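(* Let $n\ge1$ be a sample size, $A\ge1$, $\alpha\in(0,A]$ a privacy level with $n\alpha^2\ge2$, let $\delta>0$ and $\beta>0$ be smoothness parameters and $R>0$ a radius with $R^2\ge d$. For every $J\in\mathcal M_n^\alpha$ consider the Coordinate dyadic block privacy mechanism $Q^{(J)}$ with the block privacy levels $\alpha_{\boldsymbol\ell}$ given in the context and the corresponding private projection estimator $\hat f_J$, and let $\hat J$ be a minimizer over $\mathcal M_n^\alpha$ of $\widehat{\mathrm{Crit}}(J)=\hat A(J)+2V(J)$. Then $$\sup_{f}\ \mathbb E\left[d_{\mathcal W^\delta(1)}(\hat f_{\hat J},f)\right]\le \begin{cases} C\left(\dfrac{n\alpha^2}{\log(n\alpha^2)}\right)^{-\frac{\beta+\delta}{2\beta+2d}} & \text{if }\delta<d,\\[6pt] C\left(\dfrac{n\alpha^2}{[\log(n\alpha^2)]^{4d+1}}\right)^{-1/2} & \text{if }\delta=d,\\[6pt] C\left(\dfrac{n\alpha^2}{\log(n\alpha^2)}\right)^{-1/2} & \text{if }\delta>d, \end{cases}$$ where the supremum is over all probability densities $f\in\mathcal W^\beta(R)$ and $C=C_{A,d,\delta,\beta,R}$ is a constant depending only on $A,d,\delta,\beta,R$.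
   Context: $d\ge1$ is an integer, $\mathbb N=\{0,1,2,\dots\}$, $\mathbb N^*$ the positive integers. Fourier basis: $\varphi_1(t)=1$, $\varphi_{2j}(t)=\sqrt2\cos(2\pi jt)$, $\varphi_{2j+1}(t)=\sqrt2\sin(2\pi jt)$ for $j\in\mathbb N^*$, $t\in[0,1]$; $\varphi_{\mathbf j}(x)=\prod_{m=1}^d\varphi_{j_m}(x_m)$ for $\mathbf j\in(\mathbb N^* )^d$, $x\in[0,1]^d$; $\theta_{\mathbf j}(f)=\int_{[0,1]^d}f\varphi_{\mathbf j}$. Sobolev ball: $\mathcal W^\beta(R)=\{f\in L_2([0,1]^d):\sum_{\mathbf j\in(\mathbb N^* )^d}(j_1^{2\beta}+\dots+j_d^{2\beta})\theta_{\mathbf j}^2(f)\le R^2\}$. Adversarial loss: $d_{\mathcal G}(f_1,f_2)=\sup_{g\in\mathcal G}\int_{[0,1]^d}(f_1-f_2)g$. Dyadic blocks, for $J=2^{L+1}-1$: for $\boldsymbol\ell\in\{0,\dots,L\}^d$, $\mathcal J_{\boldsymbol\ell}=\prod_{m=1}^d\{2^{\ell_m},\dots,2^{\ell_m+1}-1\}$, with cardinality $d_{\boldsymbol\ell}=\prod_{m=1}^d2^{\ell_m}$; these blocks partition $\{1,\dots,J\}^d$. Block privacy levels: $\alpha_{\boldsymbol\ell}=\frac{\alpha}{S_{d,\delta}(J)}d_{\boldsymbol\ell}^{(1-\delta/d)/2}$, $S_{d,\delta}(J)=\sum_{\boldsymbol\ell\in\{0,\dots,L\}^d}d_{\boldsymbol\ell}^{(1-\delta/d)/2}$.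 Coordinate dyadic block privacy mechanism $Q^{(J)}$: let $B_0=2^{d/2}$. From $X\in[0,1]^d$ one generates $Z=(Z_{\mathbf j})_{\mathbf j\in\{1,\dots,J\}^d}$ by performing the following independently for every block $\boldsymbol\ell$, writing $v_{[\boldsymbol\ell]}=(v_{\mathbf j})_{\mathbf j\in\mathcal J_{\boldsymbol\ell}}$. (a) Draw $\tilde V_{[\boldsymbol\ell]}\in\{-B_0,B_0\}^{d_{\boldsymbol\ell}}$ with independent coordinates, $\tilde V_{\mathbf j}=B_0$ with probability $\frac12+\frac{\varphi_{\mathbf j}(X)}{2B_0}$ and $-B_0$ otherwise. (b) Put $B_{d_{\boldsymbol\ell}}(\alpha_{\boldsymbol\ell})=B_0\frac{e^{\alpha_{\boldsymbol\ell}}+1}{e^{\alpha_{\boldsymbol\ell}}-1}\Gamma_{d_{\boldsymbol\ell}}$, where $\frac1{\Gamma_k}=\frac1{2^{k-1}}\binom{k-1}{\lfloor(k-1)/2\rfloor}$. (c) Conditionally on $\tilde V_{[\boldsymbol\ell]}=\tilde v$, and independently of $X$, draw a Bernoulli variable $Y_{\boldsymbol\ell}$ of parameter $p_{\boldsymbol\ell}=1$ if $d_{\boldsymbol\ell}$ is odd and $p_{\boldsymbol\ell}=1-2^{-d_{\boldsymbol\ell}}\binom{d_{\boldsymbol\ell}}{d_{\boldsymbol\ell}/2}$ if $d_{\boldsymbol\ell}$ is even. If $Y_{\boldsymbol\ell}=1$, draw a Bernoulli variable $T_{\boldsymbol\ell}$ of parameter $\frac{e^{\alpha_{\boldsymbol\ell}}}{1+e^{\alpha_{\boldsymbol\ell}}}$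 and draw $Z_{[\boldsymbol\ell]}$ uniformly in the set of $z\in\{\pm B_{d_{\boldsymbol\ell}}(\alpha_{\boldsymbol\ell})\}^{d_{\boldsymbol\ell}}$ with $\langle z,\tilde v\rangle>0$ if $T_{\boldsymbol\ell}=1$, with $\langle z,\tilde v\rangle<0$ if $T_{\boldsymbol\ell}=0$. If $Y_{\boldsymbol\ell}=0$, draw $Z_{[\boldsymbol\ell]}$ uniformly in the set of such $z$ with $\langle z,\tilde v\rangle=0$. $Q^{(J)}$ applies this to each individual $X_i$ independently, producing $Z_i=(Z_{i,\mathbf j})_{\mathbf j}$, where $X_1,\dots,X_n$ are i.i.d. with density $f$ on $[0,1]^d$. The data are privatized anew for each $J$. Private projection estimator: $\hat f_J=\sum_{\mathbf j\in\{1,\dots,J\}^d}\hat\theta_{\mathbf j}\varphi_{\mathbf j}$ with $\hat\theta_{\mathbf j}=\frac1n\sum_{i=1}^nZ_{i,\mathbf j}$, computed from the data privatized by $Q^{(J)}$. Model collection: $\mathcal M_n^\alpha=\{J=2^{L+1}-1:\ L\in\mathbb N,\ 0\le L\le\lfloor\log_2(1+n\alpha^2)\rfloor-1\}$. Selection criterion: $\tau_{A,d}=2\sqrt{\frac{2^d}{d}}\,\frac{A(e^A+1)}{e^A-1}$; $\Sigma_J=\sum_{\boldsymbol\ell\in\{0,\dots,L\}^d}\frac1{\sqrt n}\frac{d_{\boldsymbol\ell}^{1-\delta/d}}{\alpha_{\boldsymbol\ell}}$ (equal to $S_{d,\delta}(J)^2/\sqrt{n\alpha^2}$ for the block privacy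 levels $\alpha_{\boldsymbol\ell}=\frac{\alpha}{S_{d,\delta}(J)}d_{\boldsymbol\ell}^{(1-\delta/d)/2}$); $V(J)=\sqrt2\,\tau_{A,d}\Sigma_J\sqrt{d\log J+\tfrac32\log(n\alpha^2)+\log(\tau_{A,d}\Sigma_J)}$; $\hat A(J)=\max_{J'\in\mathcal M_n^\alpha}\left(d_{\mathcal W^\delta(1)}(\hat f_{J'},\hat f_{J'\wedge J})-2V(J')\right)_+$, with $x_+=\max(0,x)$ and $J\wedge J'=\min(J,J')$. *)

(* Defs.v *)
From HB Require Import structures.
From mathcomp Require Import all_boot all_order all_algebra.
From mathcomp Require Import all_classical all_reals all_analysis.

Set Implicit Arguments.
Unset Strict Implicit.
Unset Printing Implicit Defensive.

Import Order.TTheory GRing.Theory Num.Theory.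
Import numFieldNormedType.Exports.

Local Open Scope classical_set_scope.
Local Open Scope ring_scope.

Section lebesgue_tuple.
Context {R : realType}.
Local Notation T := (measurableTypeR R).

(* Lebesgue measure on R^n, by recursion on n: the image of the product of the
   one-dimensional Lebesgue measure with the n-dimensional one under
   (t, x) |-> t :: x. *)
Definition tcons n (p : (T * n.-tuple T)%type) : n.+1.-tuple T :=
  [tuple of p.1 :: p.2].
Definition tuncons n (t : n.+1.-tuple T) : (T * n.-tuple T)%type :=
  (thead t, [tuple of behead t]).

Lemma measurable_tcons n : measurable_fun setT (@tcons n).
Proof. exact: measurable_cons. Qed.
Lemma measurable_tuncons n : measurable_fun setT (@tuncons n).
Proof.
by apply/measurable_fun_pairP; split;
  [exact: measurable_tnth|exact: measurable_behead].
Qed.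
Lemma tconsK n : cancel (@tcons n) (@tuncons n).
Proof. by move=> [x t]; congr (_, _); apply: val_inj. Qed.
Lemma tunconsK n : cancel (@tuncons n) (@tcons n).
Proof. by move=> t; rewrite [in RHS](tuple_eta t). Qed.


Section step.
Variables (n : nat) (m : {sigma_finite_measure set (n.-tuple T) -> \bar R}).

Definition lebesgue_tupleS : set (n.+1.-tuple T) -> \bar R :=
  pushforward (lebesgue_measure \x m)%E (@tcons n).

Let mtcons A : measurable A -> measurable (@tcons n @^-1` A).
Proof.
by move=> mA; rewrite -[X in measurable X]setTI; exact: measurable_tcons.
Qed.

Let push0 : lebesgue_tupleS set0 = 0%E.
Proof. by rewrite /lebesgue_tupleS /pushforward preimage_set0 measure0. Qed.

Let push_ge0 A : (0 <= lebesgue_tupleS A)%E.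
Proof. by rewrite /lebesgue_tupleS /pushforward; apply: measure_ge0. Qed.

Let push_sigma_additive : semi_sigma_additive lebesgue_tupleS.
Proof.
move=> F mF tF mUF; rewrite /lebesgue_tupleS /pushforward preimage_bigcup.
apply: measure_semi_sigma_additive.
- by move=> k; exact: mtcons.
- apply/trivIsetP => /= i j _ _ ij; rewrite -preimage_setI.
  by move/trivIsetP : tF => /(_ _ _ _ _ ij) ->//; rewrite preimage_set0.
- by rewrite -preimage_bigcup; exact: mtcons.
Qed.

HB.instance Definition _ := isMeasure.Build _ _ _ lebesgue_tupleS
  push0 push_ge0 push_sigma_additive.

Let push_sigma_finite : sigma_finite setT lebesgue_tupleS.
Proof.
have /sigma_finiteP[F [TF ndF Foo]] := sigma_finiteT (@lebesgue_measure R).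
have /sigma_finiteP[G [TG ndG Goo]] := sigma_finiteT m.
exists (fun k => @tuncons n @^-1` (F k `*` G k)).
  rewrite -preimage_bigcup (_ : \bigcup_k _ = setT) ?preimage_setT//.
  rewrite -setXTT TF TG predeqE => -[x y]; split=> [[k _ []/= ? ?]|].
    by split; exists k.
  move=> [/= [i _ Fx] [k _ Gy]]; exists (maxn i k) => //; split.
  - by move: x Fx; exact/subsetPset/ndF/leq_maxl.
  - by move: y Gy; exact/subsetPset/ndG/leq_maxr.
move=> k; have [mF Fk] := Foo k; have [mG Gk] := Goo k; split.
  rewrite -[X in measurable X]setTI; apply: measurable_tuncons => //.
  exact: measurableX.
rewrite /= /lebesgue_tupleS /pushforward -comp_preimage (_ : _ \o _ = id).
  by rewrite preimage_id product_measure1E// lte_mul_pinfty// ge0_fin_numE.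
by apply/funext => p /=; rewrite tconsK.
Qed.

HB.instance Definition _ := Measure_isSigmaFinite.Build _ _ _ lebesgue_tupleS
  push_sigma_finite.
End step.

Fixpoint lebesgue_tuple n : {sigma_finite_measure set (n.-tuple T) -> \bar R} :=
  match n with
  | 0 => \d_ ([tuple] : 0.-tuple T)
  | k.+1 => lebesgue_tupleS (lebesgue_tuple k)
  end.

Lemma lebesgue_tuple_box n (A : 'I_n -> set T) :
  (forall i, measurable (A i)) ->
  lebesgue_tuple n [set x | forall i, A i (tnth x i)] =
  (\prod_(i < n) lebesgue_measure (A i))%E.
Proof.
elim: n A => [A _|n ih A mA].
  by rewrite big_ord0 /= diracE mem_set//= => -[].
rewrite big_ord_recl -ih//= /lebesgue_tupleS /pushforward.
have mB : measurable
    [set x : n.-tuple T | forall i, A (lift ord0 i) (tnth x i)].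
  rewrite (_ : [set _ | _] = \bigcap_(i in [set: 'I_n])
      ((@tnth n T)^~ i @^-1` A (lift ord0 i))).
    apply: fin_bigcap_measurable => // i _.
    by rewrite -[X in measurable X]setTI; exact: measurable_tnth.
  by apply/seteqP; split => x /= h i; [move=> _|]; exact: h.
rewrite -product_measure1E//; congr (_ _).
apply/seteqP; split => -[t x] /= => [h|[h0 h] i].
  split=> [|i]; first exact: (h ord0).
  by have := h (lift ord0 i); rewrite tnthS.
by case: (unliftP ord0 i) => [k ->|-> //]; rewrite tnthS.
Qed.

End lebesgue_tuple.

Section fourier.
Context {R : realType}.

Definition vec d := d.-tuple (measurableTypeR R).

Definition cube d : set (vec d) :=
  [set x | forall m, 0 <= (tnth x m : R) <= 1].

Definition fourier1 (k : nat) (t : R) : R :=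
  if k == 1%N then 1
  else if odd k then Num.sqrt 2 * sin (2 * pi * k./2%:R * t)
  else Num.sqrt 2 * cos (2 * pi * k./2%:R * t).

Definition fourier d (j : 'I_d -> nat) (x : vec d) : R :=
  \prod_(m < d) fourier1 (j m) (tnth x m).

(* Functions on [0, 1]^d are functions on R^d whose values outside the cube are
   never used. *)
Definition L2cube d : set (vec d -> R) :=
  [set f : vec d -> R |
    patch (fun=> 0) (@cube d) f \in Lfun (lebesgue_tuple d) 2%:E].

Definition theta d (f : vec d -> R) (j : 'I_d -> nat) : R :=
  \int[lebesgue_tuple d]_(x in @cube d) (f x * fourier j x).

Definition sobolev d (beta r : R) : set (vec d -> R) :=
  [set f : vec d -> R | @L2cube d f /\
    (\esum_(j in [set j : {ffun 'I_d -> nat} | forall m, (0 < j m)%N])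
       ((\sum_(m < d) (j m)%:R `^ (2 * beta)) * theta f j ^+ 2)%:E
     <= (r ^+ 2)%:E)%E].

Definition adversarial_loss d (G : set (vec d -> R)) (f1 f2 : vec d -> R) :
    \bar R :=
  ereal_sup [set (\int[lebesgue_tuple d]_(x in @cube d)
                    ((f1 x - f2 x) * g x)%:E)%E | g in G].

Definition density d : set (vec d -> R) :=
  [set f : vec d -> R | [/\ measurable_fun (@cube d) f,
                (forall x, @cube d x -> 0 <= f x) &
                (\int[lebesgue_tuple d]_(x in @cube d) (f x)%:E = 1)%E]].

End fourier.
Arguments vec : clear implicits.
Arguments cube {R} d.
Arguments L2cube {R} d _.
Arguments sobolev {R} d.
Arguments density {R} d.

Section blocks.
Context {R : realType}.
Variables (d J : nat).

(* The level L of J = 2 ^ (L + 1) - 1. *)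
Definition level : nat := trunc_log 2 J.

(* [j : mindex] stands for the multi-index (j_m + 1)_m of {1, ..., J}^d. *)
Definition mindex := {ffun 'I_d -> 'I_J}.
Definition mval (j : mindex) : 'I_d -> nat := fun m => (j m).+1.

Definition lindex := {ffun 'I_d -> 'I_level.+1}.

Definition block (l : lindex) : {set mindex} :=
  [set j : mindex | [forall m, (2 ^ l m <= mval j m <= 2 ^ (l m).+1 - 1)%N]].

Definition block_dim (l : lindex) : nat := (\prod_(m < d) 2 ^ l m)%N.

Definition block_weight (delta : R) (l : lindex) : R :=
  (block_dim l)%:R `^ ((1 - delta / d%:R) / 2).

Definition total_weight (delta : R) : R :=
  \sum_(l : lindex) block_weight delta l.

Definition block_privacy (alpha delta : R) (l : lindex) : R :=
  alpha / total_weight delta * block_weight delta l.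

End blocks.

(* A vector of {- b, b}^K is encoded by its signs [v : {ffun K -> bool}], the
   entry of sign [s] being [with_sign b s]. *)
Section block_mechanism.
Context {R : realType} {K : finType}.
Implicit Types (v z : {ffun K -> bool}) (b : R).

Definition with_sign b (s : bool) : R := if s then b else - b.

Definition inner b z b' v : R :=
  \sum_(j : K) with_sign b (z j) * with_sign b' (v j).

Definition uniform_mass (T : finType) (A : {set T}) (z : T) : R :=
  (z \in A)%:R / #|A|%:R.

Definition bernoulli_mass (p : R) (s : bool) : R := if s then p else 1 - p.

(* Law of the signs of the randomized basis vector V, for the values [phi j] of
   the basis functions at X. *)
Definition randomized_signs b0 (phi : K -> R) v : R :=
  \prod_(j : K) bernoulli_mass (1 / 2 + phi j / (2 * b0)) (v j).

Definition Gamma_ (k : nat) : R :=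
  ('C(k.-1, k.-1./2)%:R / 2 ^+ k.-1)^-1.

Definition amplitude b0 (k : nat) (a : R) : R :=
  b0 * ((expR a + 1) / (expR a - 1)) * Gamma_ k.

Definition nontie_prob (k : nat) : R :=
  if odd k then 1 else 1 - 'C(k, k./2)%:R / 2 ^+ k.

Definition truth_prob (a : R) : R := expR a / (1 + expR a).

(* Law of the signs of the output Z given the signs [v] of V, for a block of
   dimension [k] and privacy level [a]. *)
Definition released_signs b0 (k : nat) (a : R) v z : R :=
  let b := amplitude b0 k a in
  \sum_(y : bool) bernoulli_mass (nontie_prob k) y *
    (if y then
       \sum_(t : bool) bernoulli_mass (truth_prob a) t *
         (if t then uniform_mass [set z' | 0 < inner b z' b0 v] z
          else uniform_mass [set z' | inner b z' b0 v < 0] z)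
     else uniform_mass [set z' | inner b z' b0 v == 0] z).

Definition block_mass b0 (k : nat) (a : R) (phi : K -> R) z : R :=
  \sum_(v : {ffun K -> bool})
    randomized_signs b0 phi v * released_signs b0 k a v z.

End block_mechanism.

Section mechanism.
Context {R : realType}.
Variables (d n : nat) (alpha delta : R).

Definition B0 : R := 2 `^ (d%:R / 2).

Definition block_amplitude J (l : lindex d J) : R :=
  amplitude B0 (block_dim l) (block_privacy alpha delta l).

(* Mass that the mechanism of resolution J, applied to [x], gives to the output
   with signs [z]. *)
Definition mechanism_mass J (x : vec R d) (z : {ffun mindex d J -> bool}) : R :=
  \prod_(l : lindex d J)
    @block_mass R {j | j \in block l} B0 (block_dim l)
      (block_privacy alpha delta l)
      (fun j => fourier (mval (val j)) x) [ffun j => z (val j)].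

Definition models : seq nat :=
  [seq (2 ^ L.+1 - 1)%N |
    L <- iota 0 (Num.truncn (ln (1 + n%:R * alpha ^+ 2) / ln 2))].

(* Joint law of X_1, ..., X_n and of the private views Z_{i, j} computed by the
   mechanism of each resolution J in the collection: the X_i are i.i.d. with
   density f and, given the X_i, the views are drawn independently over i and
   J. *)
Definition privatized_sample disp (Omega : measurableType disp)
    (P : probability Omega R) (f : vec R d -> R)
    (X : 'I_n -> {mfun Omega >-> vec R d})
    (Z : forall J, 'I_n -> mindex d J -> {mfun Omega >-> R}) : Prop :=
  forall (A : 'I_n -> set (vec R d))
         (z : forall J, 'I_n -> {ffun mindex d J -> bool}),
    (forall i, measurable (A i)) ->
    (P [set w | (forall i, A i (X i w)) /\
         (forall J i (l : lindex d J) j, J \in models -> j \in block l ->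
            Z J i j w = with_sign (block_amplitude l) (z J i j))] =
     \prod_(i < n) \int[lebesgue_tuple d]_(x in cube d `&` A i)
       (f x * \prod_(J <- models) mechanism_mass x (z J i))%:E)%E.

End mechanism.

Section selection.
Context {R : realType}.
Variables (d n : nat) (A alpha delta : R).

Definition views := forall J, 'I_n -> mindex d J -> R.
Implicit Type Z : views.

Definition theta_hat Z J (j : mindex d J) : R := n%:R^-1 * \sum_(i < n) Z J i j.

Definition estimator Z J (x : vec R d) : R :=
  \sum_(j : mindex d J) theta_hat Z j * fourier (mval j) x.

Definition tau : R :=
  2 * Num.sqrt (2 ^+ d / d%:R) * (A * (expR A + 1) / (expR A - 1)).

Definition Sigma_ J : R :=
  \sum_(l : lindex d J) (Num.sqrt n%:R)^-1 *
    ((block_dim l)%:R `^ (1 - delta / d%:R) / block_privacy alpha delta l).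

Definition threshold J : R :=
  Num.sqrt 2 * tau * Sigma_ J *
  Num.sqrt (d%:R * ln J%:R + 3 / 2 * ln (n%:R * alpha ^+ 2)
            + ln (tau * Sigma_ J)).

Definition A_hat Z J : \bar R :=
  (\big[maxe/0]_(J' <- models n alpha)
     maxe 0 (adversarial_loss (sobolev d delta 1)
               (estimator Z J') (estimator Z (minn J' J)) - (2 * threshold J')%:E))%E.

Definition Crit Z J : \bar R := (A_hat Z J + (2 * threshold J)%:E)%E.

Definition is_selected Z (Jhat : nat) : Prop :=
  Jhat \in models n alpha /\
  forall J, J \in models n alpha -> (Crit Z Jhat <= Crit Z J)%E.

Definition rate (beta : R) : R :=
  let N := n%:R * alpha ^+ 2 in
  if delta < d%:R then (N / ln N) `^ (- ((beta + delta) / (2 * beta + 2 * d%:R)))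
  else if delta == d%:R then (N / ln N ^+ (4 * d + 1)) `^ (- (1 / 2))
  else (N / ln N) `^ (- (1 / 2)).

End selection.

(* Main.v *)
Require Import Defs.
From HB Require Import structures.
From mathcomp Require Import all_boot all_order all_algebra.
From mathcomp Require Import reals sequences exp.
From mathcomp Require Import ring lra zify.
Import Order.TTheory GRing.Theory Num.Theory.
Local Open Scope ring_scope.
Set Implicit Arguments.
Unset Strict Implicit.
Unset Printing Implicit Defensive.

(** The estimator selected by the criterion is controlled by an oracle inequality,
    and the oracle is then a choice of resolution in closed form.

    The loss pairs the error [hat f_J - f] with test functions [g] in a Sobolev
    ball of smoothness [delta]. In Fourier coordinates this pairing splits into a
    noise part, [sum_j (hat theta_j - theta_j(f)) theta_j(g)] over the frequencies
    up to [J], and a bias part carried by the frequencies beyond [J]. The bias part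
    is at most [r (J + 1)^(-(beta + delta))], since both smoothness classes damp
    high frequencies ([bias]). This uses Parseval's identity, hence the
    completeness of the trigonometric system: indicators of half-spaces are limits
    of polynomials in trigonometric polynomials, the sets with approximable
    indicators form a sigma-algebra ([good_measurable]), and simple functions do
    the rest ([approx_sqint]).

    For the noise part, the mechanism is unbiased ([mean_mechanism]): given the
    randomized signs, the output is a uniform vote for or against them, and its
    mean is computed from the number of majorities that hinge on one coordinate
    ([sum_sgn_majority]). So each coordinate [Z_ij] is a sign with mean
    [theta_j(f)] times the amplitude of its block, and its centred sums are
    sub-Gaussian ([exp_moment]). On a block of dimension [d_l], the
    Cauchy-Schwarz inequality weighs this noise against the energy of [g], which
    is at most [d_l^(- 2 delta / d) / d] by the inequality between arithmetic and
    geometric means. With the amplitudes of the mechanism, the blocks add up to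
    [tau Sigma] ([noise_bound]). The noise is thus at most the threshold [V(J)] plus
    an excess, whose expectation is of order [N^(-3/2)] for [N = n alpha^2]
    ([integral_excess]).

    Comparing the selected and a competing estimator through the one at the smaller
    of their levels gives a loss of at most [7 V(J) + 5 b(J)] plus 5 times the sum
    of all excesses, for every [J] of the collection ([oracle_inequality]). The sum
    of the excesses has expectation of order [1 / sqrt N], because there are at
    most [N] levels ([risk_bound]).

    It remains to choose [J]. Up to constants, [V(J)] is [S(J)^2 sqrt (ln N / N)]
    ([threshold_le]), where the total weight [S(J)] is the [d]-th power of a
    geometric sum ([total_weightE]). This sum is bounded if [delta > d], equal to
    the number of levels if [delta = d], and of order [J^((1 - delta / d) / 2)] if
    [delta < d]. In the first two cases the finest level is taken; in the third
    one, [J] is of order [(N / ln N)^(1 / (2 beta + 2 d))], where bias and variance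
    balance ([attained_smooth], [attained_critical], [attained_rough]). *)

(** * Products over the blocks of a partition *)

Section blockwise.
Context {R : comPzRingType} {K I : finType} (block : I -> {set K}) (p : K -> I).
Hypothesis blockP : forall j l, (j \in block l) = (p j == l).

Let in_own j : j \in block (p j). Proof. by rewrite blockP. Qed.

(** Choosing signs on all coordinates is choosing them block by block: this
    factorizes the sums over the outputs of a resolution. *)
Lemma sum_blockwise (F : forall l, {ffun {j | j \in block l} -> bool} -> R) :
  \sum_(z : {ffun K -> bool}) \prod_l F l [ffun j => z (val j)] =
  \prod_l \sum_u F l u.
Proof.
pose T l : finType := {ffun {j | j \in block l} -> bool}.
pose glue (t : fprod T) : {ffun K -> bool} :=
  [ffun j => (t (p j) : {ffun _ -> bool}) (exist _ j (in_own j))].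
pose cut (z : {ffun K -> bool}) : fprod T :=
  [fprod l => [ffun j : {j | j \in block l} => z (val j)]].
have glueK : cancel glue cut.
  move=> t; apply/fprodP => l; rewrite fprodE; apply/ffunP => -[j jl].
  rewrite !ffunE /=; have e : p j = l by apply/eqP; rewrite -blockP.
  by case: _ / e jl => jl; congr ((t (p j) : {ffun _ -> bool}) _); exact: val_inj.
have cutK : cancel cut glue.
  by move=> z; apply/ffunP => j; rewrite ffunE fprodE ffunE.
rewrite (reindex glue); last by exists cut => ? _; [exact: glueK|exact: cutK].
transitivity (\sum_(t : fprod T) \prod_l [ffun u : T l => F l u] (t l)).
  apply: eq_bigr => t _; apply: eq_bigr => l _; rewrite ffunE; congr (F l _).
  by rewrite -[in RHS](glueK t) fprodE.
rewrite big_fprod -(bigA_distr_big_dep _ (fun l a => untag 0 [ffun u : T l => F l u] a)).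
apply: eq_bigr => l _.
rewrite -(big_tag (fun l => [ffun u : T l => F l u] : T l -> R) l).
by apply: eq_bigr => u _; rewrite ffunE.
Qed.

End blockwise.

(** * Counting majorities *)

Section majority_counts.
Context {K : finType}.
Local Notation k := #|K|.
Implicit Types (A : {set K}) (j : K).

(** A voter set stands for the coordinates on which the output agrees with the
    randomized basis vector. *)
Definition majority : {set {set K}} := [set A : {set K} | k < #|A|.*2]%N.
Definition minority : {set {set K}} := [set A : {set K} | #|A|.*2 < k]%N.
Definition ties : {set {set K}} := [set A : {set K} | #|A|.*2 == k]%N.

Lemma setC_majority A : (~: A \in majority) = (A \in minority).
Proof. by rewrite !inE; have := cardsC A; rewrite -cardsT; lia. Qed.

Lemma setC_ties A : (~: A \in ties) = (A \in ties).
Proof. by rewrite !inE; have := cardsC A; rewrite -cardsT; lia. Qed.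

Lemma sum_minority (V : nmodType) (F : {set K} -> V) :
  \sum_(A in minority) F A = \sum_(A in majority) F (~: A).
Proof.
rewrite (reindex_inj (inv_inj (@setCK _))) /=.
by apply: eq_bigl => A; rewrite -setC_majority setCK.
Qed.

Lemma card_minority : #|minority| = #|majority|.
Proof. by rewrite -!sum1_card sum_minority. Qed.

Lemma card_ties : #|ties| = (if odd k then 0 else 'C(k, k./2))%N.
Proof.
case: ifP => ok.
  by apply/eqP; rewrite cards_eq0; apply/eqP/setP => A; rewrite !inE; lia.
by rewrite -card_draws; apply: eq_card => A; rewrite !inE; lia.
Qed.

Lemma card_majority : (#|majority|.*2 + #|ties| = 2 ^ k)%N.
Proof.
rewrite -[k]cardsT -card_powerset -addnn -{1}card_minority.
have d1 : [disjoint minority & majority].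
  by apply/pred0Pn => -[A /=]; rewrite !inE; lia.
have d2 : [disjoint (minority :|: majority) & ties].
  by apply/pred0Pn => -[A /=]; rewrite !inE; lia.
move: d1 d2; rewrite -!leq_card_setU => /eqP <- /eqP <-.
by apply: eq_card => A; rewrite !inE subsetT; lia.
Qed.

Lemma majority_gt0 : (0 < k)%N -> (0 < #|majority|)%N.
Proof. by move=> k0; apply/card_gt0P; exists setT; rewrite inE cardsT; lia. Qed.

End majority_counts.

Section majority_signs.
Context {R : realFieldType} {K : finType}.
Local Notation k := #|K|.
Implicit Types (A : {set K}) (j : K).

Definition sgn A j : R := if j \in A then 1 else -1.

Lemma sgnC A j : sgn (~: A) j = - sgn A j.
Proof. by rewrite /sgn inE; case: (j \in A); rewrite ?opprK. Qed.

Lemma sum_sgn_minority j :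
  \sum_(A in minority) sgn A j = - \sum_(A in majority) sgn A j.
Proof. by rewrite sum_minority -sumrN; apply: eq_bigr => A _; rewrite sgnC. Qed.

Lemma sum_sgn_ties j : \sum_(A in ties) sgn A j = 0 :> R.
Proof.
have : \sum_(A in ties) sgn A j = - \sum_(A in ties) sgn A j.
  rewrite [LHS](reindex_inj (inv_inj (@setCK K))) /= -sumrN.
  by apply: eq_big => A; rewrite ?setC_ties ?sgnC.
by move=> ?; lra.
Qed.

Lemma subset_setC1 A j : (A \subset [set~ j]) = (j \notin A).
Proof.
apply/subsetP/idP => [h|jA x xA]; last by rewrite !inE; apply: contraNneq jA => <-.
by apply/negP => /h; rewrite !inE eqxx.
Qed.

(** Toggling [j] cancels the majorities that do not hinge on it; the others are
    the sets avoiding [j] that lack exactly one vote. *)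
Lemma sum_sgn_majority j :
  \sum_(A in majority) sgn A j = 'C(k.-1, k.-1./2)%:R :> R.
Proof.
have k0 : (0 < k)%N by apply/card_gt0P; exists j.
pose N := [set A : {set K} | A \subset [set~ j]].
rewrite (bigID (fun A => j \in A)) /=.
have -> : \sum_(A in majority | j \in A) sgn A j =
    \sum_(A in N | (k < #|A|.*2.+2)%N) 1.
  rewrite (reindex_onto (fun A => j |: A) (fun A => A :\ j)) /=; last first.
    by move=> A /andP[_ jA]; rewrite setD1K.
  apply: eq_big => [A|A /andP[/andP[_ jA] _]]; last by rewrite /sgn jA.
  rewrite !inE eqxx /= andbT subset_setC1 /=.
  have [jA|jA] := boolP (j \in A).
    rewrite andbC [in LHS](_ : (_ == A) = false)//; apply/eqP => e.
    by move: jA; rewrite -e !inE eqxx.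
  by rewrite setU1K// eqxx cardsU1 jA /= andbT add1n doubleS.
have -> : \sum_(A in majority | j \notin A) sgn A j =
    - \sum_(A in N | (k < #|A|.*2)%N) 1.
  rewrite -sumrN; apply: eq_big => [A|A /andP[_ /negbTE jA]]; last by rewrite /sgn jA.
  by rewrite !inE subset_setC1 /= andbC.
rewrite (bigID (fun A => k < #|A|.*2)%N) /=.
rewrite [X in X + _ - _](eq_bigl (fun A => (A \in N) && (k < #|A|.*2)%N)); last first.
  by move=> A /=; lia.
rewrite addrAC subrr add0r sumr_const.
have -> : 'C(k.-1, k.-1./2) = 'C(k.-1, k./2).
  have [ok|ok] := boolP (odd k); first by congr 'C(_, _); lia.
  by rewrite -bin_sub; [congr 'C(_, _); lia|lia].
rewrite -[k.-1 in RHS](cardsC1 j) -cards_draws; congr (_%:R).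
apply: eq_card => A; rewrite !inE; rewrite -topredE /= !inE; case: (A \subset _) => //=; lia.
Qed.

End majority_signs.

(** * Moments of the mechanism on one block *)

Section block_moments.
Context {R : realType} {K : finType} (b0 a : R).
Hypotheses (b0_gt0 : 0 < b0) (a_gt0 : 0 < a) (K_gt0 : (0 < #|K|)%N).
Local Notation k := #|K|.
Local Notation b := (amplitude b0 k a).
Implicit Types (v z : {ffun K -> bool}) (j : K).

(** Given [v], a sign vector is determined by its agreement set with [v], and the
    sign of its inner product with [v] says whether that set is a majority. *)
Definition flip v (A : {set K}) : {ffun K -> bool} :=
  [ffun j => if j \in A then v j else ~~ v j].
Definition agree v z : {set K} := [set j | z j == v j].

Lemma agreeK v : cancel (flip v) (agree v).
Proof.
move=> A; apply/setP => j; rewrite !inE ffunE; case: ifP => _; first by rewrite eqxx.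
by case: (v j).
Qed.

Lemma flipK v : cancel (agree v) (flip v).
Proof.
move=> z; apply/ffunP => j; rewrite ffunE inE; case: eqP => [->//|].
by case: (v j); case: (z j).
Qed.

Lemma with_sign_flip (c : R) v A j :
  with_sign c (flip v A j) = sgn A j * with_sign c (v j).
Proof.
by rewrite /with_sign /sgn ffunE; case: (j \in A); case: (v j) => /=;
  rewrite ?mul1r ?mulN1r ?opprK.
Qed.

Lemma sum_sgn (A : {set K}) : \sum_(j : K) sgn A j = #|A|.*2%:R - k%:R :> R.
Proof.
rewrite (bigID (fun j => j \in A)) /= (eq_bigr (fun=> 1)); last first.
  by move=> j jA; rewrite /sgn jA.
rewrite [X in _ + X = _](eq_bigr (fun=> -1)); last first.
  by move=> j /negbTE jA; rewrite /sgn jA.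
rewrite [X in _ + X = _](eq_bigl (mem (~: A))); last by move=> j; rewrite !inE.
by rewrite !sumr_const mulNrn -(cardsC A) -addnn !natrD; ring.
Qed.

Lemma inner_flip (c c' : R) v A :
  inner c (flip v A) c' v = c * c' * (#|A|.*2%:R - k%:R).
Proof.
have sq (s : bool) (x y : R) : with_sign x s * with_sign y s = x * y.
  by case: s => //=; rewrite mulrNN.
rewrite -sum_sgn mulr_sumr; apply: eq_bigr => j _.
by rewrite with_sign_flip -[LHS]mulrA sq mulrC.
Qed.

Let Gamma_pos : 0 < Gamma_ k :> R.
Proof.
rewrite /Gamma_ invr_gt0 divr_gt0 ?exprn_gt0// ltr0n bin_gt0.
by rewrite -divn2 leq_div.
Qed.

Let expa : 1 < expR a. Proof. by rewrite expR_gt1. Qed.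

Lemma amplitude_gt0 : 0 < b.
Proof.
have := expa => e1; rewrite /amplitude !mulr_gt0// ?invr_gt0 ?subr_gt0//.
by rewrite addr_gt0 ?expR_gt0.
Qed.

Let bb0 : 0 < b * b0. Proof. by rewrite mulr_gt0// amplitude_gt0. Qed.

Lemma inner_majority v A :
  (0 < inner b (flip v A) b0 v) = (A \in majority).
Proof. by rewrite inner_flip pmulr_rgt0// subr_gt0 ltr_nat inE. Qed.

Lemma inner_minority v A :
  (inner b (flip v A) b0 v < 0) = (A \in minority).
Proof. by rewrite inner_flip pmulr_rlt0// subr_lt0 ltr_nat inE. Qed.

Lemma inner_ties v A :
  (inner b (flip v A) b0 v == 0) = (A \in ties).
Proof. by rewrite inner_flip mulf_eq0 gt_eqF//= subr_eq0 eqr_nat inE. Qed.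

(** In terms of agreement sets, the support [S] of the uniform law no longer
    depends on [v]. *)
Lemma sum_uniform_mass v (T : {set {ffun K -> bool}}) (S : {set {set K}})
    (h : {ffun K -> bool} -> R) :
  (forall A, (flip v A \in T) = (A \in S)) ->
  \sum_z uniform_mass T z * h z = (\sum_(A in S) h (flip v A)) / #|S|%:R.
Proof.
move=> TS; have inj : injective (flip v) by exact: can_inj (agreeK v).
have -> : #|S| = #|T|.
  rewrite -(card_imset _ inj); apply: eq_card => z; rewrite -(flipK v z) TS.
  by rewrite mem_imset.
rewrite (reindex (flip v)) /=; last first.
  by exists (agree v) => ? _; [exact: agreeK|exact: flipK].
rewrite mulr_suml big_mkcond [RHS]big_mkcond /=; apply: eq_bigr => A _.
by rewrite /uniform_mass TS; case: ifP => _; rewrite ?mul0r// mul1r mulrC.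
Qed.

Let p := nontie_prob k : R.
Let q := truth_prob a.

(** The mechanism avoids ties as often as a uniform sign vector does; hence the
    uniform weights in [sum_released]. *)
Lemma nontieE : p = #|@majority K|.*2%:R / 2 ^+ k.
Proof.
have c := @card_majority K; have t := @card_ties K.
rewrite /p /nontie_prob; case: ifP t => _ t.
  by move: c; rewrite t addn0 => ->; rewrite natrX divff// expf_neq0// pnatr_eq0.
have x0 : 2 ^+ k != 0 :> R by rewrite expf_neq0// pnatr_eq0.
by rewrite -t -[X in X - _](divff x0) -mulrBl -natrX -c natrD addrK.
Qed.

Lemma tieE : 1 - p = #|@ties K|%:R / 2 ^+ k.
Proof.
have x0 : 2 ^+ k != 0 :> R by rewrite expf_neq0// pnatr_eq0.
by rewrite nontieE -[X in X - _](divff x0) -mulrBl -natrX -(@card_majority K) natrD addrC addKr.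
Qed.

Lemma sum_released v (h : {ffun K -> bool} -> R) :
  \sum_z released_signs b0 k a v z * h z =
  (q * (\sum_(A in majority) h (flip v A)) +
   (1 - q) * (\sum_(A in minority) h (flip v A)) ) * (2 / 2 ^+ k) +
  (\sum_(A in ties) h (flip v A)) / 2 ^+ k.
Proof.
have S1 := @sum_uniform_mass v [set z' | 0 < inner b z' b0 v] majority h.
have S2 := @sum_uniform_mass v [set z' | inner b z' b0 v < 0] minority h.
have S3 := @sum_uniform_mass v [set z' | inner b z' b0 v == 0] ties h.
rewrite (eq_bigr (fun z =>
  p * (q * (uniform_mass [set z' | 0 < inner b z' b0 v] z * h z) +
       (1 - q) * (uniform_mass [set z' | inner b z' b0 v < 0] z * h z)) +
  (1 - p) * (uniform_mass [set z' | inner b z' b0 v == 0] z * h z))); last first.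
  by move=> z _; rewrite /released_signs !big_bool /= /p /q; ring.
rewrite big_split /= -!mulr_sumr big_split /= -!mulr_sumr.
rewrite {}S1 ?{}S2 ?{}S3; last 3 first.
- by move=> A; rewrite inE inner_ties.
- by move=> A; rewrite inE inner_minority.
- by move=> A; rewrite inE inner_majority.
rewrite tieE nontieE card_minority.
have m0 : #|@majority K|%:R != 0 :> R by rewrite pnatr_eq0 -lt0n majority_gt0.
have t2 : 2 ^+ k != 0 :> R by rewrite expf_neq0// pnatr_eq0.
congr (_ + _).
  by rewrite -addnn natrD; field; rewrite t2 m0.
have [/eqP t0|t0] := boolP (#|@ties K| == 0%N).
  rewrite big_pred0 ?mul0r ?mulr0// => A.
  apply/negbTE/negP => At; have : (0 < #|@ties K|)%N by apply/card_gt0P; exists A.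
  by rewrite t0.
by field; rewrite t2 pnatr_eq0.
Qed.

Lemma sum_released1 v : \sum_z released_signs b0 k a v z = 1.
Proof.
have := sum_released v (fun=> 1); under eq_bigr do rewrite mulr1.
move=> ->; rewrite !sumr_const card_minority.
have := @card_majority K; move=> /(congr1 (fun n => n%:R : R)).
rewrite natrD natrX -addnn natrD.
set m := #|_|; set t := #|_| => e.
transitivity (((m%:R + m%:R) + t%:R) / 2 ^+ k : R); first by ring.
by rewrite e divff// expf_neq0// pnatr_eq0.
Qed.

(** The mean sign of the output is the excess of truthful answers over lies times
    the proportion of pivotal majorities; the amplitude is [b0] divided by this
    product, so that the output is unbiased. *)
Lemma mean_released v j :
  \sum_z released_signs b0 k a v z * with_sign b (z j) = with_sign b0 (v j).
Proof.
rewrite sum_released.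
have E S : \sum_(A in S) with_sign b (flip v A j) =
    (\sum_(A in S) sgn A j) * with_sign b (v j).
  by rewrite mulr_suml; apply: eq_bigr => A _; rewrite with_sign_flip.
rewrite !E sum_sgn_minority sum_sgn_ties sum_sgn_majority !mul0r addr0.
have [n kn] : exists n, k = n.+1 by exists k.-1; lia.
have W : with_sign b (v j) = b / b0 * with_sign b0 (v j).
  rewrite /with_sign; case: (v j); rewrite ?mulrN divfK//; exact: lt0r_neq0.
rewrite W /amplitude /q /truth_prob /Gamma_ kn /= exprS.
have C0 : 'C(n, n./2)%:R != 0 :> R.
  by rewrite pnatr_eq0 -lt0n bin_gt0 -divn2 leq_div.
have e0 := expR_gt0 a; have e1 := expa.
field; rewrite C0 (lt0r_neq0 b0_gt0) expf_neq0//=.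
by rewrite !gt_eqF//; lra.
by rewrite pnatr_eq0.
Qed.

Lemma nontie01 : 0 <= p <= 1.
Proof.
apply/andP; split; first by rewrite nontieE divr_ge0// exprn_ge0.
by rewrite -subr_ge0 tieE divr_ge0// exprn_ge0.
Qed.

Lemma truth01 : 0 <= q <= 1.
Proof.
have e0 := expR_gt0 a; have e1 : 0 < 1 + expR a by rewrite addr_gt0.
rewrite /q /truth_prob divr_ge0 ?(ltW e0) ?(ltW e1)//=.
by rewrite ler_pdivrMr// mul1r lerDr.
Qed.

Lemma released_ge0 v z : 0 <= released_signs b0 k a v z.
Proof.
have u0 (T : {set {ffun K -> bool}}) y : 0 <= uniform_mass T y :> R.
  by rewrite /uniform_mass divr_ge0.
rewrite /released_signs !big_bool /=; have := nontie01; have := truth01.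
rewrite /p /q => /andP[q0 q1] /andP[p0 p1].
by rewrite addr_ge0// mulr_ge0 ?subr_ge0// addr_ge0// mulr_ge0 ?subr_ge0.
Qed.

Section input.
Variable phi : K -> R.
Hypothesis phi_b0 : forall j, `|phi j| <= b0.

Let w j : R := 1 / 2 + phi j / (2 * b0).

Let w01 j : 0 <= w j <= 1.
Proof.
have := phi_b0 j; rewrite ler_norml => /andP[h1 h2].
have : -1 <= phi j / b0 <= 1.
  by rewrite ler_pdivlMr// ler_pdivrMr// mulN1r mul1r h1.
rewrite /w invfM mulrCA; lra.
Qed.

Lemma randomized_ge0 v : 0 <= randomized_signs b0 phi v.
Proof.
apply: prodr_ge0 => j _; have := w01 j; rewrite /w /bernoulli_mass.
by case: (v j) => /andP[? ?]; rewrite ?subr_ge0.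
Qed.

Lemma sum_randomized : \sum_v randomized_signs b0 phi v = 1.
Proof.
rewrite -(bigA_distr_bigA (fun j s => bernoulli_mass (w j) s)) big1// => j _.
by rewrite big_bool /= addrC subrK.
Qed.

(** The bias of the coin is chosen so that the randomized vector has mean [phi]. *)
Lemma mean_randomized j :
  \sum_v randomized_signs b0 phi v * with_sign b0 (v j) = phi j.
Proof.
pose F i s := bernoulli_mass (w i) s * (if i == j then with_sign b0 s else 1).
rewrite (eq_bigr (fun v : {ffun K -> bool} => \prod_i F i (v i))); last first.
  move=> v _; rewrite /F big_split /=; congr (_ * _).
  by rewrite (bigD1 j)//= eqxx big1 ?mulr1// => i /negbTE ->.
rewrite -bigA_distr_bigA (bigD1 j)//= [X in _ * X]big1 ?mulr1; last first.
  by move=> i /negbTE ij; rewrite big_bool /F ij /= !mulr1 addrC subrK.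
rewrite big_bool /F eqxx /= /w; field; exact: lt0r_neq0.
Qed.

Lemma block_mass_ge0 z : 0 <= block_mass b0 k a phi z.
Proof.
by apply: sumr_ge0 => v _; rewrite mulr_ge0 ?randomized_ge0 ?released_ge0.
Qed.

Lemma sum_block_mass : \sum_z block_mass b0 k a phi z = 1.
Proof.
rewrite /block_mass exchange_big /= -[RHS]sum_randomized; apply: eq_bigr => v _.
by rewrite -mulr_sumr sum_released1 mulr1.
Qed.

Lemma mean_block_mass j :
  \sum_z block_mass b0 k a phi z * with_sign b (z j) = phi j.
Proof.
rewrite -[RHS]mean_randomized /block_mass.
under eq_bigr do rewrite mulr_suml.
rewrite exchange_big /=; apply: eq_bigr => v _.
under eq_bigr do rewrite -mulrA.
by rewrite -mulr_sumr mean_released.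
Qed.

End input.
End block_moments.

From mathcomp Require Import all_classical all_reals all_analysis.
From mathcomp Require Import measurable_realfun.
Import numFieldNormedType.Exports.
Local Open Scope classical_set_scope.
Local Open Scope ring_scope.

(** * Square integrable functions on the cube *)

Section square_integrable.
Context {R : realType} (d : nat).
Local Notation mu := (@lebesgue_tuple R d).
Local Notation D := (@cube R d).
Implicit Types (f g h : vec R d -> R) (a b t : R).

Lemma measurable_cube : measurable D.
Proof.
rewrite (_ : D = \bigcap_(i in [set: 'I_d])
    ((@tnth d (measurableTypeR R))^~ i @^-1` `[0%R, 1%R])).
  apply: fin_bigcap_measurable => // i _.
  by rewrite -[X in measurable X]setTI; exact: measurable_tnth.
apply/seteqP; split => x /= hx i.
  by move=> _; rewrite /= in_itv/=; exact: hx.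
by have := hx i I; rewrite /= in_itv.
Qed.

Lemma lebesgue_tuple_cube : mu D = 1%E.
Proof.
rewrite (_ : D = [set x | forall i, `[0%R, 1%R]%classic (tnth x i)]).
  rewrite (@lebesgue_tuple_box _ _ (fun=> `[0%R, 1%R]%classic))// big1// => i _.
  by rewrite lebesgue_measure_itv/= lte_fin ltr01 sube0.
by apply/seteqP; split => x /= hx i; have := hx i; rewrite /= in_itv.
Qed.

Definition ip f g : R := \int[mu]_(x in D) (f x * g x).
Definition sqint f : Prop :=
  measurable_fun D f /\ mu.-integrable D (EFin \o (fun x => f x ^+ 2)).

Lemma bounded_integrable f M : measurable_fun D f ->
  (forall x, D x -> `|f x| <= M) -> mu.-integrable D (EFin \o f).
Proof.
move=> mf fM; have fin : (mu D < +oo)%E by rewrite lebesgue_tuple_cube ltry.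
apply: measurable_bounded_integrable => //.
- exact: measurable_cube.
- exists M; split; first by rewrite num_real.
  by move=> r Mr x Dx /=; apply: le_trans (fM _ Dx) (ltW Mr).
Qed.

Lemma bounded_sqint f M : measurable_fun D f ->
  (forall x, D x -> `|f x| <= M) -> sqint f.
Proof.
move=> mf fM; split=> //; apply: (@bounded_integrable _ (M ^+ 2)).
  exact: measurable_funX.
move=> x Dx; rewrite normrX ler_pXn2r// ?nnegrE ?fM//.
exact: le_trans (fM _ Dx).
Qed.

Lemma sqintM f g : sqint f -> sqint g ->
  mu.-integrable D (EFin \o (fun x => f x * g x)).
Proof.
move=> [mf if2] [mg ig2]; apply: (le_integrable measurable_cube _ _
  (integrableD measurable_cube if2 ig2)).
  by apply/measurable_EFinP; exact: measurable_funM.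
move=> x Dx /=; rewrite lee_fin normrM [leRHS]ger0_norm; last first.
  by rewrite addr_ge0// sqr_ge0.
rewrite -[f x ^+ 2]real_normK ?num_real// -[g x ^+ 2]real_normK ?num_real//.
have := sqr_ge0 (`|f x| - `|g x|); have := normr_ge0 (f x).
have := normr_ge0 (g x); nra.
Qed.

Lemma sqintZ a f : sqint f -> sqint (fun x => a * f x).
Proof.
move=> [mf if2]; split; first exact: measurable_funM.
rewrite (_ : _ \o _ = (fun x => (a ^+ 2)%:E * (f x ^+ 2)%:E)%E).
  exact: integrableZl measurable_cube _ _ if2.
by apply/funext => x /=; rewrite exprMn EFinM.
Qed.

Lemma sqintD f g : sqint f -> sqint g -> sqint (fun x => f x + g x).
Proof.
move=> sf sg; split; first by apply: measurable_funD; [case: sf|case: sg].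
have fg := sqintM sf sg; case: sf sg => [mf if2] [mg ig2].
have h := integrableD measurable_cube (integrableD measurable_cube if2 ig2)
  (integrableD measurable_cube fg fg).
rewrite (_ : _ \o _ = fun x : vec R d => ((f x ^+ 2)%:E + (g x ^+ 2)%:E +
  ((f x * g x)%:E + (f x * g x)%:E))%E)//.
by apply/funext => x /=; rewrite -!EFinD; congr EFin; ring.
Qed.

Lemma sqintB f g : sqint f -> sqint g -> sqint (fun x => f x - g x).
Proof.
move=> sf sg; rewrite (_ : (fun _ => _) = fun x => f x + (-1) * g x).
  by apply: sqintD => //; exact: sqintZ.
by apply/funext => x; rewrite mulN1r.
Qed.

Lemma sqint_sum (I : Type) (s : seq I) (F : I -> vec R d -> R) :
  (forall i, sqint (F i)) -> sqint (fun x => \sum_(i <- s) F i x).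
Proof.
move=> sF; elim: s => [|i s ih].
  rewrite (_ : (fun _ => _) = cst 0); last by apply/funext => x; rewrite big_nil.
  by apply: (@bounded_sqint _ 0) => // x _; rewrite normr0.
rewrite (_ : (fun _ => _) = fun x => F i x + \sum_(j <- s) F j x).
  exact: sqintD.
by apply/funext => x; rewrite big_cons.
Qed.

Lemma ipC f g : ip f g = ip g f.
Proof. by apply: eq_Rintegral => x _; rewrite mulrC. Qed.

Lemma ipDl f g h : sqint f -> sqint g -> sqint h ->
  ip (fun x => f x + g x) h = ip f h + ip g h.
Proof.
move=> sf sg sh; rewrite -RintegralD ?sqintM//; last exact: measurable_cube.
by apply: eq_Rintegral => x _; rewrite mulrDl.
Qed.

Lemma ipZl a f h : sqint f -> sqint h ->
  ip (fun x => a * f x) h = a * ip f h.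
Proof.
move=> sf sh; rewrite -RintegralZl ?sqintM//; last exact: measurable_cube.
by apply: eq_Rintegral => x _; rewrite mulrA.
Qed.

Lemma ipBl f g h : sqint f -> sqint g -> sqint h ->
  ip (fun x => f x - g x) h = ip f h - ip g h.
Proof.
move=> sf sg sh; rewrite -RintegralB ?sqintM//; last exact: measurable_cube.
by apply: eq_Rintegral => x _; rewrite mulrBl.
Qed.

Lemma ipBr f g h : sqint f -> sqint g -> sqint h ->
  ip f (fun x => g x - h x) = ip f g - ip f h.
Proof. by move=> sf sg sh; rewrite ipC ipBl// !(ipC f). Qed.

Lemma ip_suml (I : Type) (s : seq I) (F : I -> vec R d -> R) h :
  (forall i, sqint (F i)) -> sqint h ->
  ip (fun x => \sum_(i <- s) F i x) h = \sum_(i <- s) ip (F i) h.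
Proof.
move=> sF sh; elim: s => [|i s ih].
  rewrite big_nil /ip (eq_Rintegral _ (g := cst 0)); last first.
    by move=> x _; rewrite big_nil mul0r.
  by rewrite Rintegral_cst ?mul0r//; exact: measurable_cube.
rewrite big_cons -ih -ipDl//; last exact: sqint_sum.
by apply: eq_Rintegral => x _; rewrite big_cons.
Qed.

Lemma ip_ge0 f : 0 <= ip f f.
Proof. by apply: Rintegral_ge0 => x _; rewrite -expr2 sqr_ge0. Qed.

(** Expanding the norm of [t f - g], or of [t f + g]. Optimized over [t], this is
    the Cauchy-Schwarz inequality, but it avoids square roots. *)
Lemma ip_young t f g : 0 < t -> sqint f -> sqint g ->
  2 * `|ip f g| <= t * ip f f + t^-1 * ip g g.
Proof.
move=> t0 sf sg.
have key a : a ^+ 2 = 1 -> 2 * (a * ip f g) <= t * ip f f + t^-1 * ip g g.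
  move=> a1; have stf := sqintZ (- a * t) sf.
  have := ip_ge0 (fun x => (- a * t) * f x + g x).
  rewrite ipDl//; last exact: sqintD.
  rewrite ipZl//; last exact: sqintD.
  rewrite (ipC f) (ipC g) !ipDl// !ipZl// (ipC g f) => h.
  have {h} : 0 <= t^-1 * (- a * t * (- a * t * ip f f + ip f g) +
      (- a * t * ip f g + ip g g)) by rewrite mulr_ge0// invr_ge0 ltW.
  rewrite (_ : t^-1 * (_ + _) = a ^+ 2 * (t * ip f f) - 2 * (a * ip f g) + t^-1 * ip g g).
    by rewrite a1 mul1r => ?; lra.
  by field; rewrite gt_eqF.
case: (leP 0 (ip f g)) => h.
  by rewrite ger0_norm//; have := key 1 (expr1n _ _); rewrite mul1r.
have := key (-1); rewrite sqrrN expr1n mulN1r => /(_ erefl).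
by rewrite ltr0_norm.
Qed.

End square_integrable.

Section tensor.
Context {R : realType}.

(** Induction on the dimension, by Fubini's theorem. *)
Lemma integral_tensor d (h : 'I_d -> measurableTypeR R -> R) :
  (forall m, lebesgue_measure.-integrable setT (EFin \o h m)) ->
  (lebesgue_tuple d).-integrable setT
    (fun x : vec R d => (\prod_(m < d) h m (tnth x m))%:E) /\
  \int[lebesgue_tuple d]_x (\prod_(m < d) h m (tnth x m)) =
  \prod_(m < d) \int[lebesgue_measure]_t h m t.
Proof.
elim: d h => [|d ih] h ih_int.
  rewrite big_ord0 (eq_Rintegral _ (g := cst 1)) => [|x _]; last by rewrite big_ord0.
  have mass1 : @lebesgue_tuple R 0 [set: vec R 0] = 1%E.
    by rewrite /= diracT.
  split; last by rewrite Rintegral_cst// mul1r [X in fine X]mass1.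
  rewrite (_ : (fun _ => _) = EFin \o cst 1).
    exact: (finite_measure_integrable_cst _ 1).
  by apply/funext => x /=; rewrite big_ord0.
have [iG intG] := ih _ (fun m => ih_int (lift ord0 m)).
set G := fun x : vec R d => \prod_(m < d) h (lift ord0 m) (tnth x m).
rewrite -/G in iG intG.
set F := fun p : measurableTypeR R * vec R d => h ord0 p.1 * G p.2.
have FE p : \prod_(m < d.+1) h m (tnth (tcons p) m) = F p.
  rewrite big_ord_recl /F /G; congr (_ * _).
  by apply: eq_bigr => i _; rewrite tnthS.
have mh m : measurable_fun setT (h m).
  by have /measurable_int/measurable_EFinP := ih_int m.
have mG : measurable_fun setT G by have /measurable_int/measurable_EFinP := iG.
have mF : measurable_fun setT F.
  by apply: measurable_funM; exact: measurableT_comp.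
have mP : measurable_fun setT
    (fun x : vec R d.+1 => \prod_(m < d.+1) h m (tnth x m)).
  apply: measurable_prod => m _; apply: measurableT_comp => //.
  exact: measurable_tnth.
have iF : (lebesgue_measure \x lebesgue_tuple d)%E.-integrable setT (EFin \o F).
  apply/integrable12ltyP; first exact/measurable_EFinP.
  rewrite (_ : (fun _ => _) = fun x : measurableTypeR R => (`|h ord0 x|%:E *
      \int[lebesgue_tuple d]_y `|(G y)%:E|)%E).
    rewrite ge0_integralZr//; last 2 first.
    - by apply/measurable_EFinP; exact: measurableT_comp.
    - by apply: integral_ge0.
    apply: lte_mul_pinfty.
    - exact: integral_ge0.
    - rewrite ge0_fin_numE; last exact: integral_ge0.
      by have /integrableP[_] := ih_int ord0.
    - by have /integrableP[] := iG.
  apply/funext => x; rewrite -ge0_integralZl//; last first.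
    by apply/measurable_EFinP; exact: measurableT_comp.
  by apply: eq_integral => y _ /=; rewrite -EFinM -normrM.
have iF' : (lebesgue_measure \x lebesgue_tuple d)%E.-integrable
   (@tcons R d @^-1` setT)
   ((fun x : vec R d.+1 => (\prod_(m < d.+1) h m (tnth x m))%:E) \o @tcons R d).
  rewrite preimage_setT (_ : _ \o _ = EFin \o F)//.
  by apply/funext => p /=; rewrite FE.
split.
  apply: (integrable_pushforward (@measurable_tcons R d)) => //.
  exact/measurable_EFinP.
rewrite /Rintegral [X in fine X](integral_pushforward (@measurable_tcons R d))//;
  last exact/measurable_EFinP.
rewrite preimage_setT (_ : _ \o _ = EFin \o F); last first.
  by apply/funext => p /=; rewrite FE.
rewrite -integral12_prod_meas1// big_ord_recl -intG /fubini_F /F /=.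
rewrite (eq_integral (fun x => (h ord0 x)%:E *
    (\int[lebesgue_tuple d]_y G y)%:E)%E); last first.
  move=> x _; rewrite /Rintegral fineK; last exact: integrable_fin_num.
  by rewrite -integralZl//; apply: eq_integral => y _; rewrite EFinM.
rewrite integralZr//; last exact: (ih_int ord0).
by rewrite fineM// integrable_fin_num//; exact: (ih_int ord0).
Qed.

End tensor.

(** * The Fourier basis in dimension one *)

Section one_dim.
Context {R : realType}.
Implicit Types (t : R) (h : R -> R).

Definition wave (k : nat) t : R := 2 * pi * k%:R * t.

(** By the fundamental theorem of calculus. *)
Lemma integral_unit_derive (F f : R -> R) :
  (forall x : R, is_derive x (1 : R) F (f x)) -> continuous f -> F 0 = F 1 ->
  \int[lebesgue_measure]_(t in `[0, 1]) f t = 0.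
Proof.
move=> dF cf F01; have cF (x : R) : {for x, continuous F}.
  by apply: differentiable_continuous; apply/derivable1_diffP; case: (dF x).
rewrite /Rintegral (@continuous_FTC2 _ _ F)//.
- by rewrite F01 -EFinB subrr.
- exact: continuous_subspaceT.
- split; first by move=> x _; case: (dF x).
  + by apply: cvg_at_right_filter; exact: cF.
  + by apply: cvg_at_left_filter; exact: cF.
- by move=> x _; rewrite derive1E; case: (dF x).
Qed.

Lemma continuous_cos_wave k : continuous (fun t => cos (wave k t)).
Proof.
move=> t; apply: (@continuous_comp _ _ _ (wave k) cos); last exact: continuous_cos.
by apply: cvgMr; exact: cvg_id.
Qed.

Lemma continuous_sin_wave k : continuous (fun t => sin (wave k t)).
Proof.
move=> t; apply: (@continuous_comp _ _ _ (wave k) sin); last exact: continuous_sin.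
by apply: cvgMr; exact: cvg_id.
Qed.

Lemma cos_wave1 k : cos (wave k 1) = 1.
Proof.
rewrite /wave mulr1; elim: k => [|k ih]; first by rewrite mulr0 cos0.
by rewrite -[k.+1%:R]natr1 mulrDr mulr1 mulr_natl cosD2pi -mulr_natl.
Qed.

Lemma sin_wave1 k : sin (wave k 1) = 0.
Proof.
have := cos2Dsin2 (wave k 1); rewrite cos_wave1 expr1n => h.
by apply/eqP; rewrite -sqrf_eq0; apply/eqP; lra.
Qed.

Lemma wave0r k : wave k 0 = 0. Proof. by rewrite /wave mulr0. Qed.

Lemma integral_cos_wave k :
  \int[lebesgue_measure]_(t in `[0, 1]) cos (wave k.+1 t) = 0.
Proof.
have c0 : 2 * pi * k.+1%:R != 0 :> R.
  by rewrite !mulf_neq0 ?pnatr_eq0// gt_eqF ?pi_gt0.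
apply: (@integral_unit_derive (fun t => (2 * pi * k.+1%:R)^-1 * sin (wave k.+1 t)) (fun t : R => cos (wave k.+1 t))).
- move=> x; apply: is_derive_eq.
  rewrite /wave /GRing.scale /= !mulr1 ?addr0 ?mulr0 ?add0r.
  by rewrite mulrCA mulVf// mulr1.
- exact: continuous_cos_wave.
- by rewrite wave0r sin_wave1 sin0.
Qed.

Lemma integral_sin_wave k :
  \int[lebesgue_measure]_(t in `[0, 1]) sin (wave k.+1 t) = 0.
Proof.
have c0 : 2 * pi * k.+1%:R != 0 :> R.
  by rewrite !mulf_neq0 ?pnatr_eq0// gt_eqF ?pi_gt0.
apply: (@integral_unit_derive (fun t => - (2 * pi * k.+1%:R)^-1 * cos (wave k.+1 t)) (fun t : R => sin (wave k.+1 t))).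
- move=> x; apply: is_derive_eq.
  rewrite /wave /GRing.scale /= !mulr1 ?addr0 ?mulr0 ?add0r.
  by rewrite [- sin _ * _]mulNr mulrNN mulrCA mulVf// mulr1.
- exact: continuous_sin_wave.
- by rewrite wave0r cos_wave1 cos0.
Qed.

Lemma continuous_fourier1 k : continuous (@fourier1 R k).
Proof.
rewrite /fourier1; case: (k == 1%N); first by move=> t; exact: cvg_cst.
case: (odd k) => t; apply: cvgM; try exact: cvg_cst.
- exact: continuous_sin_wave.
- exact: continuous_cos_wave.
Qed.

Lemma measurable_fourier1 k : measurable_fun setT (@fourier1 R k).
Proof. by apply: continuous_measurable_fun; exact: continuous_fourier1. Qed.

Lemma fourier1_bound k t : `|fourier1 k t| <= Num.sqrt 2.
Proof.
have s1 : 1 <= Num.sqrt 2 :> R by rewrite -[leLHS]sqrtr1 ler_wsqrtr// ler1n.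
have s0 : 0 <= Num.sqrt 2 :> R by rewrite sqrtr_ge0.
rewrite /fourier1; case: ifP => _; first by rewrite normr1.
case: ifP => _; rewrite normrM (ger0_norm s0) ler_piMr//.
- by rewrite ler_norml sin_geN1 sin_le1.
- by rewrite ler_norml cos_geN1 cos_le1.
Qed.

Lemma integral_fourier1 k : (0 < k)%N ->
  \int[lebesgue_measure]_(t in `[0, 1]) @fourier1 R k t = (k == 1%N)%:R.
Proof.
move=> k0; have fin : (lebesgue_measure (`[0%R, 1%R]%classic : set R) < +oo)%E.
  by rewrite lebesgue_measure_itv/= lte_fin ltr01 sube0 ltry.
have int (h : R -> R) : continuous h ->
    lebesgue_measure.-integrable `[0%R, 1%R] (EFin \o h).
  move=> ch; apply: continuous_compact_integrable; first exact: segment_compact.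
  exact: continuous_subspaceT.
rewrite /fourier1; case: eqP => [_|k1].
  rewrite Rintegral_cst//= mul1r lebesgue_measure_itv/= lte_fin ltr01.
  by rewrite sube0.
have [p ->] : exists p, k./2 = p.+1 by exists (k./2).-1; lia.
case: (odd k); (rewrite RintegralZl//; last apply: int).
- by rewrite (@integral_sin_wave p) mulr0.
- exact: continuous_sin_wave.
- by rewrite (@integral_cos_wave p) mulr0.
- exact: continuous_cos_wave.
Qed.

(** The index [v], the coefficient of the constant function, is the mean of [h]
    over the unit interval. Carrying it along lets the product formulas below
    yield orthonormality and the stability of trigonometric polynomials under
    products at the same time. *)
Definition trig h (v : R) : Prop := exists s : seq (R * nat),
  [/\ all (fun q => 0 < q.2)%N s,
      (forall t, h t = \sum_(q <- s) q.1 * @fourier1 R q.2 t) &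
      v = \sum_(q <- s) q.1 * (q.2 == 1%N)%:R].

Lemma trigD h1 h2 v1 v2 : trig h1 v1 -> trig h2 v2 ->
  trig (fun t => h1 t + h2 t) (v1 + v2).
Proof.
move=> [s1 [p1 e1 ->]] [s2 [p2 e2 ->]]; exists (s1 ++ s2); split.
- by rewrite all_cat p1.
- by move=> t; rewrite e1 e2 big_cat.
- by rewrite big_cat.
Qed.

Lemma trigZ a h v : trig h v -> trig (fun t => a * h t) (a * v).
Proof.
move=> [s [p e ->]]; exists [seq (a * q.1, q.2) | q <- s]; split.
- by rewrite all_map.
- by move=> t; rewrite e big_map mulr_sumr; apply: eq_bigr => q _; rewrite mulrA.
- by rewrite big_map mulr_sumr; apply: eq_bigr => q _; rewrite mulrA.
Qed.

Lemma trig_fourier1 k : (0 < k)%N -> trig (fourier1 k) (k == 1%N)%:R.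
Proof.
move=> k0; exists [:: (1, k)]; split => [|t|]; rewrite /= ?k0//.
- by rewrite big_seq1 mul1r.
- by rewrite big_seq1 mul1r.
Qed.

Lemma eq_trig h1 h2 v1 v2 : h1 =1 h2 -> v1 = v2 -> trig h1 v1 -> trig h2 v2.
Proof. by move=> /funext -> ->. Qed.

Let sqrt2_neq0 : Num.sqrt 2 != 0 :> R.
Proof. by rewrite sqrtr_eq0 -ltNge ltr0n. Qed.

Let sqrt2K : (Num.sqrt 2)^-1 * Num.sqrt 2 = 1 :> R.
Proof. by rewrite mulVf. Qed.

Lemma trig_cos k : trig (fun t => cos (wave k t)) (k == 0%N)%:R.
Proof.
case: k => [|k].
  apply: eq_trig (trig_fourier1 (ltn0Sn 0)) => // t.
  by rewrite /fourier1 /wave mulr0 mul0r cos0.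
apply: eq_trig (trigZ (Num.sqrt 2)^-1 (@trig_fourier1 k.+1.*2 _)) => // [t|].
  rewrite /fourier1 ifF ?odd_double ?doubleK; last by apply/eqP; lia.
  by rewrite mulrA sqrt2K mul1r.
by rewrite (_ : (_ == 1%N) = false) ?mulr0//; apply/eqP; lia.
Qed.

Lemma trig_sin k : trig (fun t => sin (wave k t)) 0.
Proof.
case: k => [|k].
  apply: eq_trig (trigZ 0 (trig_fourier1 (ltn0Sn 0))) => // [t|].
    by rewrite /wave mulr0 !mul0r sin0.
  by rewrite mul0r.
apply: eq_trig (trigZ (Num.sqrt 2)^-1 (@trig_fourier1 k.+1.*2.+1 _)) => // [t|].
  have e1 : odd k.+1.*2.+1 by rewrite /= odd_double.
  have e2 : k.+1.*2.+1./2 = k.+1 by rewrite /= uphalf_double.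
  rewrite /fourier1 e1 e2.
  rewrite /= mulrA sqrt2K mul1r.
  by rewrite /wave.
by rewrite eqSS double_eq0 mulr0.
Qed.

Lemma waveD p q t : wave (p + q) t = wave p t + wave q t.
Proof. by rewrite /wave natrD; ring. Qed.

(** The three product-to-sum formulas. *)
Lemma trig_coscos p q :
  trig (fun t => cos (wave p t) * cos (wave q t))
       (2^-1 * ((p == q)%:R + ((p == 0%N) && (q == 0%N))%:R)).
Proof.
wlog pq : p q / (p <= q)%N.
  move=> H; case: (leqP p q) => [/H//|/ltnW/H]; apply: eq_trig => [t|].
    by rewrite mulrC.
  by rewrite eq_sym andbC.
have [r qE] : exists r, q = (p + r)%N by exists (q - p)%N; lia.
apply: eq_trig (trigZ 2^-1 (trigD (trig_cos r) (trig_cos (p + q)))) => [t|].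
  rewrite (waveD p q) qE waveD !cosD sinD.
  have := cos2Dsin2 (wave p t).
  set a := cos _; set b := sin _; set c := cos _; set e := sin _ => h.
  have : (a ^+ 2 + b ^+ 2) * c = c by rewrite h mul1r.
  lra.
congr (_ * (_ + _)); congr (_%:R); congr nat_of_bool; lia.
Qed.

Lemma trig_sinsin p q : (0 < p)%N -> (0 < q)%N ->
  trig (fun t => sin (wave p t) * sin (wave q t)) (2^-1 * (p == q)%:R).
Proof.
wlog pq : p q / (p <= q)%N.
  move=> H p0 q0; case: (leqP p q) => [/H|/ltnW/H] H'; first exact: H'.
  by apply: eq_trig (H' q0 p0) => [t|]; [rewrite mulrC|rewrite eq_sym].
move=> p0 q0.
have [r qE] : exists r, q = (p + r)%N by exists (q - p)%N; lia.
apply: eq_trig (trigZ 2^-1 (trigD (trig_cos r) (trigZ (-1) (trig_cos (p + q))))) => [t|].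
  rewrite (waveD p q) qE waveD !(cosD,sinD).
  have := cos2Dsin2 (wave p t).
  set a := cos _; set b := sin _; set c := cos _; set e := sin _ => h.
  have : (a ^+ 2 + b ^+ 2) * c = c by rewrite h mul1r.
  lra.
rewrite (_ : (p + q == 0)%N = false) ?mulr0 ?addr0; last by lia.
by congr (_ * _%:R); congr nat_of_bool; lia.
Qed.

Lemma trig_sincos p q :
  trig (fun t => sin (wave p t) * cos (wave q t)) 0.
Proof.
have [pq|qp] := leqP p q.
  have [r qE] : exists r, q = (p + r)%N by exists (q - p)%N; lia.
  apply: eq_trig (trigZ 2^-1 (trigD (trig_sin (p + q)) (trigZ (-1) (trig_sin r)))) => [t|].
    rewrite (waveD p q) qE waveD !(cosD,sinD).
    have := cos2Dsin2 (wave p t).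
    set a := cos _; set b := sin _; set c := cos _; set e := sin _ => h.
    have : (a ^+ 2 + b ^+ 2) * e = e by rewrite h mul1r.
    lra.
  by rewrite !mulr0 addr0 mulr0.
have [r pE] : exists r, p = (q + r)%N by exists (p - q)%N; lia.
apply: eq_trig (trigZ 2^-1 (trigD (trig_sin (p + q)) (trig_sin r))) => [t|].
  rewrite (waveD p q) pE waveD !(cosD,sinD).
  have := cos2Dsin2 (wave q t).
  set a := cos _; set b := sin _; set c := cos _; set e := sin _ => h.
  have : (a ^+ 2 + b ^+ 2) * e = e by rewrite h mul1r.
  lra.
by rewrite addr0 mulr0.
Qed.

(** Taking means, this is the orthonormality of the basis. *)
Lemma trig_fourier1M a b : (0 < a)%N -> (0 < b)%N ->
  trig (fun t => fourier1 a t * fourier1 b t) (a == b)%:R.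
Proof.
move=> a0 b0; case: (eqVneq a 1%N) => [->|a1].
  apply: eq_trig (trig_fourier1 b0) => [t|]; last by rewrite eq_sym.
  by rewrite {2}/fourier1 eqxx mul1r.
case: (eqVneq b 1%N) => [->|b1].
  apply: eq_trig (trig_fourier1 a0) => [t|//].
  by rewrite {3}/fourier1 eqxx mulr1.
have s2 : Num.sqrt 2 * Num.sqrt 2 = 2 :> R by rewrite -expr2 sqr_sqrtr ?ler0n.
have aE := odd_double_half a; have bE := odd_double_half b.
rewrite /fourier1 (negbTE a1) (negbTE b1).
case oa : (odd a) aE => aE; case ob : (odd b) bE => bE.
- apply: eq_trig (trigZ 2 (@trig_sinsin a./2 b./2 _ _)) => [t| | |]; try lia.
    by rewrite /wave [RHS]mulrACA s2.
  rewrite mulrA divff ?mul1r ?pnatr_eq0//; congr (_%:R); congr nat_of_bool; lia.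
- apply: eq_trig (trigZ 2 (trig_sincos a./2 b./2)) => [t|].
    by rewrite /wave [RHS]mulrACA s2.
  rewrite mulr0 (_ : (a == b) = false)//; lia.
- apply: eq_trig (trigZ 2 (trig_sincos b./2 a./2)) => [t|].
    by rewrite /wave [RHS]mulrACA s2 [in RHS](mulrC (cos _)).
  rewrite mulr0 (_ : (a == b) = false)//; lia.
- apply: eq_trig (trigZ 2 (trig_coscos a./2 b./2)) => [t|].
    by rewrite /wave [RHS]mulrACA s2.
  rewrite mulrA divff ?mul1r ?pnatr_eq0// (_ : _ && _ = false) ?addr0; last lia.
  by congr (_%:R); congr nat_of_bool; lia.
Qed.

Lemma integral_trig h v : trig h v ->
  \int[lebesgue_measure]_(t in `[0, 1]) h t = v.
Proof.
move=> [s [/allP sp he ->]]; rewrite (_ : h = fun t =>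
  \sum_(q <- s) q.1 * @fourier1 R q.2 t); last exact/funext.
have int (k : nat) (c : R) : lebesgue_measure.-integrable `[0%R, 1%R]
    (EFin \o (fun t => c * fourier1 k t)).
  apply: continuous_compact_integrable; first exact: segment_compact.
  apply: continuous_subspaceT => t; apply: cvgM; first exact: cvg_cst.
  exact: continuous_fourier1.
elim: s {he} sp => [|q s ih] sp.
  rewrite big_nil (_ : (fun _ => _) = cst 0); last first.
    by apply/funext => t; rewrite big_nil.
  by rewrite Rintegral_cst// mul0r.
rewrite big_cons (_ : (fun _ => _) = fun t =>
  q.1 * @fourier1 R q.2 t + \sum_(q <- s) q.1 * @fourier1 R q.2 t); last first.
  by apply/funext => t; rewrite big_cons.
rewrite RintegralD//; last first.
  rewrite (_ : _ \o _ = (fun t => \sum_(q <- s) (q.1 * @fourier1 R q.2 t)%:E)%E).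
    by apply: integrable_sum => // i _; exact: int.
  by apply/funext => t /=; rewrite sumEFin.
rewrite ih; last by move=> x xs; apply: sp; rewrite inE xs orbT.
congr (_ + _); rewrite RintegralZl//.
  by rewrite integral_fourier1// sp ?inE ?eqxx.
by have := int q.2 1; rewrite (_ : (fun _ => _) = fourier1 q.2)//;
  apply/funext => t; rewrite mul1r.
Qed.

End one_dim.

(** * The tensor Fourier basis and trigonometric polynomials *)

Section multi_dim.
Context {R : realType} (d : nat).
Local Notation mu := (@lebesgue_tuple R d).
Local Notation D := (@cube R d).
Implicit Types (p q : vec R d -> R) (j k : 'I_d -> nat).

Lemma measurable_fourier j : measurable_fun setT (fourier j : vec R d -> R).
Proof.
apply: measurable_prod => m _; apply: measurableT_comp.
  exact: measurable_fourier1.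
exact: measurable_tnth.
Qed.

Lemma fourier_bound j (x : vec R d) : `|fourier j x| <= B0 d.
Proof.
rewrite /fourier normr_prod.
apply: (@le_trans _ _ (\prod_(m < d) Num.sqrt 2)).
  by apply: ler_prod => m _; rewrite normr_ge0 fourier1_bound.
rewrite prodr_const card_ord /B0 -powR12_sqrt ?ler0n//.
by rewrite -powR_mulrn ?powR_ge0// -powRrM mulrC.
Qed.

Lemma sqint_fourier j : sqint (fourier j : vec R d -> R).
Proof.
apply: (@bounded_sqint _ _ _ (B0 d)); last by move=> x _; exact: fourier_bound.
by apply: measurable_funTS; exact: measurable_fourier.
Qed.

(** The tensor structure reduces orthonormality to dimension one. *)
Lemma ip_fourier j k : (forall m, 0 < j m)%N -> (forall m, 0 < k m)%N ->
  ip (fourier j : vec R d -> R) (fourier k) = [forall m, j m == k m]%:R.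
Proof.
move=> j0 k0.
have fin : (lebesgue_measure (`[0%R, 1%R]%classic : set R) < +oo)%E.
  by rewrite lebesgue_measure_itv/= lte_fin ltr01 sube0 ltry.
pose u m (t : measurableTypeR R) := @fourier1 R (j m) t * @fourier1 R (k m) t.
pose h m := u m \_ `[0%R, 1%R].
have mI : measurable (`[0%R, 1%R]%classic : set (measurableTypeR R)).
  exact: measurable_itv.
have ih m : lebesgue_measure.-integrable setT (EFin \o h m).
  rewrite /h -restrict_EFin; apply/(integrable_mkcond _ mI).
  apply: continuous_compact_integrable; first exact: segment_compact.
  apply: continuous_subspaceT => t; apply: cvgM; exact: continuous_fourier1.
have [_ e] := integral_tensor ih.
rewrite /ip Rintegral_mkcond; apply: etrans (etrans e _); last first.
  rewrite (eq_bigr (fun m => (j m == k m)%:R : R)); last first.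
    move=> m _; rewrite /h -Rintegral_mkcond; apply: integral_trig.
    exact: trig_fourier1M.
  case: forallP => [jk|]; first by rewrite big1// => m _; rewrite jk.
  move/forallP; rewrite negb_forall => /existsP[m jm].
  by rewrite (bigD1 m)//= (negbTE jm) mul0r.
apply: eq_Rintegral => x _.
rewrite patchE; case: ifPn => [/set_mem xD|xD].
  rewrite /fourier -big_split; apply: eq_bigr => m _ /=.
  by rewrite /h patchE mem_set//= in_itv/=; exact: xD.
have [m xm] : exists m, ~~ (0 <= (tnth x m : R) <= 1).
  apply/existsP; rewrite -negb_forall; apply: contra xD => /forallP xD.
  by apply/mem_set => m; exact: xD.
rewrite (bigD1 m)//= /h patchE ifF ?mul0r//; apply/negbTE.
by apply: contra xm => /set_mem /=; rewrite in_itv.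
Qed.

Definition span p : Prop := exists (I : finType) (c : I -> R) (k : I -> 'I_d -> nat),
  (forall i m, 0 < k i m)%N /\ forall x, p x = \sum_i c i * fourier (k i) x.

Lemma eq_span p q : p =1 q -> span p -> span q.
Proof. by move=> /funext ->. Qed.

Lemma spanD p q : span p -> span q -> span (fun x => p x + q x).
Proof.
move=> [I [c [k [k0 pE]]]] [J [c' [k' [k0' qE]]]].
exists (I + J)%type,
  (fun a => match a with inl i => c i | inr i => c' i end),
  (fun a => match a with inl i => k i | inr i => k' i end); split.
  by case.
by move=> x; rewrite big_sumType pE qE.
Qed.

Lemma spanZ a p : span p -> span (fun x => a * p x).
Proof.
move=> [I [c [k [k0 pE]]]]; exists I, (fun i => a * c i), k; split=> // x.
by rewrite pE mulr_sumr; apply: eq_bigr => i _; rewrite mulrA.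
Qed.

Lemma span_fourier j : (forall m, 0 < j m)%N -> span (fourier j).
Proof.
move=> j0; exists unit, (fun=> 1), (fun=> j); split=> // x.
by rewrite (big_pred1 tt) ?mul1r// => -[].
Qed.

Lemma span_tensor (h : 'I_d -> R -> R) (v : 'I_d -> R) :
  (forall m, trig (h m) (v m)) -> span (fun x => \prod_(m < d) h m (tnth x m)).
Proof.
move=> th; have /choice [s sP] : forall m, exists s : seq (R * nat),
    all (fun a : R * nat => 0 < a.2)%N s /\
    (forall t, h m t = \sum_(a <- s) a.1 * fourier1 a.2 t).
  by move=> m; have [s [s0 sE _]] := th m; exists s.
(* The expansions are padded with null terms to a common length. *)
pose N := (\max_(m < d) size (s m))%N; pose e m i := nth (0, 1%N) (s m) i.
exists {ffun 'I_d -> 'I_N}, (fun f : {ffun 'I_d -> 'I_N} => \prod_m (e m (f m)).1),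
  (fun (f : {ffun 'I_d -> 'I_N}) m => (e m (f m)).2); split.
  move=> f m; rewrite /e; have [lt|ge] := ltnP (f m) (size (s m)); last first.
    by rewrite nth_default.
  by have [/allP + _] := sP m; apply; exact: mem_nth.
move=> x; rewrite (eq_bigr (fun m => \sum_(i < N) (e m i).1 *
    fourier1 (e m i).2 (tnth x m : R))); last first.
  move=> m _; have [_ ->] := sP m; rewrite (big_nth (0, 1%N)) big_mkord.
  have le : (size (s m) <= N)%N by rewrite /N (bigD1 m)//= leq_maxl.
  rewrite (big_ord_widen _ (fun i => (e m i).1 * fourier1 (e m i).2 (tnth x m : R)) le).
  rewrite big_mkcond; apply: eq_bigr => i _; case: ltnP => // ge.
  by rewrite /e nth_default ?mul0r.
rewrite bigA_distr_bigA; apply: eq_bigr => f _.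
by rewrite /fourier -big_split.
Qed.

Lemma span_cst a : span (cst a).
Proof.
apply: eq_span (spanZ a (@span_fourier (fun=> 1%N) _)) => // x.
by rewrite /fourier big1 ?mulr1// => m _; rewrite /fourier1 eqxx.
Qed.

Lemma span_sum (I : Type) (s : seq I) (F : I -> vec R d -> R) :
  (forall i, span (F i)) -> span (fun x => \sum_(i <- s) F i x).
Proof.
move=> sF; elim: s => [|i s ih].
  by apply: eq_span (span_cst 0) => x; rewrite big_nil.
by apply: eq_span (spanD (sF i) ih) => x; rewrite big_cons.
Qed.

Lemma spanM p q : span p -> span q -> span (fun x => p x * q x).
Proof.
move=> [I [c [k [k0 pE]]]] [J [c' [k' [k0' qE]]]].
apply: (@eq_span (fun x => \sum_i \sum_j
    (c i * c' j) * (fourier (k i) x * fourier (k' j) x))).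
  move=> x; rewrite pE qE mulr_suml; apply: eq_bigr => i _.
  by rewrite mulr_sumr; apply: eq_bigr => j _; ring.
apply: span_sum => i; apply: span_sum => j; apply: spanZ.
apply: eq_span (@span_tensor (fun m t => fourier1 (k i m) t * fourier1 (k' j m) t)
  (fun m => (k i m == k' j m)%:R) _) => [x|m].
  by rewrite /fourier -big_split.
exact: trig_fourier1M.
Qed.

Lemma spanX p n : span p -> span (fun x => p x ^+ n).
Proof.
move=> sp; elim: n => [|n ih]; first exact: eq_span (span_cst 1).
by apply: eq_span (spanM sp ih) => x; rewrite exprS.
Qed.

Lemma span_coord (h : R -> R) v (m : 'I_d) : trig h v ->
  span (fun x => h (tnth x m)).
Proof.
move=> th; apply: eq_span (@span_tensor
    (fun i => if i == m then h else fourier1 1)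
    (fun i => if i == m then v else (1 == 1)%N%:R) _) => [x|i].
  rewrite (bigD1 m)//= eqxx big1 ?mulr1// => i /negbTE ->.
  by rewrite /fourier1 eqxx.
by case: ifP => // _; exact: trig_fourier1.
Qed.

Lemma span_measurable p : span p -> measurable_fun setT p.
Proof.
move=> [I [c [k [_ /funext ->]]]]; apply: measurable_sum => i.
by apply: measurable_funM => //; exact: measurable_fourier.
Qed.

Lemma span_sqint p : span p -> sqint p.
Proof.
move=> [I [c [k [_ /funext ->]]]]; apply: sqint_sum => i; apply: sqintZ.
exact: sqint_fourier.
Qed.

End multi_dim.

(** * Approximation of indicators by trigonometric polynomials *)

Section approximation.
Context {R : realType} (d : nat).
Local Notation mu := (@lebesgue_tuple R d).
Local Notation D := (@cube R d).
Implicit Types (f g p q : vec R d -> R) (A B : set (vec R d)).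

(** Dominated convergence, in mean square. *)
Lemma ip_dominated (u : nat -> vec R d -> R) (h : vec R d -> R) :
  (forall n, sqint (u n)) -> mu.-integrable D (EFin \o h) ->
  (forall n x, D x -> u n x ^+ 2 <= h x) ->
  (forall x, D x -> u n x @[n --> \oo] --> (0 : R)) ->
  forall e, 0 < e -> exists n, ip (u n) (u n) <= e.
Proof.
move=> su ih uh u0 e e0.
have mD := @measurable_cube R d.
have mu2 n : measurable_fun D (fun x => (u n x ^+ 2)%:E).
  by apply/measurable_EFinP; apply: measurable_funX; case: (su n).
have cu : \forall x \ae mu, D x -> (u n x ^+ 2)%:E @[n --> \oo] --> 0%E.
  apply: aeW => x Dx; apply: cvg_EFin; first exact: nearW.
  by have h2 := cvgM (u0 x Dx) (u0 x Dx); rewrite mulr0 in h2; exact: h2.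
have du : \forall x \ae mu, forall n, D x -> (`|(u n x ^+ 2)%:E| <= (h x)%:E)%E.
  apply: aeW => x n Dx /=; rewrite lee_fin ger0_norm ?sqr_ge0//; exact: uh.
have [_ _ +] := @dominated_convergence _ _ _ mu D mD
  (fun n x => (u n x ^+ 2)%:E) (cst 0%E) (EFin \o h) mu2 (measurable_cst _) cu ih du.
rewrite integral0.
move=> /fine_cvgP[_] /cvgrPdist_le /(_ e e0)[n _ /(_ n (leqnn _))] /=.
rewrite sub0r normrN => h1; exists n; apply: le_trans h1.
rewrite -/(Rintegral mu D (fun x => u n x ^+ 2)).
rewrite (_ : ip _ _ = \int[mu]_(x in D) (u n x ^+ 2)) ?ler_norm//.
Qed.

Lemma bounded_ip_dominated (u : nat -> vec R d -> R) M :
  (forall n, measurable_fun D (u n)) ->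
  (forall n x, D x -> `|u n x| <= M) ->
  (forall x, D x -> u n x @[n --> \oo] --> (0 : R)) ->
  forall e, 0 < e -> exists n, ip (u n) (u n) <= e.
Proof.
move=> mu_ uM; apply: (@ip_dominated u (cst (M ^+ 2))).
- by move=> n; apply: bounded_sqint (uM n).
- by apply: (@bounded_integrable _ _ _ `|M ^+ 2|).
- move=> n x Dx /=; rewrite -[u n x ^+ 2]real_normK ?num_real//.
  have := uM n x Dx; have := normr_ge0 (u n x); nra.
Qed.

Lemma sqint_indic A : measurable A -> sqint (\1_A : vec R d -> R).
Proof.
move=> mA; apply: (@bounded_sqint _ _ _ 1) => [|x _].
  by apply: measurable_funTS; exact: measurable_indic.
by rewrite indicE; case: (x \in A); rewrite ?normr1 ?normr0.
Qed.

(** The triangle inequality for squared distances. *)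
Lemma ip_le_double f g h : sqint f -> sqint g -> sqint h ->
  (forall x, D x -> `|h x| <= `|f x| + `|g x|) ->
  ip h h <= 2 * (ip f f + ip g g).
Proof.
move=> sf sg sh hfg; rewrite /ip -RintegralD; last 3 first.
- exact: measurable_cube.
- exact: sqintM.
- exact: sqintM.
have ifg : mu.-integrable D (EFin \o (fun x => f x * f x + g x * g x)).
  exact: (integrableD (@measurable_cube _ _) (sqintM sf sf) (sqintM sg sg)).
rewrite -RintegralZl//; last exact: measurable_cube.
apply: le_Rintegral.
- exact: measurable_cube.
- exact: sqintM.
- exact: (integrableZl (@measurable_cube _ _) 2 ifg).
move=> x Dx; rewrite -!expr2 -[h x ^+ 2]real_normK ?num_real//.
rewrite -[f x ^+ 2]real_normK ?num_real// -[g x ^+ 2]real_normK ?num_real//.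
have := hfg x Dx; have := normr_ge0 (f x); have := normr_ge0 (g x).
have := normr_ge0 (h x); have := sqr_ge0 (`|f x| - `|g x|); nra.
Qed.

(** Sets whose indicator is, on the cube, a mean-square limit of trigonometric
    polynomials; asking these for values in [0, 1] makes the class stable under
    intersections. *)
Definition good A : Prop := measurable A /\ forall e, 0 < e ->
  exists p, [/\ span p, (forall x, D x -> 0 <= p x <= 1) &
                ip (fun x => \1_A x - p x) (fun x => \1_A x - p x) <= e].

Lemma indic01 A x : 0 <= (\1_A x : R) <= 1.
Proof. by rewrite indicE; case: (x \in A); rewrite ?ler01 ?lexx. Qed.

Lemma sqint_indicB A p : measurable A -> span p -> sqint (fun x => \1_A x - p x).
Proof. by move=> mA sp; apply: sqintB; [exact: sqint_indic|exact: span_sqint]. Qed.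

(** Mean-square approximation ignores null sets. *)
Lemma good_ae A B : good A -> measurable B ->
  (exists N, [/\ measurable N, mu N = 0%E &
     forall x, D x -> ~ N x -> A x <-> B x]) -> good B.
Proof.
move=> [mA gA] mB [N [mN N0 AB]]; split => // e e0.
have [p [sp p01 pe]] := gA _ e0; exists p; split => //.
rewrite (_ : ip _ _ = ip (fun x => \1_A x - p x) (fun x => \1_A x - p x))//.
have mD := @measurable_cube R d.
rewrite /ip /Rintegral; congr fine.
have int C : measurable C -> mu.-integrable D
    (EFin \o (fun x => (\1_C x - p x) * (\1_C x - p x))).
  by move=> mC; apply: sqintM; exact: sqint_indicB.
rewrite (negligible_integral mN mD (int _ mB) N0).
rewrite [RHS](negligible_integral mN mD (int _ mA) N0).
apply: eq_integral => x /set_mem[Dx Nx].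
rewrite /= !indicE (_ : (x \in A) = (x \in B))//.
by apply/idP/idP => /set_mem h; apply/mem_set; apply/(AB x Dx Nx).
Qed.

Lemma good_set0 : good set0.
Proof.
split=> // e e0; exists (cst 0); split.
- exact: span_cst.
- by move=> x _ /=; rewrite lexx ler01.
- rewrite /ip (eq_Rintegral _ (g := cst 0)).
    by rewrite Rintegral_cst ?mul0r ?ltW//; exact: measurable_cube.
  by move=> x _; rewrite indic0 /= subr0 mulr0.
Qed.

Lemma goodC A : good A -> good (~` A).
Proof.
move=> [mA gA]; split; first exact: measurableC.
move=> e e0; have [p [sp p01 pe]] := gA _ e0.
exists (fun x => 1 + (-1) * p x); split.
- exact: (spanD (span_cst d 1) (spanZ (-1) sp)).
- by move=> x Dx; have := p01 x Dx; lra.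
- rewrite (_ : ip _ _ = ip (fun x => \1_A x - p x) (fun x => \1_A x - p x))//.
  apply: eq_Rintegral => x _; rewrite !indicE in_setC.
  by case: (x \in A) => /=; ring.
Qed.

(** The product of the approximations approximates the product of the
    indicators, because all factors lie in [0, 1]. *)
Lemma goodI A B : good A -> good B -> good (A `&` B).
Proof.
move=> [mA gA] [mB gB]; split; first exact: measurableI.
move=> e e0; have e40 : 0 < e / 4 by rewrite divr_gt0.
have [p [sp p01 pe]] := gA _ e40; have [q [sq q01 qe]] := gB _ e40.
exists (fun x => p x * q x); split; first exact: spanM.
  by move=> x Dx; have := p01 x Dx; have := q01 x Dx; nra.
apply: (@le_trans _ _ (2 * (ip (fun x => \1_A x - p x) (fun x => \1_A x - p x) +
   ip (fun x => \1_B x - q x) (fun x => \1_B x - q x)))); last lra.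
apply: ip_le_double; [exact: sqint_indicB|exact: sqint_indicB| |].
  by apply: sqint_indicB; [exact: measurableI|exact: spanM].
move=> x Dx; rewrite indicI /=.
rewrite (_ : _ - _ = \1_B x * (\1_A x - p x) + p x * (\1_B x - q x)); last ring.
apply: (le_trans (ler_normD _ _)); rewrite !normrM.
have /andP[p0 p1] := p01 x Dx; have /andP[b0 b1] := indic01 B x.
rewrite (ger0_norm p0) (ger0_norm b0).
by rewrite lerD// ler_piMl.
Qed.

(** Finite unions converge to the countable one, in mean square by dominated
    convergence. *)
Lemma good_bigcup (F : nat -> set (vec R d)) :
  (forall n, good (F n)) -> good (\bigcup_n F n).
Proof.
move=> gF; pose G n := \big[setI/setT]_(k < n) ~` F k.
have gG n : good (G n).
  rewrite /G; elim: n => [|n ih].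
    by rewrite big_ord0 -setC0; exact: goodC good_set0.
  by rewrite big_ord_recr; apply: goodI => //; exact: goodC.
have mG n : measurable (G n) by case: (gG n).
set U := \bigcup_n F n.
have mU : measurable U by apply: bigcupT_measurable => n; case: (gF n).
have GU n x : G n x <-> forall k, (k < n)%N -> ~ F k x.
  rewrite /G -(bigcap_mkord n (fun k => ~` F k)); split => [h k kn|h k /= kn]; exact: h.
split=> // e e0; have e40 : 0 < e / 4 by rewrite divr_gt0.
have mB n : measurable_fun D (fun x => \1_(~` G n) x - \1_U x : R).
  by apply: measurable_funTS; apply: measurable_funB; apply: measurable_indic => //;
    exact: measurableC.
have [| |n ne] := @bounded_ip_dominated (fun n x => \1_(~` G n) x - \1_U x) 1 mB _ _ _ e40.
- move=> n x _; have := indic01 (~` G n) x; have := indic01 U x.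
  by rewrite ler_norml; lra.
- move=> x _; apply: (@cvg_near_cst _ _ (0 : R)).
  have [Ux|nUx] := pselect (U x).
    have [k _ Fk] := Ux; exists k.+1 => // n /= kn.
    rewrite !indicE !mem_set ?subrr//= => /GU/(_ k kn); exact.
  apply: nearW => n; rewrite !indicE !memNset ?subrr//= => h; apply: h.
  by apply/GU => k _ Fk; apply: nUx; exists k.
have [_ /(_ _ e40)[p [sp p01 pe]]] := goodC (gG n).
exists p; split => //.
apply: (@le_trans _ _ (2 * (ip (fun x => \1_(~` G n) x - \1_U x)
   (fun x => \1_(~` G n) x - \1_U x) +
   ip (fun x => \1_(~` G n) x - p x) (fun x => \1_(~` G n) x - p x)))); last lra.
apply: ip_le_double; [| |exact: sqint_indicB|].
- by apply: sqintB; apply: sqint_indic => //; exact: measurableC.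
- by apply: sqint_indicB => //; exact: measurableC.
move=> x Dx; rewrite -[`|\1_(~` G n) x - \1_U x|]normrN.
rewrite (_ : \1_U x - p x = - (\1_(~` G n) x - \1_U x) + (\1_(~` G n) x - p x));
  last ring.
exact: ler_normD.
Qed.

End approximation.

(** * Measurable sets *)

Section elementary.
Context {R : realType}.
Implicit Types (c t y q : R).

Lemma bernoulli_decay y n : 0 <= y <= 1 -> (1 - y) ^+ n * (1 + n%:R * y) <= 1.
Proof.
move=> /andP[y0 y1]; elim: n => [|n]; first by rewrite expr0 mul0r addr0 mul1r.
apply: le_trans; rewrite exprS mulrC mulrA mulrC ler_wpM2l//.
  by rewrite exprn_ge0// subr_ge0.
rewrite -[n.+1%:R]natr1; have : 0 <= n%:R * y ^+ 2 by rewrite mulr_ge0// sqr_ge0.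
by have := sqr_ge0 y; nra.
Qed.

Lemma bernoulli_growth y n : 0 <= y <= 1 -> 1 - (1 - y) ^+ n <= n%:R * y.
Proof.
move=> /andP[y0 y1]; elim: n => [|n ih]; first by rewrite expr0 subrr mul0r.
rewrite exprS -[n.+1%:R]natr1.
have : 0 <= (1 - y) ^+ n <= 1.
  by rewrite exprn_ge0 ?subr_ge0//= exprn_ile1// ?subr_ge0// lerBlDr lerDl.
nra.
Qed.

(** Geometric decay beats a linear factor. *)
Lemma linear_geometric q : 0 <= q < 1 ->
  exists C, forall n, n%:R * q ^+ n <= C / n.+1%:R.
Proof.
move=> /andP[q0 q1]; set s := Num.sqrt q; have s0 : 0 <= s by exact: sqrtr_ge0.
have s1 : s < 1 by rewrite -[ltRHS]sqrtr1 ltr_sqrt.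
have h0 : 0 < 1 - s by lra.
(* One factor s ^ n absorbs n, the other one gives the decay. *)
exists ((1 - s) ^- 2) => n.
have b : s ^+ n * (1 + n%:R * (1 - s)) <= 1.
  by have := @bernoulli_decay (1 - s) n; rewrite subKr; apply; lra.
have sn0 : 0 <= s ^+ n by exact: exprn_ge0.
have h1 : n%:R * (1 - s) * s ^+ n <= 1 by nra.
have h2 : n.+1%:R * (1 - s) * s ^+ n <= 1.
  by rewrite -[n.+1%:R]natr1; nra.
have h3 : (n%:R * (1 - s) * s ^+ n) * (n.+1%:R * (1 - s) * s ^+ n) <= 1.
  by rewrite -[leRHS]mulr1 ler_pM// !mulr_ge0// ltW.
have qE : q ^+ n = s ^+ n * s ^+ n by rewrite -expr2 -exprM mulnC exprM sqr_sqrtr.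
rewrite -[X in X / _]mul1r qE ler_pdivlMr ?ltr0n// ler_pdivlMr ?exprn_gt0//.
by apply: le_trans h3; rewrite le_eqVlt; apply/orP; left; apply/eqP; ring.
Qed.

(** The polynomials 1 - (1 - c^n)^(N n) approximate the indicator of [t, 1] on
    [0, 1] when N n is about n / t^n. *)
Definition step_exponent t n : nat := (n * (Num.truncn (t ^- n)).+1)%N.
Definition step_poly t n c : R := 1 - (1 - c ^+ n) ^+ step_exponent t n.

Lemma step_poly01 t n c : 0 <= c <= 1 -> 0 <= step_poly t n c <= 1.
Proof.
move=> /andP[c0 c1]; have c01 : 0 <= 1 - c ^+ n <= 1.
  by rewrite subr_ge0 exprn_ile1//= lerBlDr lerDl exprn_ge0.
case/andP: c01 => c2 c3.
by rewrite /step_poly subr_ge0 exprn_ile1//= lerBlDr lerDl exprn_ge0.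
Qed.

(** Let [N] be the exponent. Above [t], [N c^n >= n]; below [t],
    [N c^n <= 2 n (c / t)^n], which vanishes. Bernoulli's inequalities do the
    rest. *)
Lemma step_poly_cvg t c : 0 < t <= 1 -> 0 <= c <= 1 ->
  exists C, forall n, `|(t <= c)%R%:R - step_poly t n c| <= C / n.+1%:R.
Proof.
move=> /andP[t0 t1] /andP[c0 c1].
have tn n : 1 <= t ^- n by rewrite invf_ge1 ?exprn_gt0// exprn_ile1// ltW.
have cn n : 0 <= c ^+ n <= 1 by rewrite exprn_ge0// exprn_ile1.
have [tc|ct] := leP t c.
  exists 1 => n; rewrite /step_poly subKr ger0_norm; last first.
    by rewrite exprn_ge0// subr_ge0; case/andP: (cn n).
  have := bernoulli_decay (step_exponent t n) (cn n).
  have N : n%:R <= (step_exponent t n)%:R * c ^+ n.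
    rewrite /step_exponent natrM -mulrA ler_peMr//.
    apply: (@le_trans _ _ (t ^- n * t ^+ n)).
      by rewrite mulVf// expf_neq0// gt_eqF.
    apply: ler_pM.
    - by rewrite invr_ge0 exprn_ge0// ltW.
    - by rewrite exprn_ge0// ltW.
    - by apply: ltW; exact: truncnS_gt.
    - by rewrite lerXn2r// ?nnegrE// ltW.
  rewrite ler_pdivlMr ?ltr0n// => h; apply: le_trans h.
  rewrite ler_wpM2l//; first by rewrite exprn_ge0// subr_ge0; case/andP: (cn n).
  by rewrite -[n.+1%:R]natr1; lra.
have q01 : 0 <= c / t < 1.
  apply/andP; split; first by rewrite divr_ge0// ltW.
  by rewrite ltr_pdivrMr// mul1r.
have [C hC] := linear_geometric q01; exists (2 * C) => n.
rewrite sub0r normrN ger0_norm; last first.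
  by have := @step_poly01 t n c; rewrite c0 c1 => /(_ erefl)/andP[].
apply: (le_trans (bernoulli_growth _ (cn n))).
rewrite -mulrA; apply: (@le_trans _ _ (2 * (n%:R * (c / t) ^+ n))); last first.
  by rewrite ler_wpM2l.
have K : ((Num.truncn (t ^- n)).+1)%:R <= 2 * t ^- n.
  rewrite -natr1; have : (Num.truncn (t ^- n))%:R <= t ^- n.
    by rewrite truncn_le (le_trans _ (tn n)).
  by have := tn n; lra.
have {K} : n%:R * (Num.truncn (t ^- n)).+1%:R * c ^+ n <= n%:R * (2 * t ^- n) * c ^+ n.
  by rewrite ler_wpM2r ?exprn_ge0// ler_wpM2l.
rewrite /step_exponent natrM => h; apply: (le_trans h).
by rewrite expr_div_n le_eqVlt; apply/orP; left; apply/eqP; ring.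
Qed.

End elementary.

Section borel.
Context {R : realType} (d : nat).
Local Notation mu := (@lebesgue_tuple R d).
Local Notation D := (@cube R d).
Implicit Types (p : vec R d -> R) (A B : set (vec R d)) (m : 'I_d).

(** The step polynomials composed with a trigonometric polynomial are
    trigonometric polynomials converging to the indicator of its level set. *)
Lemma good_level p t : span p -> (forall x, D x -> 0 <= p x <= 1) -> 0 < t <= 1 ->
  good [set x | t <= p x].
Proof.
move=> sp p01 t01; set A := [set x | t <= p x].
have mp := span_measurable sp.
have mA : measurable A.
  rewrite (_ : A = p @^-1` `[t, +oo[).
    by rewrite -[X in measurable X]setTI; exact: mp.
  by apply/seteqP; split => x /=; rewrite in_itv/= andbT.
have sstep n : span (fun x => step_poly t n (p x)).
  apply: eq_span (spanD (span_cst d 1) (spanZ (-1) (spanX (step_exponent t n)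
     (spanD (span_cst d 1) (spanZ (-1) (spanX n sp)))))) => x /=.
  by rewrite /step_poly !mulN1r.
split=> // e e0.
have [|||n ne] := @bounded_ip_dominated _ _ (fun n x => \1_A x - step_poly t n (p x))
   1 _ _ _ e e0.
- move=> n; apply: measurable_funTS; apply: measurable_funB.
    exact: measurable_indic.
  exact: span_measurable.
- move=> n x Dx; have := indic01 A x; have := step_poly01 t n (p01 x Dx).
  by rewrite ler_norml; lra.
- move=> x Dx; have [C hC] := step_poly_cvg t01 (p01 x Dx).
  have c0 : C * (@harmonic R n) @[n --> \oo] --> (0 : R).
    by rewrite -[X in _ --> X](mulr0 C); apply: cvgMr; exact: cvg_harmonic.
  have cN : - (C * (@harmonic R n)) @[n --> \oo] --> (0 : R).
    by rewrite -[X in _ --> X]oppr0; exact: cvgN.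
  apply: (squeeze_cvgr _ cN c0); apply: nearW => n.
  rewrite -ler_norml; apply: le_trans (hC n).
  rewrite indicE (_ : (x \in A) = (t <= p x))//.
  by apply/idP/idP => [/set_mem//|h]; exact/mem_set.
by exists (fun x => step_poly t n (p x)); split => // x Dx; exact: step_poly01 (p01 x Dx).
Qed.

(** Restricted to the cube in the other coordinates, which is all that matters
    here and makes the measure a product of finite factors. *)
Definition slice m (c : R) : set (vec R d) :=
  [set x | forall i, (if i == m then [set c] else `[0%R, 1%R]%classic) (tnth x i : R)].

Lemma measurable_slice m c : measurable (slice m c).
Proof.
rewrite (_ : slice m c = \bigcap_(i in [set: 'I_d])
    ((@tnth d (measurableTypeR R))^~ i @^-1`
      (if i == m then [set c] else `[0%R, 1%R]%classic))).
  apply: fin_bigcap_measurable => // i _.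
  rewrite -[X in measurable X]setTI; apply: measurable_tnth => //.
  by case: ifP => _; [exact: measurable_set1|exact: measurable_itv].
by apply/seteqP; split => x /= hx i; [move=> _|]; exact: hx.
Qed.

Lemma slice0 m c : mu (slice m c) = 0%E.
Proof.
rewrite /slice (@lebesgue_tuple_box _ _
  (fun i => if i == m then [set c] else `[0%R, 1%R]%classic)).
  by rewrite (bigD1 m)//= eqxx lebesgue_measure_set1 mul0e.
by move=> i; case: ifP => _; [exact: measurable_set1|exact: measurable_itv].
Qed.

Lemma good_off_slices A B m (c1 c2 : R) : good A -> measurable B ->
  (forall x, D x -> (tnth x m : R) != c1 -> (tnth x m : R) != c2 -> A x <-> B x) ->
  good B.
Proof.
move=> gA mB AB; apply: (good_ae gA mB).
exists (slice m c1 `|` slice m c2); split.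
- by apply: measurableU; exact: measurable_slice.
- apply/eqP; rewrite eq_le measure_ge0 andbT.
  apply: (le_trans (measureU2 _ _ _)); [exact: measurable_slice..|].
  by rewrite [X in (X + _)%E]slice0 [X in (_ + X)%E]slice0 adde0.
- have sl c x : D x -> tnth x m = c -> slice m c x.
    move=> Dx xc i; case: eqP => [->//|_] /=; rewrite in_itv/=; exact: Dx.
  move=> x Dx nN; apply: AB => //; apply/eqP => xc; apply: nN; [left|right]; exact: sl.
Qed.

Lemma good_setT : good [set: vec R d].
Proof. by rewrite -setC0; apply: goodC; exact: good_set0. Qed.

Lemma goodU A B : good A -> good B -> good (A `|` B).
Proof.
move=> gA gB; rewrite -[A `|` B]setCK setCU.
by apply: goodC; apply: goodI; exact: goodC.
Qed.

Lemma measurable_le_coord m (t : R) :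
  measurable [set x : vec R d | (tnth x m : R) <= t].
Proof.
rewrite (_ : [set _ | _] = (@tnth d (measurableTypeR R))^~ m @^-1` `]-oo, t]).
  by rewrite -[X in measurable X]setTI; apply: measurable_tnth.
by apply/seteqP; split => x /=; rewrite in_itv.
Qed.

(** The map [t |-> (1 + t) / 2] brings the values of the wave into [0, 1]. *)
Let half_wave (h : R -> R) v m : trig h v -> (forall t, -1 <= h t <= 1) ->
  forall c, -1 < c <= 1 -> good [set x : vec R d | c <= h (tnth x m)].
Proof.
move=> th h1 c c1.
rewrite (_ : [set _ | _] = [set x | (1 + c) / 2 <= 1 / 2 + 1 / 2 * h (tnth x m)]).
  apply: good_level; last lra.
  - exact: (spanD (span_cst d _) (spanZ _ (span_coord m th))).
  - by move=> x _; have := h1 (tnth x m); lra.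
by apply/seteqP; split => x /=; lra.
Qed.

Let sinw (t : R) : R := sin (wave 1 t).
Let cosw (t : R) : R := cos (wave 1 t).

Let waveE (t : R) : wave 1 t = 2 * pi * t. Proof. by rewrite /wave mulr1. Qed.

Let sin_pos (t : R) : 0 < t < 1 / 2 -> 0 < sinw t.
Proof.
move=> t2; rewrite /sinw waveE; apply: sin_gt0_pi.
by have := pi_gt0 R; move: t2 => /andP[? ?] ?; apply/andP; split; nra.
Qed.

Let sin_neg (t : R) : 1 / 2 < t < 1 -> sinw t < 0.
Proof.
move=> t2; have : 0 < sinw (1 - t) by apply: sin_pos; lra.
rewrite /sinw !waveE mulrBr mulr1 sinB [2 * pi]mulr_natl sin2pi cos2pi.
by rewrite mul0r mul1r sub0r oppr_gt0.
Qed.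

Let cos_refl (t : R) : cosw (1 - t) = cosw t.
Proof.
rewrite /cosw !waveE mulrBr mulr1 cosB [2 * pi]mulr_natl sin2pi cos2pi.
by rewrite mul0r mul1r addr0.
Qed.

Let cos_mono (s t : R) : 0 <= s <= 1 / 2 -> 0 <= t <= 1 / 2 ->
  (cosw s <= cosw t) = (t <= s).
Proof.
move=> s2 t2; have p0 := pi_gt0 R.
have I (u : R) : 0 <= u <= 1 / 2 -> 2 * pi * u \in `[0, pi].
  by move=> /andP[? ?]; rewrite in_itv/=; apply/andP; split; nra.
rewrite leNgt /cosw !waveE ltr_cos ?I// -leNgt ler_pM2l//.
by rewrite mulr_gt0.
Qed.

(** Up to two slices, the half cube is where the first sine wave is nonnegative. *)
Lemma good_half m : good [set x : vec R d | (tnth x m : R) <= 1 / 2].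
Proof.
have g : good [set x : vec R d | 0 <= sinw (tnth x m)].
  apply: (half_wave m (trig_sin 1)); last lra.
  by move=> t; rewrite sin_geN1 sin_le1.
apply: (good_off_slices (m := m) (c1 := 1 / 2) (c2 := 1) g (measurable_le_coord m _)).
move=> x Dx /= x2 x1; have x01 := Dx m.
case: (ltgtP (tnth x m : R) (1 / 2)) x2 => [lt|gt|//] _.
  have [->|x0] := eqVneq (tnth x m : R) 0.
    by rewrite /sinw waveE mulr0 sin0.
  split=> // _; apply: ltW; apply: sin_pos; rewrite lt andbT lt_neqAle eq_sym x0.
  by case/andP: x01.
split=> //; have : sinw (tnth x m) < 0.
  by apply: sin_neg; rewrite gt lt_neqAle x1; case/andP: x01.
by rewrite ltNge => /negP.
Qed.

(** The first cosine wave is monotone on each half of the unit interval, so that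
    its level sets, cut by the half cube, give all intervals from 0. *)
Lemma good_coord m (t : R) : good [set x : vec R d | (tnth x m : R) <= t].
Proof.
have mt := measurable_le_coord m t.
have [t0|t0] := ltP t 0.
  apply: (good_off_slices (m := m) (c1 := 0) (c2 := 0) (good_set0 d) mt) => x Dx _ _ /=.
  by split=> // xt; have := Dx m; lra.
have [t1|t1] := leP 1 t.
  apply: (good_off_slices (m := m) (c1 := 0) (c2 := 0) good_setT mt) => x Dx _ _ /=.
  by split=> // _; have := Dx m; lra.
have gc (s : R) : 0 <= s < 1 / 2 -> good [set x : vec R d | cosw s <= cosw (tnth x m)].
  move=> s2; apply: (half_wave m (trig_cos 1)).
    by move=> u; rewrite cos_geN1 cos_le1.
  rewrite /cosw cos_le1 andbT -[-1](_ : cosw (1 / 2) = _); last first.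
    by rewrite /cosw waveE (_ : 2 * pi * (1 / 2) = pi) ?cospi//; lra.
  by rewrite ltNge cos_mono -?ltNge; lra.
have gh := good_half m.
have [t2|t2|->//] := ltgtP t (1 / 2).
  apply: (good_off_slices (m := m) (c1 := 1) (c2 := 1)
    (goodI gh (gc t _)) mt) => [|x Dx _ _ /=]; first lra.
  have := Dx m; split => [[x2]|xt]; first by rewrite cos_mono; lra.
  by rewrite cos_mono; lra.
apply: (good_off_slices (m := m) (c1 := t) (c2 := 1 / 2)
    (goodU gh (goodC (gc (1 - t) _))) mt) => [|x Dx xt x2 /=]; first lra.
have := Dx m => x01; split => [[|]|lt]; first lra.
- move/negP; rewrite -ltNge; have [|x3] := leP (tnth x m : R) (1 / 2); first lra.
  by rewrite -(cos_refl (tnth x m)) ltNge cos_mono -?ltNge; lra.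
- have [|x3] := leP (tnth x m : R) (1 / 2); first by left.
  right; apply/negP; rewrite -ltNge -(cos_refl (tnth x m)) ltNge cos_mono; lra.
Qed.

(** The good sets form a sigma-algebra containing the half-spaces. *)
Lemma good_measurable A : measurable A -> good A.
Proof.
have coord m (B : set (measurableTypeR R)) : measurable B ->
    good ((@tnth d (measurableTypeR R))^~ m @^-1` B).
  move=> mB'; have mB : (@RGenOInfty.G R).-sigma.-measurable B.
    by rewrite -RGenOInfty.measurableE.
  pose G := [set B : set R | good ((@tnth d (measurableTypeR R))^~ m @^-1` B)].
  apply: (@smallest_sub _ _ _ G _ _ _ mB).
    split => /=.
    - by rewrite /G /= preimage_set0; exact: good_set0.
    - by move=> E; rewrite /G /= setTD preimage_setC; exact: goodC.
    - by move=> F gF; rewrite /G /= preimage_bigcup; exact: good_bigcup.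
  move=> _ [t ->]; rewrite /G /=.
  rewrite (_ : _ @^-1` _ = ~` [set x | (tnth x m : R) <= t]).
    exact: goodC (good_coord m t).
  by apply/seteqP; split => x /=; rewrite in_itv/= andbT ltNge => /negP.
move=> mA; apply: (@smallest_sub _ _ _ [set A | good A] _ _ _ mA).
  split => /=.
  - exact: good_set0.
  - by move=> E; rewrite setTD; exact: goodC.
  - by move=> F gF; exact: good_bigcup.
apply: (big_ind (fun S : set (set (vec R d)) => S `<=` [set A | good A])) => //.
  by move=> S T hS hT B [/hS|/hT].
by move=> m _ B [C mC <-] /=; rewrite setTI; exact: coord.
Qed.

End borel.

(** * Completeness of the Fourier basis *)

Section completeness.
Import HBNNSimple.
Context {R : realType} (d : nat).
Local Notation mu := (@lebesgue_tuple R d).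
Local Notation D := (@cube R d).
Implicit Types (f g p q : vec R d -> R) (A B : set (vec R d)).

Definition dist2 f g : R := ip (fun x => f x - g x) (fun x => f x - g x).

(** Trigonometric polynomials as a dense class: [approx f] says that [f] lies in
    their mean-square closure. *)
Definition approx f : Prop := sqint f /\
  forall e, 0 < e -> exists p, span p /\ dist2 f p <= e.

Lemma dist2_triangle f g h : sqint f -> sqint g -> sqint h ->
  dist2 f h <= 2 * (dist2 f g + dist2 g h).
Proof.
move=> sf sg sh; apply: ip_le_double; [exact: sqintB..|].
move=> x _; rewrite (_ : f x - h x = (f x - g x) + (g x - h x)); last ring.
exact: ler_normD.
Qed.

Lemma approx_closed f : sqint f ->
  (forall e, 0 < e -> exists g, approx g /\ dist2 f g <= e) -> approx f.
Proof.
move=> sf fg; split=> // e e0; have e40 : 0 < e / 4 by rewrite divr_gt0.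
have [g [[sg gp] fge]] := fg _ e40; have [p [sp gpe]] := gp _ e40.
exists p; split => //.
apply: (le_trans (dist2_triangle sf sg (span_sqint sp))); lra.
Qed.

Lemma approx_indic A : measurable A -> approx (\1_A : vec R d -> R).
Proof.
move=> mA; split; first exact: sqint_indic.
by move=> e e0; have [_ /(_ e e0)[p [sp _ pe]]] := good_measurable mA; exists p.
Qed.

Lemma approxZ a f : approx f -> approx (fun x => a * f x).
Proof.
move=> [sf fp]; split; first exact: sqintZ.
move=> e e0; have b0 : 0 < a ^+ 2 + 1 by rewrite ltr_wpDl// sqr_ge0.
have [p [sp pe]] := fp _ (divr_gt0 e0 b0); exists (fun x => a * p x); split.
  exact: spanZ.
have sfp : sqint (fun x => f x - p x) by apply: sqintB => //; exact: span_sqint.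
rewrite (_ : dist2 _ _ = a ^+ 2 * dist2 f p).
  move: pe; rewrite ler_pdivlMr// => pe; apply: le_trans pe.
  by rewrite mulrC ler_wpM2l ?ip_ge0// lerDl.
rewrite /dist2 /ip -RintegralZl; [|exact: measurable_cube|exact: sqintM].
by apply: eq_Rintegral => x _; ring.
Qed.

Lemma approxD f g : approx f -> approx g -> approx (fun x => f x + g x).
Proof.
move=> [sf fp] [sg gp]; split; first exact: sqintD.
move=> e e0; have e40 : 0 < e / 4 by rewrite divr_gt0.
have [p [sp pe]] := fp _ e40; have [q [sq qe]] := gp _ e40.
exists (fun x => p x + q x); split; first exact: spanD.
have sfp : sqint (fun x => f x - p x) by apply: sqintB => //; exact: span_sqint.
have sgq : sqint (fun x => g x - q x) by apply: sqintB => //; exact: span_sqint.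
apply: (@le_trans _ _ (2 * (dist2 f p + dist2 g q))); last lra.
apply: ip_le_double => //.
  by apply: sqintB; apply: sqintD => //; exact: span_sqint.
move=> x _; rewrite (_ : _ - _ = (f x - p x) + (g x - q x)); last ring.
exact: ler_normD.
Qed.

Lemma approx_sum (I : Type) (s : seq I) (F : I -> vec R d -> R) :
  (forall i, approx (F i)) -> approx (fun x => \sum_(i <- s) F i x).
Proof.
move=> aF; elim: s => [|i s ih].
  rewrite (_ : (fun _ => _) = (fun x => 0 * \1_(set0 : set (vec R d)) x)).
    by apply: approxZ; exact: approx_indic.
  by apply/funext => x; rewrite big_nil mul0r.
rewrite (_ : (fun _ => _) = fun x => F i x + \sum_(j <- s) F j x).
  exact: approxD.
by apply/funext => x; rewrite big_cons.
Qed.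

Lemma approx_simple (s : {nnsfun (vec R d) >-> R}) : approx (s : vec R d -> R).
Proof.
rewrite (_ : (s : _ -> _) = fun x => \sum_(y <- finmap.enum_fset (fset_set (range s)))
    y * \1_(s @^-1` [set y]) x).
  apply: approx_sum => y; apply: approxZ; apply: approx_indic.
  exact: measurable_sfunP.
by apply/funext => x; rewrite {1}fimfunE fsbig_finite.
Qed.

(** A nonnegative function is an increasing limit of simple functions, and
    indicators of measurable sets are approximable. *)
Lemma approx_sqint f : sqint f -> (forall x, D x -> 0 <= f x) -> approx f.
Proof.
move=> sf f0; apply: approx_closed => // e e0; have [mf if2] := sf.
have mD := @measurable_cube R d.
have mf' : measurable_fun D (EFin \o f) by apply/measurable_EFinP.
have [||s [nds cs]] := @approximation _ _ R D mD (EFin \o f).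
- exact: mf'.
- by move=> x Dx; rewrite lee_fin; exact: f0.
have cs' x : D x -> s n x @[n --> \oo] --> f x.
  by move=> Dx; have /fine_cvgP[_] := cs x Dx.
have sle n x : D x -> s n x <= f x.
  move=> Dx; have -> : f x = limn (fun n => s n x) by apply/esym/cvg_lim => //; exact: cs'.
  apply: nondecreasing_cvgn_le; last by apply/cvg_ex; exists (f x); exact: cs'.
  by move=> a b ab; have /lefP := nds _ _ ab; exact.
have [|||n ne] := @ip_dominated _ _ (fun n x => f x - s n x) (fun x => f x ^+ 2)
    _ if2 _ _ e e0.
- by move=> n; apply: sqintB => //; case: (approx_simple (s n)).
- move=> n x Dx; have := sle n x Dx; have := f0 x Dx.
  have : 0 <= s n x by []. nra.
- move=> x Dx; rewrite -[X in _ --> X](subrr (f x)).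
  by apply: cvgB; [exact: cvg_cst|exact: cs'].
by exists (s n); split => //; exact: approx_simple.
Qed.

Section projections.
Variable J : nat.
Implicit Types j : mindex d J.

Lemma mval_inj (j k : mindex d J) : [forall m, mval j m == mval k m] = (j == k).
Proof.
apply/forallP/eqP => [h|-> m //]; apply/ffunP => m; apply: val_inj.
by have /eqP[] := h m.
Qed.

Lemma theta_span (c : mindex d J -> R) g : sqint g ->
  ip (fun x => \sum_(j : mindex d J) c j * fourier (mval j) x) g =
  \sum_(j : mindex d J) c j * theta g (mval j).
Proof.
move=> sg; rewrite ip_suml// => [|j]; last by apply: sqintZ; exact: sqint_fourier.
apply: eq_bigr => j _; rewrite ipZl//; last exact: sqint_fourier.
by rewrite ipC.
Qed.

Lemma theta_fourier (k : 'I_d -> nat) j : (forall m, 0 < k m)%N ->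
  theta (fourier k) (mval j) = [forall m, k m == mval j m]%:R :> R.
Proof. by move=> k0; exact: ip_fourier. Qed.

(** The squared distance of [f] to its projection is nonnegative. *)
Lemma bessel f : sqint f ->
  \sum_(j : mindex d J) theta f (mval j) ^+ 2 <= ip f f.
Proof.
move=> sf; pose c (j : mindex d J) := theta f (mval j).
pose p x := \sum_(j : mindex d J) c j * fourier (mval j) x.
have sp : sqint p by apply: sqint_sum => j; apply: sqintZ; exact: sqint_fourier.
have := ip_ge0 (fun x => f x - p x).
rewrite ipBl ?ipBr//; last exact: sqintB.
rewrite (ipC f p) /p theta_span// theta_span//.
rewrite (eq_bigr (fun j => c j ^+ 2)); last by [].
rewrite [X in _ - (_ - X)](eq_bigr (fun j => c j ^+ 2)).
  by rewrite subrr subr0 subr_ge0.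
move=> j _; rewrite /theta -/(ip _ _) theta_span; last exact: sqint_fourier.
rewrite (bigD1 j)//= theta_fourier// mval_inj eqxx mulr1 big1 ?addr0//.
by move=> k kj; rewrite theta_fourier// mval_inj eq_sym (negbTE kj) mulr0.
Qed.

(** The part of the pairing that the frequencies up to [J] miss. *)
Definition residue f g : R :=
  ip f g - \sum_(j : mindex d J) theta f (mval j) * theta g (mval j).

Lemma thetaB f g (k : 'I_d -> nat) : sqint f -> sqint g ->
  theta (fun x => f x - g x) k = theta f k - theta g k.
Proof. by move=> sf sg; rewrite /theta -!/(ip _ _) ipBl//; exact: sqint_fourier. Qed.

Lemma residueB f g h : sqint f -> sqint g -> sqint h ->
  residue (fun x => f x - g x) h = residue f h - residue g h.
Proof.
move=> sf sg sh; rewrite /residue ipBl//.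
rewrite (eq_bigr (fun j : mindex d J => theta f (mval j) * theta h (mval j) -
    theta g (mval j) * theta h (mval j))); last first.
  by move=> j _; rewrite thetaB// mulrBl.
by rewrite sumrB; ring.
Qed.

(** Bessel's inequality makes the residue continuous in mean square, uniformly in
    the cutoff. *)
Lemma residue_bound t f g : 0 < t -> sqint f -> sqint g ->
  `|residue f g| <= t * ip f f + t^-1 * ip g g.
Proof.
move=> t0 sf sg; rewrite /residue; apply: (le_trans (ler_normB _ _)).
have h1 := ip_young t0 sf sg.
have ti0 : 0 < t^-1 by rewrite invr_gt0.
have h2 : 2 * `|\sum_(j : mindex d J) theta f (mval j) * theta g (mval j)| <=
    t * ip f f + t^-1 * ip g g.
  apply: (@le_trans _ _ (t * (\sum_(j : mindex d J) theta f (mval j) ^+ 2) +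
      t^-1 * (\sum_(j : mindex d J) theta g (mval j) ^+ 2))); last first.
    by apply: lerD; apply: ler_wpM2l; rewrite ?(ltW t0) ?(ltW ti0)// bessel.
  rewrite !mulr_sumr -big_split/=; apply: (@le_trans _ _ (2 *
      (\sum_(j : mindex d J) `|theta f (mval j) * theta g (mval j)|))).
    by rewrite ler_wpM2l// ler_norm_sum.
  rewrite mulr_sumr; apply: ler_sum => j _; rewrite normrM.
  set a := theta _ _; set b := theta _ _.
  rewrite -[a ^+ 2]real_normK ?num_real// -[b ^+ 2]real_normK ?num_real//.
  have := normr_ge0 a; have := normr_ge0 b.
  move: `|a| `|b| => u v v0 u0.
  have : 0 <= t^-1 * (t * u - v) ^+ 2 by rewrite mulr_ge0 ?sqr_ge0// ltW.
  rewrite (_ : t^-1 * (t * u - v) ^+ 2 = t * u ^+ 2 - 2 * (u * v) + t^-1 * v ^+ 2).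
    by move=> ?; lra.
  by field; rewrite gt_eqF.
lra.
Qed.

End projections.

Lemma residue_fourier J (k : 'I_d -> nat) g :
  (forall m, 0 < k m <= J)%N -> sqint g -> residue J (fourier k) g = 0.
Proof.
move=> kJ sg; rewrite /residue.
have [j jk] : exists j : mindex d J, forall m, k m = mval j m.
  have lt m : ((k m).-1 < J)%N by have := kJ m; lia.
  by exists [ffun m => Ordinal (lt m)] => m; rewrite /mval ffunE /=; have := kJ m; lia.
have -> : k = mval j by apply/funext.
rewrite (bigD1 j)//= theta_fourier// mval_inj eqxx mul1r big1 ?addr0.
  by rewrite ipC subrr.
by move=> i ij; rewrite theta_fourier// mval_inj eq_sym (negbTE ij) mul0r.
Qed.

Lemma residue_suml J (I : Type) (s : seq I) (F : I -> vec R d -> R) g :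
  (forall i, sqint (F i)) -> sqint g ->
  residue J (fun x => \sum_(i <- s) F i x) g = \sum_(i <- s) residue J (F i) g.
Proof.
move=> sF sg; rewrite /residue ip_suml// sumrB exchange_big/=; congr (_ - _).
apply: eq_bigr => j _; rewrite -mulr_suml; congr (_ * _).
by rewrite /theta -/(ip _ _) ip_suml//; exact: sqint_fourier.
Qed.

Lemma residueZ J a f g : sqint f -> sqint g ->
  residue J (fun x => a * f x) g = a * residue J f g.
Proof.
move=> sf sg; rewrite /residue ipZl// mulrBr; congr (_ - _).
rewrite mulr_sumr; apply: eq_bigr => j _; rewrite mulrA; congr (_ * _).
by rewrite /theta -/(ip _ _) ipZl//; exact: sqint_fourier.
Qed.

Lemma residue_span p : span p -> exists J0, forall J g, (J0 <= J)%N ->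
  sqint g -> residue J p g = 0.
Proof.
move=> [I [c [k [k0 /funext ->]]]].
exists (\max_(i : I) \max_(m < d) k i m)%N => J g J0 sg.
have s1 i : sqint (fun x => c i * fourier (k i) x) by apply: sqintZ; exact: sqint_fourier.
rewrite residue_suml// big1// => i _.
rewrite residueZ ?residue_fourier ?mulr0//; last exact: sqint_fourier.
move=> m; rewrite k0/=; apply: leq_trans J0.
by rewrite (bigD1 i)//= (bigD1 m)//= -maxnA leq_maxl.
Qed.

(** Parseval's identity for [f] and [g] as a limit: the residue of a trigonometric
    polynomial eventually vanishes, and [f] is close to one. *)
Lemma residue_cvg f g e : sqint f -> (forall x, D x -> 0 <= f x) -> sqint g ->
  0 < e -> exists J0, forall J, (J0 <= J)%N -> `|residue J f g| <= e.
Proof.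
move=> sf f0 sg e0; have [_ fp] := approx_sqint sf f0.
(* With this weight, both terms of residue_bound are at most e / 2. *)
pose t := 2 * (ip g g + 1) / e; have gg := ip_ge0 g.
have t0 : 0 < t by rewrite divr_gt0// mulr_gt0// ltr_wpDl.
have [p [sp pe]] := fp (e / (2 * t)) (divr_gt0 e0 (mulr_gt0 (ltr0Sn _ _) t0)).
have sp' := span_sqint sp.
have [J0 pJ] := residue_span sp; exists J0 => J JJ0.
have -> : residue J f g = residue J (fun x => f x - p x) g.
  by rewrite residueB// pJ// subr0.
apply: (le_trans (residue_bound J t0 (sqintB sf sp') sg)).
have h1 : t * ip (fun x => f x - p x) (fun x => f x - p x) <= e / 2.
  apply: (@le_trans _ _ (t * (e / (2 * t)))); first by rewrite ler_wpM2l// ltW.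
  by rewrite le_eqVlt; apply/orP; left; apply/eqP; field; rewrite gt_eqF.
have h2 : t^-1 * ip g g <= e / 2.
  rewrite /t invf_div -mulrA mulrC ler_pdivlMr// [X in X <= _](_ : _ =
    e * (ip g g / (ip g g + 1))); last by field; rewrite gt_eqF// ltr_wpDl.
  by apply: ler_piMr; [exact: ltW|rewrite ler_pdivrMr ?mul1r ?ltr_wpDl// lerDl].
lra.
Qed.

End completeness.

(** * Sobolev balls and the bias *)

Section sobolev_facts.
Context {R : realType} (d : nat).
Local Notation mu := (@lebesgue_tuple R d).
Local Notation D := (@cube R d).
Implicit Types (f g : vec R d -> R).

Lemma L2cube_sqint f : L2cube d f -> sqint f.
Proof.
rewrite /L2cube /=; set h := patch _ _ _ => hL; have mD := @measurable_cube R d.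
have mh : measurable_fun setT h by move: hL; rewrite inE => /andP[/= + _]; rewrite inE.
split; first by apply/(measurable_restrictT _ mD).
have := Lfun2_integrable_sqr hL => ih.
apply/(integrable_mkcond _ mD); rewrite (_ : _ \_ _ = EFin \o (fun x => h x ^+ 2))//.
apply/funext => x; rewrite patchE /= /h patchE; case: ifP => // _.
by rewrite expr0n.
Qed.

Definition sobolev_weight (b : R) (j : 'I_d -> nat) : R :=
  \sum_(m < d) (j m)%:R `^ (2 * b).

Lemma sobolev_weight_ge0 b j : 0 <= sobolev_weight b j.
Proof. by apply: sumr_ge0 => m _; exact: powR_ge0. Qed.

Lemma sobolev_sum J b r f : sobolev d b r f ->
  \sum_(j : mindex d J) sobolev_weight b (mval j) * theta f (mval j) ^+ 2 <= r ^+ 2.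
Proof.
move=> [_ fr]; rewrite -lee_fin; apply: le_trans fr.
pose h (j : mindex d J) : {ffun 'I_d -> nat} := [ffun m => mval j m].
have hE j : mval j = h j by apply/funext => m; rewrite ffunE.
have h_inj : injective h.
  move=> j k /ffunP jk; apply/ffunP => m; apply: val_inj.
  by have := jk m; rewrite !ffunE => -[].
apply: esum_ge; exists [set` [seq h j | j <- enum (mindex d J)]].
  split; first exact: finite_seq.
  by move=> _ /= /mapP[j _ ->] m; rewrite ffunE.
rewrite -fsbig_seq; last by rewrite map_inj_uniq ?enum_uniq. rewrite [leRHS]big_map big_enum/=.
by rewrite sumEFin lee_fin; apply: ler_sum => j _; rewrite hE.
Qed.

(** Lower resolutions index a subset of the frequencies of higher ones. *)
Lemma sum_mindex_widen J J' (F : ('I_d -> nat) -> R) : (J <= J')%N ->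
  \sum_(j : mindex d J) F (mval j) =
  \sum_(j : mindex d J' | [forall m, (j m < J)%N]) F (mval j).
Proof.
move=> JJ; pose h (j : mindex d J) : mindex d J' := [ffun m => widen_ord JJ (j m)].
have hE j : mval j = mval (h j) by apply/funext => m; rewrite /mval ffunE.
have h_inj : injective h.
  move=> j k /ffunP jk; apply/ffunP => m; apply: val_inj.
  by have := jk m; rewrite !ffunE => -[].
transitivity (\sum_(j in h @: [set: mindex d J]) F (mval j)).
  rewrite big_imset/=; last by move=> ? ? _ _; exact: h_inj.
  by apply: eq_big => [j|j _]; rewrite ?in_setT// hE.
apply: eq_bigl => j; apply/imsetP/forallP => [[k _ ->] m|jJ].
  by rewrite ffunE /=.
exists [ffun m => Ordinal (jJ m)]; first by rewrite in_setT.
by apply/ffunP => m; rewrite !ffunE; exact: val_inj.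
Qed.

(** Up to [e], the residue is a finite sum over the frequencies between [J] and
    some larger cutoff. Such a frequency has a coordinate above [J], so its weight
    is at least [(J + 1)^(2 b)] in the one class and [(J + 1)^(2 c)] in the
    other. *)
Lemma bias f g b c r J : sobolev d b r f -> (forall x, D x -> 0 <= f x) ->
  sobolev d c 1 g -> 0 <= b -> 0 <= c -> 0 < r ->
  `|residue J f g| <= r * J.+1%:R `^ (- (b + c)).
Proof.
move=> fb f0 gc b0 c0 r0; apply/ler_addgt0Pr => e e0.
have sf : sqint f by apply: L2cube_sqint; case: fb.
have sg : sqint g by apply: L2cube_sqint; case: gc.
have [J0 J0P] := residue_cvg sf f0 sg e0; pose J' := maxn J0 J.
have JJ : (J <= J')%N by exact: leq_maxr.
have := J0P J' (leq_maxl _ _).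
rewrite /residue (sum_mindex_widen (fun j => theta f j * theta g j) JJ).
rewrite [X in `|_ - X| <= _ -> _](bigID (fun j : mindex d J' => [forall m, (j m < J)%N])) /=.
set S := \sum_(j | [forall m, _]) _; set T := \sum_(j | ~~ _) _ => h.
suff hT : `|T| <= r * J.+1%:R `^ (- (b + c)).
  rewrite (_ : ip f g - S = (ip f g - (S + T)) + T); last ring.
  by apply: (le_trans (ler_normD _ _)); rewrite addrC lerD.
pose u := J.+1%:R : R; have u0 : 0 < u by rewrite ltr0n.
have tail a q (k : vec R d -> R) : 0 <= a -> sobolev d a q k ->
    \sum_(j : mindex d J' | ~~ [forall m, (j m < J)%N]) theta k (mval j) ^+ 2 <=
    q ^+ 2 * u `^ (- (2 * a)).
  move=> a0 ka; rewrite powRN ler_pdivlMr ?powR_gt0//.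
  apply: le_trans (sobolev_sum J' ka); rewrite mulr_suml.
  rewrite [leRHS](bigID (fun j : mindex d J' => [forall m, (j m < J)%N])) /=.
  apply: (@le_trans _ _ (\sum_(j : mindex d J' | ~~ [forall m, (j m < J)%N])
      sobolev_weight a (mval j) * theta k (mval j) ^+ 2)); last first.
    by rewrite lerDr sumr_ge0// => j _; rewrite mulr_ge0 ?sqr_ge0// sobolev_weight_ge0.
  apply: ler_sum => j; rewrite negb_forall => /existsP[m]; rewrite -leqNgt => Jm.
  rewrite mulrC ler_wpM2r ?sqr_ge0// /sobolev_weight (bigD1 m)//=.
  apply: (@le_trans _ _ ((mval j m)%:R `^ (2 * a))).
    by rewrite ge0_ler_powR ?nnegrE ?mulr_ge0// ler_nat.
  by rewrite lerDl sumr_ge0// => i _; exact: powR_ge0.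
have h1 := tail _ _ _ b0 fb; have h2 := tail _ _ _ c0 gc.
(* The weight that balances the two tails. *)
pose t := u `^ (b - c) / r; have t0 : 0 < t by rewrite divr_gt0// powR_gt0.
have ti0 : 0 < t^-1 by rewrite invr_gt0.
have key : 2 * `|T| <= t * (r ^+ 2 * u `^ (- (2 * b))) +
    t^-1 * (1 ^+ 2 * u `^ (- (2 * c))).
  apply: (le_trans _ (lerD (ler_wpM2l (ltW t0) h1) (ler_wpM2l (ltW ti0) h2))).
  rewrite !mulr_sumr -big_split/=; apply: (@le_trans _ _ (2 *
      (\sum_(j : mindex d J' | ~~ [forall m, (j m < J)%N])
         `|theta f (mval j) * theta g (mval j)|))).
    by rewrite ler_wpM2l// ler_norm_sum.
  rewrite mulr_sumr; apply: ler_sum => j _; rewrite normrM.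
  set x := theta _ _; set y := theta _ _.
  rewrite -[x ^+ 2]real_normK ?num_real// -[y ^+ 2]real_normK ?num_real//.
  move: `|x| `|y| => v w.
  have : 0 <= t^-1 * (t * v - w) ^+ 2 by rewrite mulr_ge0 ?sqr_ge0// ltW.
  rewrite (_ : t^-1 * (t * v - w) ^+ 2 = t * v ^+ 2 - 2 * (v * w) + t^-1 * w ^+ 2).
    by move=> ?; lra.
  by field; rewrite gt_eqF.
have pE x y : u `^ x * u `^ y = u `^ (x + y).
  by rewrite powRD// (gt_eqF u0) implybT.
have e1 : t * (r ^+ 2 * u `^ (- (2 * b))) = r * u `^ (- (b + c)).
  rewrite /t (_ : _ * _ = r * (u `^ (b - c) * u `^ (- (2 * b)))); last first.
    by field; rewrite gt_eqF.
  by rewrite pE; congr (_ * powR _ _); ring.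
have e2 : t^-1 * (1 ^+ 2 * u `^ (- (2 * c))) = r * u `^ (- (b + c)).
  rewrite /t invf_div expr1n mul1r mulrAC -powRN -mulrA.
  by rewrite pE; congr (_ * powR _ _); ring.
move: key; rewrite e1 e2; lra.
Qed.

End sobolev_facts.

(** * Moments of the mechanism of one resolution *)

Section mechanism_moments.
Context {R : realType} (d L J : nat).
Hypothesis JE : J = (2 ^ L.+1 - 1)%N.
Implicit Types (j : mindex d J) (l : lindex d J).

Lemma level_eq : level J = L.
Proof.
have := expn_gt0 2 L.
by rewrite /level JE => h; apply: trunc_log_eq => //; rewrite expnS; lia.
Qed.

Lemma mval_lt (j : mindex d J) m : (mval j m < 2 ^ L.+1)%N.
Proof. by rewrite /mval; have := ltn_ord (j m); have := expn_gt0 2 L.+1; move: JE; lia. Qed.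

Definition block_of (j : mindex d J) : lindex d J :=
  [ffun m => inord (trunc_log 2 (mval j m))].

Lemma block_ofP j l : (j \in block l) = (block_of j == l).
Proof.
rewrite inE; apply/forallP/eqP => [h|<- m].
  apply/ffunP => m; rewrite ffunE; apply: val_inj.
  have /andP[h1 h2] := h m; have e : trunc_log 2 (mval j m) = l m.
    by apply: trunc_log_eq => //; rewrite h1 /=; have := expn_gt0 2 (l m).+1; lia.
  by rewrite /= inordK e.
have j0 : (0 < mval j m)%N by [].
rewrite ffunE inordK; last first.
  rewrite level_eq; have := trunc_logP (isT : 1 < 2)%N j0.
  move/leq_ltn_trans => /(_ _ (mval_lt j m)).
  by rewrite ltn_exp2l.
have /andP[h1 h2] := trunc_log_bounds (isT : 1 < 2)%N j0.
by rewrite h1 /=; lia.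
Qed.

Lemma card_ord_interval (n a b : nat) : (a <= b <= n)%N ->
  #|[pred i : 'I_n | (a <= i < b)%N]| = (b - a)%N.
Proof.
move=> /andP[ab bn]; rewrite -sum1_card -(big_mkord (fun i => a <= i < b)%N (fun=> 1%N)).
rewrite (@big_cat_nat _ _ _ a) ?(leq_trans ab)//= big1_seq => [|i]; last first.
  by rewrite mem_index_iota; lia.
rewrite add0n (@big_cat_nat _ _ _ b)//= [X in (_ + X)%N]big1_seq => [|i]; last first.
  by rewrite mem_index_iota; lia.
rewrite addn0 big_seq_cond (eq_bigl (fun i => i \in index_iota a b)); last first.
  by move=> i; rewrite mem_index_iota; lia.
by rewrite -big_seq sum_nat_const_nat muln1.
Qed.

Lemma card_block l : #|{: {j | j \in block l}}| = block_dim l.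
Proof.
rewrite card_sig (eq_card (B := family (fun m =>
    [pred i : 'I_J | (2 ^ l m - 1 <= i < 2 ^ (l m).+1 - 1)%N]))); last first.
  move=> j; rewrite !inE; apply: eq_forallb => m; rewrite inE /mval.
  have a0 : (0 < 2 ^ l m)%N by rewrite expn_gt0.
  have := expnS 2 (l m); move: (2 ^ l m)%N (2 ^ (l m).+1)%N (nat_of_ord (j m)) a0 => a b c.
  lia.
rewrite card_family foldrE big_map big_enum /=; apply: eq_bigr => m _.
have lL : (l m <= L)%N by rewrite -[leqRHS]level_eq -ltnS ltn_ord.
have e0 : (0 < 2 ^ l m)%N by rewrite expn_gt0.
have e1 := expnS 2 (l m).
have e2 : (2 ^ (l m).+1 <= 2 ^ L.+1)%N by rewrite leq_exp2l.
rewrite card_ord_interval; move: e0 e1 e2 (JE);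
  move: (2 ^ l m)%N (2 ^ (l m).+1)%N (2 ^ L.+1)%N => a b c; lia.
Qed.

Lemma block_dim_gt0 l : (0 < block_dim l)%N.
Proof. by rewrite /block_dim prodn_gt0// => m; rewrite expn_gt0. Qed.

Lemma block_weight_gt0 (delta : R) l : 0 < block_weight delta l.
Proof. by rewrite powR_gt0// ltr0n block_dim_gt0. Qed.

Lemma total_weight_gt0 (delta : R) : 0 < total_weight d J delta.
Proof.
rewrite /total_weight (bigD1 [ffun=> ord0])//= ltr_pwDl ?block_weight_gt0//.
by apply: sumr_ge0 => l _; exact: ltW (block_weight_gt0 _ _).
Qed.

Lemma block_weight_le (delta : R) l : block_weight delta l <= total_weight d J delta.
Proof.
rewrite /total_weight (bigD1 l)//= lerDl.
by apply: sumr_ge0 => i _; exact: ltW (block_weight_gt0 _ _).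
Qed.

Lemma B0_gt0 : 0 < B0 d :> R. Proof. by rewrite powR_gt0. Qed.

Variables (alpha delta : R).
Hypothesis alpha_gt0 : 0 < alpha.

Lemma block_privacy_gt0 l : 0 < block_privacy alpha delta l.
Proof. by rewrite mulr_gt0 ?block_weight_gt0// divr_gt0// total_weight_gt0. Qed.

Lemma block_privacy_le l : block_privacy alpha delta l <= alpha.
Proof.
rewrite /block_privacy mulrAC ler_pdivrMr ?total_weight_gt0//.
by rewrite ler_pM2l// block_weight_le.
Qed.

Lemma block_amplitude_gt0 l : 0 < block_amplitude alpha delta l.
Proof.
rewrite /block_amplitude -card_block; apply: amplitude_gt0.
- exact: B0_gt0.
- exact: block_privacy_gt0.
Qed.

Section at_point.
Variable x : vec R d.

Let mass l (u : {ffun {j | j \in block l} -> bool}) : R :=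
  block_mass (B0 d) (block_dim l) (block_privacy alpha delta l)
    (fun j : {j | j \in block l} => fourier (mval (val j)) x) u.

Let card_block_gt0 l : (0 < #|{: {j | j \in block l}}|)%N.
Proof. by rewrite card_block block_dim_gt0. Qed.

Let phi_le l (j : {j | j \in block l}) : `|fourier (mval (val j)) x| <= B0 d.
Proof. exact: fourier_bound. Qed.

Lemma mechanism_ge0 (z : {ffun mindex d J -> bool}) : 0 <= mechanism_mass alpha delta x z.
Proof.
apply: prodr_ge0 => l _; rewrite -card_block; apply: block_mass_ge0;
  by [exact: B0_gt0|exact: block_privacy_gt0|exact: card_block_gt0|exact: phi_le].
Qed.

Lemma sum_mechanism :
  \sum_(z : {ffun mindex d J -> bool}) mechanism_mass alpha delta x z = 1.
Proof.
rewrite (sum_blockwise block_ofP mass) big1// => l _.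
rewrite /mass -card_block; apply: sum_block_mass;
  by [exact: B0_gt0|exact: block_privacy_gt0|exact: card_block_gt0].
Qed.

Lemma mean_mechanism l j : j \in block l ->
  \sum_(z : {ffun mindex d J -> bool})
    mechanism_mass alpha delta x z * with_sign (block_amplitude alpha delta l) (z j) =
  fourier (mval j) x.
Proof.
(* The sign at j is a product over the blocks with one factor different from 1. *)
move=> jl; pose s l' (u : {ffun {j | j \in block l'} -> bool}) : R :=
  if insub j is Some i then with_sign (block_amplitude alpha delta l') (u i) else 1.
have sE (z : {ffun mindex d J -> bool}) l' : s l' [ffun i => z (val i)] =
    if l' == l then with_sign (block_amplitude alpha delta l) (z j) else 1.
  rewrite /s; case: eqP => [->|ll']; first by rewrite insubT /= ffunE.
  rewrite insubF// block_ofP; move: jl; rewrite block_ofP => /eqP ->.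
  by apply/eqP => e; exact: ll'.
transitivity (\sum_(z : {ffun mindex d J -> bool}) \prod_l'
    (mass [ffun i : {j | j \in block l'} => z (val i)] *
     s l' [ffun i => z (val i)])).
  apply: eq_bigr => z _; rewrite big_split /=; congr (_ * _).
  by rewrite (bigD1 l)//= sE eqxx big1 ?mulr1// => l' /negbTE l'l; rewrite sE l'l.
rewrite (sum_blockwise block_ofP (fun l' u => mass u * s l' u)) (bigD1 l)//=.
rewrite [X in _ * X]big1 ?mulr1 => [|l' l'l].
  transitivity (\sum_u mass u * with_sign (block_amplitude alpha delta l)
      (u (exist (fun j => j \in block l) j jl))).
    by apply: eq_bigr => u _; rewrite /s insubT.
  rewrite /mass /block_amplitude -card_block.
  pose i0 : {j | j \in block l} := exist _ j jl.
  exact: (@mean_block_mass R {j | j \in block l} (B0 d)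
    (block_privacy alpha delta l) B0_gt0 (block_privacy_gt0 l) (card_block_gt0 l)
    (fun j : {j | j \in block l} => fourier (mval (val j)) x) i0).
transitivity (\sum_(u : {ffun {j | j \in block l'} -> bool}) mass u).
  apply: eq_bigr => u _; rewrite /s insubF ?mulr1//.
  by apply: contraNF l'l; rewrite !block_ofP in jl *; rewrite (eqP jl) eq_sym.
rewrite /mass -card_block; apply: sum_block_mass;
  by [exact: B0_gt0|exact: block_privacy_gt0|exact: card_block_gt0].
Qed.

End at_point.
End mechanism_moments.

(** * Moment generating function of a random sign *)

Section sub_gaussian.
Context {R : realType}.
Implicit Types (x mu p m : R).

Lemma derive_nonneg_le (F f : R -> R) x :
  (forall y : R, is_derive y (1 : R) F (f y)) -> (forall y, 0 <= y -> 0 <= f y) ->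
  0 <= x -> F 0 <= F x.
Proof.
move=> dF f0; rewrite le_eqVlt => /orP[/eqP <-//|x0].
have cF : {within `[0, x], continuous F}.
  by apply: derivable_within_continuous => y _; case: (dF y).
have [c /[!in_itv]/= /andP[c0 _] e] := MVT x0 (fun y _ => dF y) cF.
by rewrite -subr_ge0 e mulr_ge0 ?f0 ?subr0// ltW.
Qed.

(** The quotient of the two sides is monotone because [tanh y <= y]. *)
Lemma cosh_le_gauss x : expR x + expR (- x) <= 2 * expR (x ^+ 2 / 2).
Proof.
wlog x0 : x / 0 <= x.
  move=> H; case: (leP 0 x) => [/H//|x0].
  by have := H (- x); rewrite opprK sqrrN addrC; apply; rewrite oppr_ge0 ltW.
have tanh (y : R) : 0 <= y -> expR y - expR (- y) <= y * (expR y + expR (- y)).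
  move=> y0; rewrite -subr_ge0.
  have := @derive_nonneg_le (fun y : R => y * (expR y + expR (- y)) - (expR y - expR (- y)))
    (fun y : R => y * (expR y - expR (- y))) y _ _ y0.
  rewrite mul0r oppr0 !subrr; apply.
    move=> z; apply: is_derive_eq; rewrite /GRing.scale /=; ring.
  move=> z z0; rewrite mulr_ge0// subr_ge0 ler_expR; lra.
have := @derive_nonneg_le
  (fun y : R => - ((expR y + expR (- y)) * expR (- (y ^+ 2 / 2))))
  (fun y : R => (y * (expR y + expR (- y)) - (expR y - expR (- y))) * expR (- (y ^+ 2 / 2)))
  x _ _ x0.
rewrite expr0n /= mul0r oppr0 expR0 mulr1 lerN2 => h.
have {h} : (expR x + expR (- x)) * expR (- (x ^+ 2 / 2)) <= 1 + 1.
  apply: h => [z|z z0]; last first.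
    by rewrite mulr_ge0 ?expR_ge0// subr_ge0 tanh.
  by apply: is_derive_eq; rewrite /GRing.scale /=; field.
by rewrite [expR (- (_ / _))]expRN ler_pdivrMr ?expR_gt0.
Qed.

(** By Jensen's inequality, a centred sign is dominated by its difference from an
    independent copy, whose moment generating function is that of a symmetric
    variable. *)
Lemma sub_gaussian_sign p mu : 0 <= p <= 1 ->
  p * expR (mu * (1 - (2 * p - 1))) + (1 - p) * expR (- mu * (1 + (2 * p - 1))) <=
  expR (mu ^+ 2).
Proof.
move=> /andP[p0 p1]; set m := 2 * p - 1.
pose a := expR mu; pose b := expR (- mu); pose t := expR (- (mu * m)).
have ab : a * b = 1 by rewrite /a /b -expRD subrr expR0.
have t0 : 0 < t by exact: expR_gt0.
have -> : expR (mu * (1 - m)) = a * t by rewrite -expRD; congr expR; ring.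
have -> : expR (- mu * (1 + m)) = b * t by rewrite -expRD; congr expR; ring.
have jensen : t <= p * b + (1 - p) * a.
  have h1 : t * (1 - mu * (1 - m)) <= b.
    rewrite (_ : b = t * expR (- (mu * (1 - m)))).
      by rewrite ler_pM2l// expR_ge1Dx.
    by rewrite -expRD; congr expR; ring.
  have h2 : t * (1 + mu * (1 + m)) <= a.
    rewrite (_ : a = t * expR (mu * (1 + m))).
      by rewrite ler_pM2l// expR_ge1Dx.
    by rewrite -expRD; congr expR; ring.
  have h3 := ler_wpM2l p0 h1.
  have q0 : 0 <= 1 - p by lra.
  have h4 := ler_wpM2l q0 h2.
  apply: le_trans (lerD h3 h4); rewrite le_eqVlt; apply/orP; left; apply/eqP.
  by rewrite /m; ring.
have G0 : 0 <= p * a + (1 - p) * b.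
  by rewrite addr_ge0// mulr_ge0 ?expR_ge0//; lra.
rewrite (_ : _ + _ = (p * a + (1 - p) * b) * t); last ring.
apply: (le_trans (ler_wpM2l G0 jensen)).
have c := cosh_le_gauss mu; rewrite -/a -/b in c.
apply: (@le_trans _ _ (((a + b) / 2) ^+ 2)).
  have : 0 <= (1 / 2 - p) ^+ 2 * (a - b) ^+ 2 by rewrite mulr_ge0// sqr_ge0.
  by nra.
rewrite (_ : mu ^+ 2 = mu ^+ 2 / 2 + mu ^+ 2 / 2); last by field.
have s0 : 0 <= (a + b) / 2 by rewrite divr_ge0// addr_ge0 ?expR_ge0.
by rewrite expRD -expr2 ler_pXn2r// ?nnegrE ?expR_ge0//; lra.
Qed.

End sub_gaussian.

(** * Law of the views of one resolution *)

Lemma measure_bigcup_finType d (T : measurableType d) (R : realType)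
    (m : {measure set T -> \bar R}) (I : finType) (F : I -> set T) :
  (forall i, measurable (F i)) -> (forall i j w, F i w -> F j w -> i = j) ->
  (m (\bigcup_(i in [set: I]) F i) = \sum_i m (F i))%E.
Proof.
move=> mF dF; rewrite measure_fin_bigcup//.
- rewrite (_ : [set: I] = [set` enum I]); last first.
    by apply/seteqP; split => i //= _; rewrite mem_enum.
  by rewrite -fsbig_seq ?enum_uniq// big_enum.
- exact: finite_finset.
- by move=> i j _ _ [w [Fi Fj]]; exact: dF Fi Fj.
Qed.

Lemma with_sign_inj (R : realType) (b : R) : 0 < b -> injective (with_sign b).
Proof. by move=> b0 [] [] //=; rewrite /with_sign => e; exfalso; lra. Qed.

Section law.
Context {R : realType} (d n : nat) (alpha delta : R).
Hypothesis alpha_gt0 : 0 < alpha.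
Local Notation mu := (@lebesgue_tuple R d).
Local Notation D := (@cube R d).
Local Notation models := (models n alpha).

Lemma modelsP J : J \in models -> exists L, J = (2 ^ L.+1 - 1)%N.
Proof. by move=> /mapP[L _ ->]; exists L. Qed.

Lemma models_uniq : uniq models.
Proof.
rewrite map_inj_uniq ?iota_uniq// => a b e.
have : (2 ^ a.+1 = 2 ^ b.+1)%N.
  by have := expn_gt0 2 a.+1; have := expn_gt0 2 b.+1; move: e; lia.
by move/eqP; rewrite eqn_exp2l// => /eqP[].
Qed.

Local Notation mech x z := (mechanism_mass alpha delta x z).

Lemma mech_ge0 J (x : vec R d) (z : {ffun mindex d J -> bool}) : J \in models ->
  0 <= mech x z.
Proof. by move=> /modelsP[L JL]; exact: (mechanism_ge0 JL). Qed.

Lemma mech_le1 J (x : vec R d) (z : {ffun mindex d J -> bool}) : J \in models ->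
  mech x z <= 1.
Proof.
move=> JM; have [L JL] := modelsP JM; rewrite -(sum_mechanism JL delta alpha_gt0 x).
rewrite (bigD1 z)//= lerDl sumr_ge0// => y _; exact: mech_ge0.
Qed.

Lemma measurable_mech J (z : {ffun mindex d J -> bool}) :
  measurable_fun setT (fun x : vec R d => mech x z).
Proof.
apply: measurable_prod => l _; apply: measurable_sum => v.
apply: measurable_funM => //; apply: measurable_prod => i _.
rewrite /bernoulli_mass; case: (v i).
  apply: measurable_funD => //; apply: measurable_funM => //.
  exact: measurable_fourier.
apply: measurable_funB => //; apply: measurable_funD => //; apply: measurable_funM => //.
exact: measurable_fourier.
Qed.

Definition joint (s : seq nat) (y : forall J, {ffun mindex d J -> bool}) (x : vec R d) : R :=
  \prod_(J <- s) mech x (y J).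

Lemma joint01 s y x : {subset s <= models} -> 0 <= joint s y x <= 1.
Proof.
rewrite /joint; elim: s => [|J s ih] sM; first by rewrite big_nil ler01 lexx.
have JM : J \in models by apply: sM; rewrite inE eqxx.
have /ih/andP[h0 h1] : {subset s <= models} by move=> a as_; apply: sM; rewrite inE as_ orbT.
by rewrite big_cons mulr_ge0 ?mech_ge0//= mulr_ile1 ?mech_ge0 ?mech_le1.
Qed.

Lemma sqint_joint s y : {subset s <= models} -> sqint (joint s y).
Proof.
move=> sM; apply: (@bounded_sqint _ _ _ 1) => [|x _].
  by apply: measurable_funTS; apply: measurable_prod => J _; exact: measurable_mech.
by have /andP[h0 h1] := joint01 y x sM; rewrite ger0_norm.
Qed.

Lemma sqint_mech J (y : {ffun mindex d J -> bool}) : J \in models ->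
  sqint (fun x : vec R d => mech x y).
Proof.
move=> JM; apply: (@bounded_sqint _ _ _ 1) => [|x _].
  by apply: measurable_funTS; exact: measurable_mech.
by rewrite ger0_norm ?mech_le1 ?mech_ge0.
Qed.

Context disp (Omega : measurableType disp) (P : probability Omega R).
Variables (f : vec R d -> R) (X : 'I_n -> {mfun Omega >-> vec R d})
  (Z : forall J, 'I_n -> mindex d J -> {mfun Omega >-> R}).
Hypotheses (sf : sqint f) (f_ge0 : forall x, D x -> 0 <= f x)
  (f_mass : (\int[mu]_(x in D) (f x)%:E = 1)%E).
Hypothesis law : privatized_sample alpha delta P f X Z.

Definition signs := forall J, 'I_n -> {ffun mindex d J -> bool}.

Definition event (s : seq nat) (z : signs) : set Omega :=
  [set w | forall J i (l : lindex d J) j, J \in s -> j \in block l ->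
     Z i j w = with_sign (block_amplitude alpha delta l) (z J i j)].

Lemma measurable_event s z : measurable (event s z).
Proof.
rewrite (_ : event s z = \bigcap_(J in [set` s]) \bigcap_(i in [set: 'I_n])
   \bigcap_(l in [set: lindex d J]) \bigcap_(j in [set j | j \in block l])
     (Z i j @^-1` [set with_sign (block_amplitude alpha delta l) (z J i j)])).
  apply: fin_bigcap_measurable => [|J _]; first exact: finite_seq.
  do 3 (apply: fin_bigcap_measurable => [|? _]; first exact: finite_finset).
  by rewrite -[X in measurable X]setTI; exact: measurable_funP.
apply/seteqP; split => w h.
  by move=> J Js i _ l _ j jl /=; exact: h.
by move=> J i l j Js jl; exact: (h J Js i I l I j jl).
Qed.

Definition law_of s (y : forall J, {ffun mindex d J -> bool}) : R := ip f (joint s y).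

Definition update (z : signs) J (u : {ffun 'I_n -> {ffun mindex d J -> bool}}) : signs :=
  dfwith z J (fun i => u i).

Lemma update_same z J (u : {ffun 'I_n -> {ffun mindex d J -> bool}}) i :
  update z u J i = u i.
Proof. by rewrite /update dfwithin. Qed.

Lemma update_other z J (u : {ffun 'I_n -> {ffun mindex d J -> bool}}) J' :
  J != J' -> update z u J' = z J'.
Proof. by move=> JJ; rewrite /update dfwithout. Qed.

Lemma sum_law J s (z : signs) : {subset J :: s <= models} -> J \notin s ->
  \sum_(u : {ffun 'I_n -> {ffun mindex d J -> bool}})
     \prod_(i < n) law_of (J :: s) (fun J' => update z u J' i) =
  \prod_(i < n) law_of s (fun J' => z J' i).
Proof.
move=> sM Js; have JM : J \in models by apply: sM; rewrite inE eqxx.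
have sM' : {subset s <= models} by move=> a as_; apply: sM; rewrite inE as_ orbT.
pose F i (y : {ffun mindex d J -> bool}) : R :=
  ip f (fun x => mech x y * joint s (fun J' => z J' i) x).
transitivity (\sum_(u : {ffun 'I_n -> {ffun mindex d J -> bool}}) \prod_(i < n) F i (u i)).
  apply: eq_bigr => u _; apply: eq_bigr => i _; congr ip; apply/funext => x.
  rewrite /joint big_cons update_same; congr (_ * _).
  apply: eq_big_seq => J' J's; rewrite update_other//.
  by apply: contraNneq Js => ->.
rewrite -bigA_distr_bigA; apply: eq_bigr => i _; rewrite /F /law_of.
have sj (y : {ffun mindex d J -> bool}) :
    sqint (fun x : vec R d => mech x y * joint s (fun J' => z J' i) x).
  apply: (@bounded_sqint _ _ _ 1) => [|x _].
    apply: measurable_funTS; apply: measurable_funM; first exact: measurable_mech.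
    by apply: measurable_prod => J' _; exact: measurable_mech.
  have /andP[h0 h1] := joint01 (fun J' => z J' i) x sM'.
  by rewrite ger0_norm ?mulr_ge0 ?mech_ge0// mulr_ile1 ?mech_le1 ?mech_ge0.
rewrite ipC.
transitivity (ip (fun x : vec R d => \sum_(y : {ffun mindex d J -> bool})
   mech x y * joint s (fun J' => z J' i) x) f).
  by rewrite ip_suml//; apply: eq_bigr => y _; rewrite ipC.
congr ip; apply/funext => x; have [L JL] := modelsP JM.
by rewrite -mulr_suml (sum_mechanism JL delta alpha_gt0) mul1r.
Qed.

(** The joint law prescribes the probabilities of patterns specified on all the
    levels; the levels in [t] are summed out one after the other. The inequality
    suffices because the masses of the patterns of a level add up to 1. *)
Lemma event_law t s (z : signs) : perm_eq models (t ++ s) ->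
  ((\prod_(i < n) law_of s (fun J => z J i))%:E <= P (event s z))%E.
Proof.
elim: t s z => [|J t ih] s z /=.
  move=> pm; have sM : {subset s <= models} by move=> a; rewrite (perm_mem pm).
  have := @law (fun=> setT) z (fun=> measurableT).
  rewrite (_ : [set w | _ /\ _] = event s z); last first.
    apply/seteqP; split => w /=.
      by move=> [_ h] J i l j; rewrite -(perm_mem pm); exact: h.
    by move=> h; split=> // J i l j; rewrite (perm_mem pm); exact: h.
  move=> ->; rewrite le_eqVlt; apply/orP; left; apply/eqP.
  rewrite -prodEFin; apply: eq_bigr => i _; rewrite setIT /law_of /ip /Rintegral.
  rewrite fineK; last first.
    apply: (integrable_fin_num (@measurable_cube R d)).
    exact: sqintM sf (sqint_joint _ sM).
  by apply: eq_integral => x _; rewrite /joint (perm_big _ pm).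
move=> pm; have pm' : perm_eq models (t ++ J :: s).
  by apply: (perm_trans pm); rewrite -cat_cons -cat1s -[J :: s]cat1s !catA perm_cat2r perm_catC.
have um := models_uniq; rewrite (perm_uniq pm') cat_uniq /= in um.
have /and3P[_ _ /andP[Js _]] := um.
have sM : {subset J :: s <= models}.
  by move=> a as_; rewrite (perm_mem pm') mem_cat as_ orbT.
have JM : J \in models by apply: sM; rewrite inE eqxx.
have [L JL] := modelsP JM.
rewrite -(sum_law z sM Js).
apply: (@le_trans _ _ (\sum_(u : {ffun 'I_n -> {ffun mindex d J -> bool}})
    P (event (J :: s) (update z u)))%E).
  by rewrite -sumEFin; apply: lee_sum => u _; exact: ih.
rewrite -measure_bigcup_finType.
- apply: le_measure; rewrite ?inE.
  + by apply: fin_bigcup_measurable => [|u _]; [exact: finite_finset|exact: measurable_event].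
  + exact: measurable_event.
  + move=> w [u _ h] J' i l j J's jl.
    have J's' : J' \in J :: s by rewrite inE J's orbT.
    by rewrite (h J' i l j J's' jl) update_other//; apply: contraNneq Js => ->.
- by move=> u; exact: measurable_event.
- move=> u v w hu hv; apply/ffunP => i; apply/ffunP => j.
  have jl : j \in block (block_of j) by rewrite (block_ofP JL).
  have a0 := block_amplitude_gt0 JL delta alpha_gt0 (block_of j).
  have := hu J i _ j (mem_head _ _) jl; rewrite (hv J i _ j (mem_head _ _) jl).
  by rewrite !update_same => /(with_sign_inj a0).
Qed.

Section one_level.
Variable J : nat.
Hypothesis JM : J \in models.
Local Notation pattern := {ffun 'I_n -> {ffun mindex d J -> bool}}.

Definition level_event (z : pattern) : set Omega :=
  event [:: J] (update (fun J i => [ffun=> true]) z).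

Definition level_mass (y : {ffun mindex d J -> bool}) : R :=
  ip f (fun x => mech x y).

Lemma level_mass_ge0 y : 0 <= level_mass y.
Proof. by apply: Rintegral_ge0 => x Dx; rewrite mulr_ge0 ?f_ge0 ?mech_ge0. Qed.

Lemma sum_level_mass : \sum_y level_mass y = 1.
Proof.
rewrite (eq_bigr (fun y => ip (fun x => mech x y) f)) => [|y _]; last by rewrite ipC.
rewrite -ip_suml// => [|y]; last exact: sqint_mech.
have [L JL] := modelsP JM; rewrite /ip /Rintegral (eq_integral (fun x => (f x)%:E)).
  by rewrite f_mass.
by move=> x _; rewrite (sum_mechanism JL delta alpha_gt0) mul1r.
Qed.

Lemma mean_level_mass (l : lindex d J) j : j \in block l ->
  \sum_y level_mass y * with_sign (block_amplitude alpha delta l) (y j) =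
  theta f (mval j).
Proof.
move=> jl; set b := block_amplitude _ _ _.
rewrite (eq_bigr (fun y : {ffun mindex d J -> bool} =>
    ip (fun x => with_sign b (y j) * mech x y) f)) => [|y _]; last first.
  by rewrite ipZl//; [rewrite mulrC ipC|exact: sqint_mech].
rewrite -ip_suml// => [|y]; last by apply: sqintZ; exact: sqint_mech.
have [L JL] := modelsP JM; rewrite /theta -/(ip _ _) [RHS]ipC; congr ip.
apply/funext => x; rewrite -(mean_mechanism JL delta alpha_gt0 x jl).
by apply: eq_bigr => y _; rewrite mulrC.
Qed.

Lemma level_eventE (z : pattern) w : level_event z w <-> forall i (l : lindex d J) j,
  j \in block l -> Z i j w = with_sign (block_amplitude alpha delta l) (z i j).
Proof.
split => [h i l j jl|h J' i l j].
  by rewrite (h J i l j (mem_head _ _) jl) update_same.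
by rewrite inE => /eqP e; subst J' => jl; rewrite (h i l j jl) update_same.
Qed.

Let mass_le (z : pattern) : ((\prod_(i < n) level_mass (z i))%:E <= P (level_event z))%E.
Proof.
have pm : perm_eq models (rem J models ++ [:: J]).
  by apply: (perm_trans (perm_to_rem JM)); rewrite -cat1s perm_catC.
apply: le_trans (event_law _ pm); rewrite lee_fin le_eqVlt; apply/orP; left; apply/eqP.
apply: eq_bigr => i _; congr ip; apply/funext => x.
by rewrite /joint big_seq1 update_same.
Qed.

Let disjoint_events (z z' : pattern) w : level_event z w -> level_event z' w -> z = z'.
Proof.
have [L JL] := modelsP JM; rewrite !level_eventE => h h'.
apply/ffunP => i; apply/ffunP => j.
have jl : j \in block (block_of j) by rewrite (block_ofP JL).
have a0 := block_amplitude_gt0 JL delta alpha_gt0 (block_of j).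
by have := h i _ j jl; rewrite (h' i _ j jl) => /(with_sign_inj a0).
Qed.

Let sum_mass : \sum_(z : pattern) \prod_(i < n) level_mass (z i) = 1.
Proof.
rewrite -(bigA_distr_bigA (fun i y => level_mass y)) big1// => i _.
exact: sum_level_mass.
Qed.

Let measurable_level_event z : measurable (level_event z).
Proof. exact: measurable_event. Qed.

Let sum_events : (\sum_(z : pattern) P (level_event z) = 1)%E.
Proof.
apply/eqP; rewrite eq_le; apply/andP; split.
  rewrite -measure_bigcup_finType//; apply: probability_le1.
  by apply: fin_bigcup_measurable => //; exact: finite_finset.
rewrite -[leLHS](_ : (\sum_(z : pattern) \prod_(i < n) level_mass (z i))%:E = 1%E).
  by rewrite -sumEFin; apply: lee_sum => z _; exact: mass_le.
by rewrite sum_mass.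
Qed.

(** Lower bounds of the probabilities of disjoint events that already add up to 1
    are equalities. *)
Lemma level_event_mass (z : pattern) : P (level_event z) = (\prod_(i < n) level_mass (z i))%:E.
Proof.
pose p (z : pattern) := fine (P (level_event z)).
have pE z' : P (level_event z') = (p z')%:E by rewrite fineK// fin_num_measure.
rewrite pE; congr EFin.
have sp : \sum_z p z = 1.
  by apply: EFin_inj; rewrite -sum_events -sumEFin; apply: eq_bigr => z' _; rewrite pE.
have le (z' : pattern) : \prod_(i < n) level_mass (z' i) <= p z' by rewrite -lee_fin -pE.
have : \sum_(z' : pattern) (p z' - \prod_(i < n) level_mass (z' i)) = 0.
  by rewrite sumrB sp sum_mass subrr.
move=> /psumr_eq0P h; apply/eqP; rewrite -subr_eq0; apply/eqP; apply: h => // z' _.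
by rewrite subr_ge0.
Qed.

(** The patterns of one level exhaust the probability, so that expectations are
    finite sums. *)
Lemma expectation_level (g : Omega -> R) (h : pattern -> R) :
  measurable_fun setT g -> (forall w, 0 <= g w) ->
  (forall z, 0 <= h z) -> (forall z w, level_event z w -> g w = h z) ->
  (\int[P]_w (g w)%:E = (\sum_(z : pattern) h z * \prod_(i < n) level_mass (z i))%:E)%E.
Proof.
move=> mg g0 h0 gh.
pose G w := (\sum_(z : pattern) (h z)%:E * (\1_(level_event z) w)%:E)%E.
have mG (z : pattern) : measurable_fun setT (fun w => (h z)%:E * (\1_(level_event z) w)%:E)%E.
  by apply/measurable_EFinP; apply: measurable_funM => //; exact: measurable_indic.
pose E := \bigcup_(z in [set: pattern]) level_event z.
have mE : measurable E.
  by apply: fin_bigcup_measurable => //; exact: finite_finset.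
have PE : P E = 1%E by rewrite measure_bigcup_finType.
transitivity (\int[P]_w G w)%E.
  apply: ge0_ae_eq_integral => //.
  - exact/measurable_EFinP.
  - by apply: emeasurable_sum => z; exact: mG.
  - by move=> w _; rewrite lee_fin.
  - move=> w _; apply: sume_ge0 => z _; apply: mule_ge0; rewrite lee_fin// indicE.
  exists (~` E); split; first exact: measurableC.
    by have := probability_setC P mE; rewrite PE subee.
  move=> w /= nw [z _ zw]; apply: nw => _; rewrite (gh z w zw) /G (bigD1 z)//=.
  rewrite big1 ?adde0 => [|z' z'z].
    by rewrite indicE mem_set// mule1.
  rewrite indicE memNset ?mule0// => z'w.
  by move: z'z; rewrite (disjoint_events z'w zw) eqxx.
rewrite /G ge0_integral_sum//; last first.
  by move=> z w _; apply: mule_ge0; rewrite lee_fin// indicE.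
rewrite -sumEFin; apply: eq_bigr => z _.
rewrite ge0_integralZl_EFin//; last by apply/measurable_EFinP; exact: measurable_indic.
by rewrite integral_indic// setIT EFinM; congr (_ * _)%E; exact: level_event_mass.
Qed.

(** Each released coordinate is a sign times its amplitude with the right mean,
    and the individuals are independent. *)
Lemma exp_moment (l : lindex d J) j c : j \in block l ->
  (\int[P]_w (expR (c * \sum_(i < n) (Z i j w - theta f (mval j))))%:E <=
   (expR (n%:R * (c * block_amplitude alpha delta l) ^+ 2))%:E)%E.
Proof.
move=> jl; set b := block_amplitude _ _ _; set t := theta _ _.
have [L JL] := modelsP JM; have b0 : 0 < b := block_amplitude_gt0 JL delta alpha_gt0 l.
pose F (y : {ffun mindex d J -> bool}) := expR (c * (with_sign b (y j) - t)).
rewrite (expectation_level (h := fun z => \prod_(i < n) F (z i))); first last.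
- move=> z w /level_eventE zw; rewrite mulr_sumr expR_sum; apply: eq_bigr => i _.
  by rewrite (zw i l j jl).
- by move=> z; apply: prodr_ge0 => i _; exact: expR_ge0.
- by move=> w; exact: expR_ge0.
- apply: measurableT_comp => //; apply: measurable_funM => //.
  by apply: measurable_sum => i; exact: measurable_funB.
rewrite lee_fin; under eq_bigr do rewrite -big_split /=.
rewrite -(bigA_distr_bigA (fun _ y => F y * level_mass y)) prodr_const card_ord.
have -> : expR (n%:R * (c * b) ^+ 2) = expR ((c * b) ^+ 2) ^+ n.
  by rewrite mulrC expRM_natr.
pose p := \sum_(y : {ffun mindex d J -> bool} | y j) level_mass y.
have pE : 1 - p = \sum_(y : {ffun mindex d J -> bool} | ~~ y j) level_mass y.
  by rewrite -sum_level_mass (bigID (fun y : {ffun mindex d J -> bool} => y j)) /= -/p addrAC subrr add0r.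
have tE : t = b * (2 * p - 1).
  rewrite /t -(mean_level_mass jl) (bigID (fun y : {ffun mindex d J -> bool} => y j)) /=.
  rewrite (eq_bigr (fun y => level_mass y * b)) => [|y yj]; last by rewrite /with_sign yj.
  rewrite [X in _ + X](eq_bigr (fun y => level_mass y * (- b))) => [|y /negbTE yj]; last first.
    by rewrite /with_sign yj.
  by rewrite -!mulr_suml -pE -/p; ring.
have p01 : 0 <= p <= 1.
  have q0 : 0 <= 1 - p by rewrite pE sumr_ge0// => y _; exact: level_mass_ge0.
  have p0 : 0 <= p by rewrite sumr_ge0// => y _; exact: level_mass_ge0.
  by rewrite p0 -subr_ge0.
rewrite lerXn2r// ?nnegrE ?expR_ge0 ?sumr_ge0//.
  by move=> y _; rewrite mulr_ge0 ?expR_ge0 ?level_mass_ge0.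
apply: le_trans (sub_gaussian_sign (c * b) p01); rewrite le_eqVlt; apply/orP; left; apply/eqP.
rewrite (bigID (fun y : {ffun mindex d J -> bool} => y j)) /=; congr (_ + _).
  rewrite /p mulr_suml; apply: eq_bigr => y yj; rewrite mulrC; congr (_ * _).
  by rewrite /F /with_sign yj tE; congr expR; rewrite -/p; ring.
rewrite pE mulr_suml; apply: eq_bigr => y /negbTE yj; rewrite mulrC; congr (_ * _).
by rewrite /F /with_sign yj tE; congr expR; ring.
Qed.

End one_level.

End law.

(** * Size of the amplitudes *)

Section constants.
Context {R : realType}.

(** A squared form of [C(2 m, m) >= 4^m / (2 sqrt m)], which stays within the
    natural numbers and goes by induction. *)
Lemma central_bin q : (16 ^ q.+1 <= 4 * q.+1 * 'C(q.+1.*2, q.+1) ^ 2)%N.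
Proof.
elim: q => [|q ih]; first by [].
set m := q.+1 in ih *; set c := 'C(m.*2, m) in ih.
have step : (m.+1 * 'C(m.+1.*2, m.+1) = 2 * m.*2.+1 * c)%N.
  have e1 : (m.+1 * 'C(m.*2.+1, m.+1) = m.*2.+1 * c)%N.
    by rewrite -mul_bin_diag.
  have e2 : 'C(m.+1.*2, m.+1) = (2 * 'C(m.*2.+1, m.+1))%N.
    rewrite doubleS binS -[X in (_ + X)%N]bin_sub; last by lia.
    by rewrite (_ : m.*2.+1 - m = m.+1)%N ?mul2n ?addnn//; lia.
  by rewrite e2; lia.
rewrite -(leq_pmul2l (ltn0Sn m)) expnS.
apply: (@leq_trans (m.+1 * (16 * (4 * m * c ^ 2)))%N).
  by rewrite leq_pmul2l// leq_pmul2l.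
have -> : (m.+1 * (4 * m.+1 * 'C(m.+1.*2, m.+1) ^ 2) = 4 * (m.+1 * 'C(m.+1.*2, m.+1)) ^ 2)%N.
  by rewrite expnMn; ring.
rewrite step !expnMn -addnn.
have -> : (m.+1 * (16 * (4 * m * c ^ 2)) = (64 * (m * m + m)) * c ^ 2)%N by ring.
rewrite mulnA leq_mul2r; apply/orP; right.
by rewrite (_ : (m + m).+1 ^ 2 = 4 * (m * m + m) + 1)%N; [lia|ring].
Qed.

(** Block dimensions are powers of two; for an even dimension [k], [Gamma_ k] is the
    inverse of [C(k, k / 2) / 2^k]. *)
Lemma Gamma_bound m : Gamma_ (2 ^ m) <= Num.sqrt (2 * (2 ^ m)%N%:R) :> R.
Proof.
case: m => [|m].
  rewrite /Gamma_ /= bin0 expr0 divr1 invr1 mulr1 -[leLHS]sqrtr1.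
  by rewrite ler_wsqrtr// ler1n.
have [q qE] : exists q, (2 ^ m = q.+1)%N.
  by exists (2 ^ m).-1; rewrite prednK ?expn_gt0.
have -> : (2 ^ m.+1 = q.+1.*2)%N by rewrite expnS qE mul2n.
have bE : ('C(q.+1.*2, q.+1) = 2 * 'C(q.+1.*2.-1, q.+1.*2.-1./2))%N.
  have -> : q.+1.*2.-1./2 = q by rewrite doubleS /= uphalf_double.
  rewrite doubleS [_.-1]/= binS -[X in (X + _)%N]bin_sub; last by lia.
  by rewrite (_ : q.*2.+1 - q.+1 = q)%N; lia.
set c := 'C(q.+1.*2.-1, _) in bE; have := central_bin q; rewrite bE => h.
have c0 : (0 < c)%N by rewrite bin_gt0; lia.
rewrite /Gamma_ -/c invf_div ler_pdivrMr ?ltr0n//.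
rewrite -(@ler_pXn2r _ 2)// ?nnegrE ?exprn_ge0 ?mulr_ge0 ?sqrtr_ge0//.
rewrite exprMn sqr_sqrtr ?mulr_ge0// -!natrX -!natrM ler_nat.
have : (16 * 16 ^ q <= 4 * q.+1 * (4 * c ^ 2))%N by rewrite -expnS (leq_trans h)// expnMn.
have -> : (2 ^ q.+1.*2.-1 = 2 * 4 ^ q)%N.
  by rewrite doubleS /= expnS -mul2n expnM.
have -> : ((2 * 4 ^ q) ^ 2 = 4 * 16 ^ q)%N by rewrite expnMn -expnM (mulnC q) expnM.
by move: (16 ^ q)%N (c ^ 2)%N => u v; nia.
Qed.

(** The function [x (e^x + 1) / (e^x - 1)] is nondecreasing on the positive reals;
    its value at [A] is the constant in [tau]. *)
Lemma privacy_factor_mono (a A : R) : 0 < a -> a <= A ->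
  (expR a + 1) / (expR a - 1) <= A * (expR A + 1) / (expR A - 1) / a.
Proof.
move=> a0 aA; have A0 : 0 < A by exact: lt_le_trans aA.
have ea : 0 < expR a - 1 by rewrite subr_gt0 expR_gt1.
have eA : 0 < expR A - 1 by rewrite subr_gt0 expR_gt1.
have sinh (x : R) : 0 <= x -> 2 * x <= expR x - expR (- x).
  move=> x0; rewrite -subr_ge0.
  have := @derive_nonneg_le _ (fun y : R => expR y - expR (- y) - 2 * y)
    (fun y : R => expR y + expR (- y) - 2) x _ _ x0.
  rewrite oppr0 mulr0 subrr subr0; apply.
    by move=> y; apply: is_derive_eq; rewrite /GRing.scale /=; ring.
  move=> y y0; have := expR_gt0 y; have := expR_gt0 (- y).
  have : expR y * expR (- y) = 1 by rewrite -expRD subrr expR0.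
  by have := sqr_ge0 (expR y - expR (- y)); nra.
have mono (x : R) : a <= x -> expR (- a) + a <= expR (- x) + x.
  move=> ax; have : expR (- x) = expR (- a) * expR (- (x - a)).
    by rewrite -expRD; congr expR; ring.
  have := expR_ge1Dx (- (x - a)); have : expR (- a) <= 1 by rewrite -expR0 ler_expR; lra.
  by have := expR_gt0 (- a); nra.
pose G (y : R) := (a + y) * (expR (a + y) + 1) * (expR a - 1) -
  a * (expR a + 1) * (expR (a + y) - 1).
have : G 0 <= G (A - a).
  apply: (@derive_nonneg_le _ G (fun y : R =>
    expR (a + y) * ((expR a - 1) * (expR (- (a + y)) + 1 + (a + y)) - a * (expR a + 1)))).
  - move=> y; have e : expR (a + y) * expR (- (a + y)) = 1 by rewrite -expRD subrr expR0.
    rewrite (_ : expR (a + y) * _ = (expR a - 1) * (expR (a + y) * expR (- (a + y)) +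
        expR (a + y) + expR (a + y) * (a + y)) - a * (expR a + 1) * expR (a + y)).
      by rewrite e; apply: is_derive_eq; rewrite /GRing.scale /=; ring.
    by ring.
  - move=> y y0; rewrite mulr_ge0 ?expR_ge0//.
    have h1 := mono (a + y) ltac:(lra).
    have h2 := sinh a (ltW a0).
    have e : expR a * expR (- a) = 1 by rewrite -expRD subrr expR0.
    by nra.
  - by rewrite subr_ge0.
rewrite /G addr0 subrr [a + _]addrC subrK subr_ge0 => h.
rewrite ler_pdivlMr// mulrAC ler_pdivrMr// mulrAC ler_pdivlMr//.
by move: h; lra.
Qed.

End constants.

(** * Pairing the noise with a Sobolev function *)

Section noise.
Context {R : realType} (d n L J : nat) (A alpha delta : R).
Hypothesis JE : J = (2 ^ L.+1 - 1)%N.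
Hypotheses (d_gt0 : (0 < d)%N) (n_gt0 : (0 < n)%N) (alpha_gt0 : 0 < alpha)
  (alpha_le : alpha <= A) (delta_gt0 : 0 < delta).
Implicit Types (l : lindex d J) (j : mindex d J).

Lemma powR_prod (I : finType) (F : I -> R) (r : R) : (forall i, 0 <= F i) ->
  (\prod_i F i) `^ r = \prod_i F i `^ r.
Proof.
move=> F0; suff [] : 0 <= \prod_i F i /\ (\prod_i F i) `^ r = \prod_i F i `^ r by [].
elim/big_rec2: _ => [|i y1 y2 _ [y0 <-]]; first by rewrite ler01 powR1.
by rewrite mulr_ge0// powRM.
Qed.

(** By the arithmetic-geometric mean inequality, the Sobolev weight of a frequency
    is controlled by the dimension of its dyadic block. *)
Lemma sobolev_weight_block l j : j \in block l ->
  d%:R * (block_dim l)%:R `^ (2 * delta / d%:R) <= sobolev_weight delta (mval j).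
Proof.
move=> jl; have d0 : (0 : R) < d%:R by rewrite ltr0n.
pose E m := (2 ^ l m)%N%:R `^ (2 * delta) : R.
apply: (@le_trans _ _ (\sum_m E m)); last first.
  apply: ler_sum => m _; move: jl; rewrite inE => /forallP/(_ m)/andP[h _].
  by rewrite ge0_ler_powR ?nnegrE ?mulr_ge0 ?ler_nat// ltW.
rewrite mulrC -ler_pdivlMr//.
have [+ _] := @leif_AGM _ _ (pred_of_argType 'I_d) E (fun m _ => powR_ge0 _ _).
rewrite card_ord => h.
rewrite -(@ler_pXn2r _ d)// ?nnegrE ?powR_ge0//; last first.
  by rewrite divr_ge0 ?sumr_ge0// => m _; exact: powR_ge0.
apply: le_trans h; rewrite /E -powR_prod// -natr_prod -/(block_dim l).
rewrite -powR_mulrn ?powR_ge0// -powRrM.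
by rewrite -mulrA mulVf ?mulr1// gt_eqF.
Qed.

(** Within a block all Sobolev weights are of the same order, so the Sobolev
    constraint bounds the energy of each block. *)
Lemma block_coefficients (g : vec R d -> R) l : sobolev d delta 1 g ->
  \sum_(j in block l) theta g (mval j) ^+ 2 <=
  (d%:R * (block_dim l)%:R `^ (2 * delta / d%:R))^-1.
Proof.
move=> sg; have b0 : (0 : R) < (block_dim l)%:R by rewrite ltr0n (block_dim_gt0 l).
set w := d%:R * _; have w0 : 0 < w by rewrite mulr_gt0 ?ltr0n ?powR_gt0.
rewrite -[leRHS]mul1r ler_pdivlMr// mulrC mulr_sumr.
have := sobolev_sum J sg; rewrite expr1n; apply: le_trans.
rewrite [leRHS](bigID (mem (block l)))/=; apply: ler_wpDr.
  by apply: sumr_ge0 => j _; rewrite mulr_ge0 ?sobolev_weight_ge0 ?sqr_ge0.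
by apply: ler_sum => j jl; rewrite ler_wpM2r ?sqr_ge0// sobolev_weight_block.
Qed.

(** The Cauchy-Schwarz inequality against a constant family. *)
Lemma sum_norm_le (I : finType) (S : {set I}) (F : I -> R) (M : R) : 0 < M ->
  (0 < #|S|)%N -> \sum_(i in S) F i ^+ 2 <= M ->
  \sum_(i in S) `|F i| <= Num.sqrt (#|S|%:R * M).
Proof.
move=> M0 S0 FM; set N := #|S|%:R : R; have N0 : 0 < N by rewrite ltr0n.
set q := Num.sqrt (N * M); have q0 : 0 < q by rewrite sqrtr_gt0 mulr_gt0.
have qq : q * q = N * M by rewrite -expr2 sqr_sqrtr// mulr_ge0// ltW.
have : \sum_(i in S) (2 * M * (q * `|F i|)) <=
    \sum_(i in S) (N * M * F i ^+ 2 + M ^+ 2).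
  apply: ler_sum => i _; have := sqr_ge0 (q * `|F i| - M).
  by rewrite -[F i ^+ 2]real_normK ?num_real// -qq; nra.
rewrite -!mulr_sumr big_split /= -mulr_sumr sumr_const -[_ *+ #|S|]mulr_natl -/N => h.
set s := \sum_(i in S) `|F i| in h *.
have h2 : 2 * M * (q * s) <= 2 * M * (q * q).
  apply: (le_trans h); rewrite qq.
  have := ler_wpM2l (ltW (mulr_gt0 N0 M0)) FM; nra.
by move: h2; rewrite !ler_pM2l// mulr_gt0.
Qed.

Lemma card_block_set l : #|block l| = block_dim l.
Proof. by rewrite -(card_block JE) card_sig. Qed.

Lemma block_amplitude_bound l : block_amplitude alpha delta l <=
  2 `^ (d%:R / 2) * (A * (expR A + 1) / (expR A - 1) / block_privacy alpha delta l) *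
  Num.sqrt (2 * (block_dim l)%:R).
Proof.
have a0 := block_privacy_gt0 delta alpha_gt0 l.
have aA : block_privacy alpha delta l <= A.
  exact: le_trans (block_privacy_le delta alpha_gt0 l) alpha_le.
rewrite /block_amplitude /amplitude /B0; apply: ler_pM.
- apply: mulr_ge0; first exact: powR_ge0.
  apply: divr_ge0; first by rewrite addr_ge0 ?expR_ge0.
  by rewrite subr_ge0 ltW// expR_gt1.
- by rewrite /Gamma_ invr_ge0 divr_ge0// exprn_ge0.
- by rewrite ler_wpM2l ?powR_ge0// privacy_factor_mono.
- rewrite (_ : block_dim l = 2 ^ (\sum_m l m))%N; first exact: Gamma_bound.
  by rewrite /block_dim expn_sum.
Qed.

(** On each block, the Cauchy-Schwarz inequality plays the amplitude of the noise
    against the energy of the test function; the product is a term of [Sigma_]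
    times the constant [tau]. *)
Lemma noise_bound (g : vec R d -> R) (e : mindex d J -> R) K :
  sobolev d delta 1 g -> 0 <= K ->
  (forall l j, j \in block l ->
     `|e j| <= K * (block_amplitude alpha delta l / Num.sqrt n%:R)) ->
  `|\sum_(j : mindex d J) e j * theta g (mval j)| <=
  K / Num.sqrt 2 * (tau d A * Sigma_ d n alpha delta J).
Proof.
move=> sg K0 eK; have d0 : (0 : R) < d%:R by rewrite ltr0n.
have n0 : (0 : R) < Num.sqrt n%:R by rewrite sqrtr_gt0 ltr0n.
apply: (le_trans (ler_norm_sum _ _ _)).
rewrite (partition_big (fun j : mindex d J => block_of j) xpredT)//= /Sigma_ !mulr_sumr; apply: ler_sum => l _.
have b0 : (0 : R) < (block_dim l)%:R by rewrite ltr0n (block_dim_gt0 l).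
have a0 := block_privacy_gt0 delta alpha_gt0 l.
set M := (d%:R * (block_dim l)%:R `^ (2 * delta / d%:R))^-1 : R.
have M0 : 0 < M by rewrite invr_gt0 mulr_gt0// powR_gt0.
have B0 := block_amplitude_gt0 JE delta alpha_gt0 l.
apply: (@le_trans _ _ (K * (block_amplitude alpha delta l / Num.sqrt n%:R) *
    \sum_(j in block l) `|theta g (mval j)|)).
  rewrite mulr_sumr [leLHS](eq_bigl (fun j => j \in block l)); last first.
    by move=> j; rewrite (block_ofP JE).
  by apply: ler_sum => j jl; rewrite normrM ler_wpM2r// eK.
have c0 : 0 <= K * (block_amplitude alpha delta l / Num.sqrt n%:R).
  by rewrite mulr_ge0// divr_ge0// ltW.
have := @sum_norm_le _ (block l) (fun j => theta g (mval j)) M M0.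
rewrite card_block_set => /(_ (block_dim_gt0 l) (block_coefficients l sg)) h.
apply: (le_trans (ler_wpM2l c0 h)).
apply: (@le_trans _ _ (K * ((2 `^ (d%:R / 2) * (A * (expR A + 1) / (expR A - 1) /
   block_privacy alpha delta l) * Num.sqrt (2 * (block_dim l)%:R)) / Num.sqrt n%:R) *
   Num.sqrt ((block_dim l)%:R * M))).
  rewrite ler_wpM2r ?sqrtr_ge0// ler_wpM2l// ler_wpM2r ?invr_ge0 ?sqrtr_ge0//.
  exact: block_amplitude_bound.
rewrite le_eqVlt; apply/orP; left; apply/eqP.
have sM : Num.sqrt ((block_dim l)%:R * M) =
    Num.sqrt (block_dim l)%:R / Num.sqrt d%:R / (block_dim l)%:R `^ (delta / d%:R).
  rewrite /M invfM sqrtrM ?ltW// sqrtrM ?invr_ge0 ?ltW// -[RHS]mulrA; congr (_ * _).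
  rewrite sqrtrV ?ltW//; congr (_ * _).
  rewrite sqrtrV ?powR_ge0//; congr (_^-1).
  rewrite -powR12_sqrt ?powR_ge0// -powRrM; congr powR.
  by field; rewrite gt_eqF.
have s2 : Num.sqrt (2 * (block_dim l)%:R) = Num.sqrt 2 * Num.sqrt (block_dim l)%:R :> R.
  by rewrite sqrtrM.
have sb : Num.sqrt (block_dim l)%:R * Num.sqrt (block_dim l)%:R = (block_dim l)%:R :> R.
  by rewrite -expr2 sqr_sqrtr// ltW.
have t2 : Num.sqrt 2 * Num.sqrt 2 = 2 :> R by rewrite -expr2 sqr_sqrtr.
have td : Num.sqrt (2 ^+ d / d%:R) = 2 `^ (d%:R / 2) / Num.sqrt d%:R :> R.
  rewrite sqrtrM ?exprn_ge0// sqrtrV ?ltW//; congr (_ / _).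
  by rewrite -powR12_sqrt ?exprn_ge0// -powR_mulrn// -powRrM.
have pb : (block_dim l)%:R `^ (1 - delta / d%:R) =
    (block_dim l)%:R / (block_dim l)%:R `^ (delta / d%:R) :> R.
  by rewrite powRD ?(gt_eqF b0) ?implybT// powRr1 ?ltW// powRN.
rewrite sM s2 /tau td pb.
have q2 : Num.sqrt 2 != 0 :> R by rewrite gt_eqF// sqrtr_gt0.
have eA : expR A - 1 != 0.
  by rewrite gt_eqF// subr_gt0 expR_gt1 (lt_le_trans alpha_gt0).
have p0 : (block_dim l)%:R `^ (delta / d%:R) != 0 :> R by rewrite gt_eqF// powR_gt0.
have sd : Num.sqrt d%:R != 0 :> R by rewrite gt_eqF// sqrtr_gt0.
transitivity (K / Num.sqrt 2 * ((Num.sqrt 2 * Num.sqrt 2) * (2 `^ (d%:R / 2) / Num.sqrt d%:R) *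
   (A * (expR A + 1) / (expR A - 1)) * ((Num.sqrt n%:R)^-1 *
   ((Num.sqrt (block_dim l)%:R * Num.sqrt (block_dim l)%:R) /
     (block_dim l)%:R `^ (delta / d%:R) / block_privacy alpha delta l)))).
  move: q2 eA p0 sd (lt0r_neq0 n0) (lt0r_neq0 a0).
  move: (Num.sqrt 2) (2 `^ _) (Num.sqrt d%:R) (expR A) (Num.sqrt n%:R)
    (Num.sqrt (block_dim l)%:R) (_ `^ (delta / d%:R)) (block_privacy _ _ _).
  move=> u1 u2 u3 u4 u5 u6 u7 u8 q2 eA p0 sd n1 a1.
  by field; rewrite q2 eA p0 sd n1 a1.
by rewrite t2 sb.
Qed.

End noise.

(** * The threshold *)

Section threshold_facts.
Context {R : realType} (d n : nat) (A alpha delta : R).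
Hypotheses (d_gt0 : (0 < d)%N) (n_gt0 : (0 < n)%N) (A_ge1 : 1 <= A)
  (alpha_gt0 : 0 < alpha) (alpha_le : alpha <= A) (delta_gt0 : 0 < delta).
Local Notation N := (n%:R * alpha ^+ 2).
Hypothesis N_ge2 : 2 <= N.
Local Notation tau := (tau d A).
Local Notation Sigma_ := (Sigma_ d n alpha delta).
Local Notation S J := (total_weight d J delta).

Lemma N_gt0 : 0 < N. Proof. by apply: lt_le_trans N_ge2. Qed.

Lemma sqrtN : Num.sqrt N = Num.sqrt n%:R * alpha.
Proof. by rewrite sqrtrM// sqrtr_sqr ger0_norm// ltW. Qed.

Lemma lnN_ge : ln 2 <= ln N.
Proof. by rewrite ler_ln// posrE ?N_gt0. Qed.

Lemma ln2_gt0 : 0 < ln 2 :> R. Proof. by rewrite ln_gt0// ltr1n. Qed.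

Lemma tau_ge2 : 2 <= tau.
Proof.
have e1 : 0 < expR A - 1 by rewrite subr_gt0 expR_gt1 (lt_le_trans ltr01).
rewrite /Defs.tau -[leLHS]mulr1 -[X in _ <= _ * X]mulrA; apply: ler_pM => //.
  rewrite -[leLHS]mulr1 ler_wpM2l// -[leLHS]sqrtr1 ler_wsqrtr//.
  by rewrite ler_pdivlMr ?ltr0n// mul1r -natrX ler_nat ltnW// ltn_expl.
rewrite -[leLHS]mulr1 ler_pM//.
by rewrite ler_pdivlMr// mul1r; lra.
Qed.

Lemma Sigma_eq J : Sigma_ J = S J ^+ 2 / Num.sqrt N.
Proof.
rewrite /Defs.Sigma_ sqrtN; have S0 : S J != 0.
  by rewrite gt_eqF// total_weight_gt0.
have n0 : Num.sqrt n%:R != 0 :> R by rewrite gt_eqF// sqrtr_gt0 ltr0n.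
have a0 : alpha != 0 by rewrite gt_eqF.
transitivity (\sum_(l : lindex d J) S J / (Num.sqrt n%:R * alpha) * block_weight delta l).
  apply: eq_bigr => l _; have w0 := block_weight_gt0 delta l.
  have -> : (block_dim l)%:R `^ (1 - delta / d%:R) = block_weight delta l ^+ 2.
    rewrite /block_weight -powR_mulrn ?powR_ge0// -powRrM; congr powR; lra.
  rewrite /block_privacy; field.
  by rewrite n0 a0 S0 (gt_eqF w0).
rewrite -mulr_sumr -/(total_weight d J delta); field.
by rewrite n0 a0.
Qed.

Lemma total_weight_ge1 J : 1 <= S J.
Proof.
apply: le_trans (block_weight_le delta [ffun=> ord0]).
rewrite /block_weight (_ : block_dim _ = 1%N) ?powR1//.
by rewrite /block_dim big1// => m _; rewrite ffunE.
Qed.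

Lemma tauSigma_ge J : 2 / Num.sqrt N <= tau * Sigma_ J.
Proof.
rewrite Sigma_eq mulrA; apply: ler_wpM2r; first by rewrite invr_ge0 sqrtr_ge0.
rewrite -[leLHS]mulr1; apply: ler_pM => //; first exact: tau_ge2.
by rewrite exprn_ege1// total_weight_ge1.
Qed.

Lemma tauSigma_gt0 J : 0 < tau * Sigma_ J.
Proof.
apply: lt_le_trans (tauSigma_ge J).
by rewrite divr_gt0// sqrtr_gt0 N_gt0.
Qed.

(** The quantity under the square root in the threshold. *)
Definition exponent J : R :=
  d%:R * ln J%:R + 3 / 2 * ln N + ln (tau * Sigma_ J).

(** The threshold is the bound of [noise_bound] for errors of [2 sqrt y] standard
    amplitudes, with [y] the exponent. *)
Lemma thresholdE J :
  threshold d n A alpha delta J =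
  tau * Sigma_ J / Num.sqrt 2 * (2 * Num.sqrt (exponent J)).
Proof.
rewrite /threshold -/(exponent J).
have t2 : Num.sqrt 2 * Num.sqrt 2 = 2 :> R by rewrite -expr2 sqr_sqrtr.
have q2 : Num.sqrt 2 != 0 :> R by rewrite gt_eqF// sqrtr_gt0.
rewrite -[X in _ = _ * (X * _)]t2; field; exact: q2.
Qed.

Lemma ln_sqrtN : ln (Num.sqrt N) = ln N / 2.
Proof. by rewrite -powR12_sqrt ?(ltW N_gt0)// ln_powR; lra. Qed.

Lemma exponent_ge J : (0 < J)%N -> ln 2 <= exponent J.
Proof.
move=> J0; have l0 := lnN_ge; have l2 := ln2_gt0.
have h1 : ln 2 - ln N / 2 <= ln (tau * Sigma_ J).
  rewrite -ln_sqrtN -ln_div ?posrE ?sqrtr_gt0 ?N_gt0//.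
  rewrite ler_ln ?posrE ?tauSigma_ge ?tauSigma_gt0//.
  by rewrite divr_gt0// sqrtr_gt0 N_gt0.
have h2 : 0 <= d%:R * ln J%:R :> R by rewrite mulr_ge0// ln_ge0// ler1n.
by rewrite /exponent; lra.
Qed.

Lemma threshold_ge0 J : 0 <= threshold d n A alpha delta J.
Proof.
rewrite thresholdE; apply: mulr_ge0; last by rewrite mulr_ge0 ?sqrtr_ge0.
by apply: divr_ge0; [exact: ltW (tauSigma_gt0 J)|exact: sqrtr_ge0].
Qed.

(** The exponent is designed so that its exponential beats the number of
    coordinates and the scale of the noise, with a factor [N^(3/2)] to spare. *)
Lemma expR_exponent J : (0 < J)%N ->
  expR (exponent J) = J%:R ^+ d * (N * Num.sqrt N) * (tau * Sigma_ J).
Proof.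
move=> J0; have N0 := N_gt0.
rewrite /exponent 2!expRD lnK ?posrE ?tauSigma_gt0//; congr (_ * _ * _).
  by rewrite mulrC expRM_natr lnK// posrE ltr0n.
rewrite (_ : 3 / 2 * ln N = ln N + ln (Num.sqrt N)); last by rewrite ln_sqrtN; lra.
by rewrite expRD !lnK ?posrE ?sqrtr_gt0.
Qed.

End threshold_facts.

(** * The total weight *)

Section rates.
Context {R : realType}.

Definition geo (k : R) L : R := \sum_(i < L.+1) (2 `^ k) ^+ i.

(** Block dimensions are products over the coordinates, and so are the weights. *)
Lemma total_weightE (d L J : nat) (delta : R) : J = (2 ^ L.+1 - 1)%N ->
  total_weight d J delta = geo ((1 - delta / d%:R) / 2) L ^+ d.
Proof.
move=> JE; rewrite /total_weight /geo.
have -> : \sum_(i < L.+1) (2 `^ ((1 - delta / d%:R) / 2)) ^+ i =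
    \sum_(i < (level J).+1) (2 `^ ((1 - delta / d%:R) / 2)) ^+ i :> R.
  by rewrite (level_eq JE).
rewrite -[d in RHS]card_ord -prodr_const bigA_distr_bigA /=.
apply: eq_bigr => l _; rewrite /block_weight /block_dim natr_prod powR_prod//.
apply: eq_bigr => m _; rewrite natrX -[2 ^+ _]powR_mulrn; last exact: ler0n.
rewrite -[RHS]powR_mulrn; last exact: powR_ge0.
by rewrite -[LHS]powRrM -[RHS]powRrM; congr powR; rewrite card_ord mulrC.
Qed.

Lemma geo_ge1 (k : R) L : 1 <= geo k L.
Proof.
rewrite /geo big_ord_recl expr0 lerDl sumr_ge0//.
Qed.

Lemma geo_le (k : R) L : k <= 1 -> geo k L <= (2 ^ L.+1 - 1)%N%:R.
Proof.
move=> k1; rewrite subn1 predn_exp mul1n natr_sum; apply: ler_sum => i _.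
rewrite natrX; apply: lerXn2r; rewrite ?nnegrE ?powR_ge0//.
by rewrite -[leRHS]powRr1// ler_powR// ler1n.
Qed.

Lemma powR2_gt1 (k : R) : 0 < k -> 1 < 2 `^ k.
Proof.
move=> k0; have h : (1 : R) `^ k < 2 `^ k.
  by apply: gt0_ltr_powR; rewrite ?nnegrE// ltr1n.
by rewrite powR1 in h.
Qed.

Lemma geo_neg (k : R) L : k < 0 -> geo k L <= (1 - 2 `^ k)^-1.
Proof.
move=> k0; have q1 : 2 `^ k < 1.
  by rewrite -[k]opprK powRN invf_lt1 ?powR_gt0// powR2_gt1// oppr_gt0.
have e := subrX1 (2 `^ k) L.+1; rewrite -/(geo k L) in e.
rewrite -[leRHS]mul1r ler_pdivlMr ?subr_gt0//.
have : 0 <= (2 `^ k) ^+ L.+1 by rewrite exprn_ge0// powR_ge0.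
by move: e; lra.
Qed.

Lemma geo_pos (k : R) L : 0 < k -> geo k L <= (2 `^ k) ^+ L.+1 / (2 `^ k - 1).
Proof.
move=> k0; have q1 := powR2_gt1 k0.
have e := subrX1 (2 `^ k) L.+1; rewrite -/(geo k L) in e.
by rewrite ler_pdivlMr ?subr_gt0// mulrC -e; lra.
Qed.

Lemma geo_zero L : geo 0 L = L.+1%:R.
Proof.
rewrite /geo (eq_bigr (fun=> 1)) => [|i _]; last by rewrite powRr0 expr1n.
by rewrite sumr_const card_ord.
Qed.

End rates.

(** * The noise above the threshold *)

Section noise_expectation.
Context {R : realType} (d n : nat) (A alpha delta : R).
Hypotheses (d_gt0 : (0 < d)%N) (n_gt0 : (0 < n)%N) (A_ge1 : 1 <= A)
  (alpha_gt0 : 0 < alpha) (alpha_le : alpha <= A) (delta_gt0 : 0 < delta).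
Local Notation N := (n%:R * alpha ^+ 2).
Hypothesis N_ge2 : 2 <= N.
Local Notation D := (@cube R d).
Local Notation models := (models n alpha).
Context disp (Omega : measurableType disp) (P : probability Omega R).
Variables (f : vec R d -> R) (X : 'I_n -> {mfun Omega >-> vec R d})
  (Z : forall J, 'I_n -> mindex d J -> {mfun Omega >-> R}).
Hypotheses (sf : sqint f) (f_ge0 : forall x, D x -> 0 <= f x)
  (f_mass : (\int[lebesgue_tuple d]_(x in D) (f x)%:E = 1)%E).
Hypothesis law : privatized_sample alpha delta P f X Z.
Local Notation tS J := (tau d A * Sigma_ d n alpha delta J).
Local Notation V J := (threshold d n A alpha delta J).

Let r J := Num.sqrt (exponent d n A alpha delta J).
Let centred J (j : mindex d J) w := \sum_(i < n) (Z i j w - theta f (mval j)).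
Let scale J (j : mindex d J) :=
  r J / (Num.sqrt n%:R * block_amplitude alpha delta (block_of j)).

(** An exponential majorant of the part of the noise above the threshold. *)
Definition tail_term J (e : bool) (j : mindex d J) w : R :=
  expR (with_sign (scale j) e * centred j w) * expR (- (2 * exponent d n A alpha delta J)).
Definition excess J w : R :=
  tS J / Num.sqrt 2 / r J * \sum_(j : mindex d J) \sum_e tail_term e j w.

Let models_gt0 J : J \in models -> (0 < J)%N.
Proof.
move=> /modelsP[L ->]; have : (2 <= 2 ^ L.+1)%N by rewrite expnS leq_pmulr// expn_gt0.
lia.
Qed.

Let r_gt0 J : J \in models -> 0 < r J.
Proof.
move=> /models_gt0 J0; rewrite sqrtr_gt0.
by apply: lt_le_trans (exponent_ge delta d_gt0 n_gt0 A_ge1 alpha_gt0 N_ge2 J0); exact: ln2_gt0.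
Qed.

Let rr J : J \in models -> r J * r J = exponent d n A alpha delta J.
Proof.
move=> /r_gt0; rewrite sqrtr_gt0 => e0; rewrite -expr2 sqr_sqrtr//; exact: ltW.
Qed.

Let sn_gt0 : 0 < Num.sqrt n%:R :> R. Proof. by rewrite sqrtr_gt0 ltr0n. Qed.

Let amp_gt0 J (j : mindex d J) : J \in models ->
  0 < block_amplitude alpha delta (block_of j).
Proof. by move=> /modelsP[L JL]; exact: (block_amplitude_gt0 JL delta alpha_gt0). Qed.

Lemma excess_ge0 J w : J \in models -> 0 <= excess J w.
Proof.
move=> JM; have tS0 := tauSigma_gt0 delta d_gt0 n_gt0 A_ge1 alpha_gt0 N_ge2 J.
rewrite /excess mulr_ge0//.
  by rewrite !divr_ge0 ?sqrtr_ge0 ?(ltW tS0)// ltW// r_gt0.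
by apply: sumr_ge0 => j _; apply: sumr_ge0 => e _; rewrite mulr_ge0 ?expR_ge0.
Qed.

Lemma measurable_excess J : measurable_fun setT (excess J).
Proof.
apply: measurable_funM => //; apply: measurable_sum => j; apply: measurable_sum => e.
apply: measurable_funM => //; apply: measurableT_comp => //.
apply: measurable_funM => //; apply: measurable_sum => i; exact: measurable_funB.
Qed.

(** Since [1 + x <= e^x], the tail terms of a coordinate dominate its noise beyond
    twice the exponent, in the units of [scale]; [noise_bound] transfers this to the
    pairing. *)
Lemma noise_pointwise J w (g : vec R d -> R) : J \in models ->
  sobolev d delta 1 g ->
  `|\sum_(j : mindex d J) (theta_hat (fun J i j => Z i j w : R) j - theta f (mval j)) *
      theta g (mval j)| <= V J + excess J w.
Proof.
move=> JM sg; have r0 := r_gt0 JM; have [L JL] := modelsP JM.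
set M := \sum_(j : mindex d J) \sum_e tail_term e j w.
have M0 : 0 <= M.
  by apply: sumr_ge0 => j _; apply: sumr_ge0 => e _; rewrite mulr_ge0 ?expR_ge0.
have K0 : 0 <= 2 * r J + M / r J 
  by apply: addr_ge0; [rewrite mulr_ge0// ltW|rewrite divr_ge0// ltW].
suff eK : forall (l : lindex d J) j, j \in block l ->
    `|theta_hat (fun J i j => Z i j w : R) j - theta f (mval j)| <=
    (2 * r J + M / r J) * (block_amplitude alpha delta l / Num.sqrt n%:R).
  apply: (le_trans (noise_bound JL d_gt0 n_gt0 alpha_gt0 alpha_le delta_gt0 sg K0 eK)).
  rewrite thresholdE /excess -/M -/(r J) le_eqVlt; apply/orP; left; apply/eqP.
  by field; rewrite gt_eqF//= gt_eqF// sqrtr_gt0.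
move=> l j jl; have lE : l = block_of j.
  by apply/esym/eqP; rewrite -(block_ofP JL).
have b0 := amp_gt0 j JM; rewrite lE; set b := block_amplitude _ _ _ in b0 *.
have n0 : n%:R != 0 :> R by rewrite pnatr_eq0 -lt0n.
have -> : theta_hat (fun J i j => Z i j w : R) j - theta f (mval j) = n%:R^-1 * centred j w.
  rewrite /theta_hat /centred sumrB sumr_const card_ord -[theta f (mval j) *+ n]mulr_natl mulrBr mulrA.
  by rewrite mulVf// mul1r.
have sn : Num.sqrt n%:R * Num.sqrt n%:R = n%:R :> R by rewrite -expr2 sqr_sqrtr.
have key e : with_sign 1 e * centred j w <= (2 * r J + M / r J) * (b * Num.sqrt n%:R).
  have h : with_sign (scale j) e * centred j w - 2 * exponent d n A alpha delta J <= M.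
    apply: (@le_trans _ _ (tail_term e j w)).
      rewrite /tail_term -expRD; apply: le_trans (expR_ge1Dx _); lra.
    rewrite /M (bigD1 j)//= (bigD1 e)//=.
    rewrite -addrA lerDl addr_ge0//.
      by apply: sumr_ge0 => e' _; rewrite mulr_ge0 ?expR_ge0.
    by apply: sumr_ge0 => i _; apply: sumr_ge0 => e' _; rewrite mulr_ge0 ?expR_ge0.
  have -> : with_sign 1 e * centred j w =
      (with_sign (scale j) e * centred j w) * (b * Num.sqrt n%:R) / r J.
    have -> : with_sign (scale j) e = scale j * with_sign 1 e.
      by case: e {h} => /=; rewrite ?mulr1 ?mulrN1.
    rewrite /scale -/b; field.
    by rewrite (gt_eqF r0) (gt_eqF b0) (gt_eqF sn_gt0).
  have bn0 : 0 < b * Num.sqrt n%:R by exact: mulr_gt0.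
  rewrite -mulrA mulrCA -[leRHS]mulrC ler_pM2l//.
  rewrite ler_pdivrMr// mulrDl divfK ?(lt0r_neq0 r0)// -mulrA rr//; lra.
rewrite normrM (ger0_norm (_ : 0 <= n%:R^-1)) ?invr_ge0// mulrC ler_pdivrMr ?ltr0n//.
rewrite -[X in _ * X]sn; have -> : (2 * r J + M / r J) * (b / Num.sqrt n%:R) *
  (Num.sqrt n%:R * Num.sqrt n%:R) = (2 * r J + M / r J) * (b * Num.sqrt n%:R).
  by field; rewrite (gt_eqF r0) (gt_eqF sn_gt0).
have := key true; have := key false; rewrite /= mul1r mulN1r => h1 h2.
by rewrite ler_norml h2 andbT lerNl.
Qed.

(** The sub-Gaussian moment costs [e^y], and the shift gains [e^(-2 y)]. *)
Lemma integral_tail_term J e (j : mindex d J) : J \in models ->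
  (\int[P]_w (tail_term e j w)%:E <= (expR (- exponent d n A alpha delta J))%:E)%E.
Proof.
move=> JM; have [L JL] := modelsP JM; set y := exponent _ _ _ _ _ _.
have b0 := amp_gt0 j JM.
have mE : measurable_fun setT (fun w => expR (with_sign (scale j) e * centred j w)).
  apply: measurableT_comp => //; apply: measurable_funM => //.
  by apply: measurable_sum => i; exact: measurable_funB.
rewrite /tail_term -/y; under eq_integral do rewrite EFinM muleC.
rewrite ge0_integralZl_EFin//; last exact/measurable_EFinP.
have jl : j \in block (block_of j) by rewrite (block_ofP JL).
have := exp_moment alpha_gt0 sf f_ge0 f_mass law JM (with_sign (scale j) e) jl.
move=> /(lee_wpmul2l _) h; apply: le_trans (h _ _) _; first by rewrite lee_fin expR_ge0.
rewrite -EFinM -expRD lee_fin ler_expR.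
have -> : (with_sign (scale j) e * block_amplitude alpha delta (block_of j)) ^+ 2 =
    (scale j * block_amplitude alpha delta (block_of j)) ^+ 2.
  by case: e {h mE}; rewrite //= mulNr sqrrN.
have -> : scale j * block_amplitude alpha delta (block_of j) = r J / Num.sqrt n%:R.
  rewrite /scale; field.
  by rewrite (gt_eqF b0) (gt_eqF sn_gt0).
have sn : Num.sqrt n%:R ^+ 2 = n%:R :> R by rewrite sqr_sqrtr.
have nn0 : n%:R != 0 :> R by rewrite pnatr_eq0 -lt0n.
by rewrite expr_div_n sn (mulrC n%:R) divfK// expr2 rr// -/y; lra.
Qed.

(** By [expR_exponent], summing over the coordinates leaves [1 / N^(3/2)]. *)
Lemma integral_excess J : J \in models ->
  (\int[P]_w (excess J w)%:E <=
   (2 / Num.sqrt 2 / Num.sqrt (ln 2) / (N * Num.sqrt N))%:E)%E.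
Proof.
move=> JM; have r0 := r_gt0 JM; have J0 := models_gt0 JM.
have tS0 := tauSigma_gt0 delta d_gt0 n_gt0 A_ge1 alpha_gt0 N_ge2 J.
have q0 : 0 < Num.sqrt 2 :> R by rewrite sqrtr_gt0.
have mt e (j : mindex d J) : measurable_fun setT (tail_term e j).
  apply: measurable_funM => //; apply: measurableT_comp => //.
  apply: measurable_funM => //; apply: measurable_sum => i; exact: measurable_funB.
have c0 : 0 <= tS J / Num.sqrt 2 / r J by rewrite !divr_ge0 ?ltW.
rewrite /excess; under eq_integral do rewrite EFinM -sumEFin.
rewrite ge0_integralZl_EFin//; last 2 first.
- move=> w _; apply: sume_ge0 => j _; rewrite lee_fin sumr_ge0// => e _.
  by rewrite mulr_ge0 ?expR_ge0.
- apply: emeasurable_sum => j; apply/measurable_EFinP; exact: measurable_sum.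
rewrite ge0_integral_sum//; last 2 first.
- by move=> j; apply/measurable_EFinP; exact: measurable_sum.
- move=> j w _; rewrite lee_fin sumr_ge0// => e _; by rewrite mulr_ge0 ?expR_ge0.
set y := exponent d n A alpha delta J.
apply: (@le_trans _ _ ((tS J / Num.sqrt 2 / r J)%:E *
    \sum_(j : mindex d J) (2 * expR (- y))%:E)%E).
  apply: lee_wpmul2l; first by rewrite lee_fin.
  apply: lee_sum => j _; under eq_integral do rewrite -sumEFin.
  rewrite ge0_integral_sum//; last 2 first.
  - by move=> e; apply/measurable_EFinP.
  - by move=> e w _; rewrite lee_fin mulr_ge0 ?expR_ge0.
  rewrite big_bool /= mulr_natl mulr2n EFinD.
  by apply: leeD; exact: integral_tail_term.
rewrite sumEFin -EFinM lee_fin sumr_const card_ffun !card_ord.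
rewrite -[(2 * _) *+ _]mulr_natl natrX.
have yE := expR_exponent delta d_gt0 n_gt0 A_ge1 alpha_gt0 N_ge2 J0.
rewrite -/y in yE; rewrite expRN yE.
have Jd : J%:R ^+ d != 0 :> R by rewrite expf_neq0// pnatr_eq0 -lt0n.
have N0 := N_gt0 N_ge2; have sN0 : 0 < Num.sqrt N by rewrite sqrtr_gt0.
have -> : tS J / Num.sqrt 2 / r J * (J%:R ^+ d * (2 * (J%:R ^+ d * (N * Num.sqrt N) * tS J)^-1)) =
    2 / Num.sqrt 2 / (N * Num.sqrt N) * (r J)^-1.
  move: (lt0r_neq0 tS0) (lt0r_neq0 q0) (lt0r_neq0 r0) Jd (lt0r_neq0 N0) (lt0r_neq0 sN0).
  move: (tS J) (Num.sqrt 2) (r J) (J%:R ^+ d) (Num.sqrt N) => u1 u2 u3 u4 u5.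
  move: N => u6 h1 h2 h3 h4 h5 h6; field.
  by rewrite h1 h2 h3 h4 h5 h6.
have -> : 2 / Num.sqrt 2 / Num.sqrt (ln 2) / (N * Num.sqrt N) =
    2 / Num.sqrt 2 / (N * Num.sqrt N) * (Num.sqrt (ln 2))^-1 :> R by ring.
have NN0 : 0 < N * Num.sqrt N := mulr_gt0 N0 sN0.
apply: ler_wpM2l; first by apply: divr_ge0; [rewrite divr_ge0// ltW|exact: ltW].
rewrite lef_pV2 ?posrE ?sqrtr_gt0 ?ln2_gt0//; last by rewrite -sqrtr_gt0.
by apply: ler_wsqrtr; exact: exponent_ge.
Qed.

End noise_expectation.

(** * The oracle inequality *)

(** The adversarial loss is a supremum over an uncountable class, so that its
    measurability in the sample is not granted: only the majorant is measurable. *)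
Lemma integral_le_majorant d (T : measurableType d) (R : realType)
    (m : {measure set T -> \bar R}) (f g : T -> \bar R) :
  (forall x, 0 <= g x)%E -> (forall x, f x <= g x)%E ->
  (\int[m]_x f x <= \int[m]_x g x)%E.
Proof.
move=> g0 fg; rewrite [leLHS]integralE; apply: (@le_trans _ _ (\int[m]_x f^\+ x)%E).
  rewrite -[leRHS]sube0; apply: leeB => //; apply: integral_ge0 => x _.
  exact: funeneg_ge0.
rewrite !ge0_integralTE//; apply: ge_ereal_sup => _ /= [h hf <-].
apply: ereal_sup_ubound; exists h => //= x; apply: le_trans (hf x) _.
by rewrite funeposE ge_max fg g0.
Qed.

Section adversarial.
Context {R : realType} (d : nat) (delta : R).
Local Notation D := (@cube R d).
Local Notation W := (sobolev d delta 1).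
Local Notation loss := (adversarial_loss W).
Implicit Types (f g h : vec R d -> R).

Lemma sobolev_sqint b r g : sobolev d b r g -> sqint g.
Proof. by move=> [h _]; exact: L2cube_sqint. Qed.

Lemma sobolev_opp b r g : sobolev d b r g -> sobolev d b r (fun x => - g x).
Proof.
move=> Wg; have sg := sobolev_sqint Wg; have [L2g gr] := Wg; split.
  rewrite /L2cube /= (_ : patch _ _ _ = - patch (fun=> 0) D g).
    exact: Lfun_oppr_closed L2g.
  apply/funext => x; rewrite -[RHS]/(- patch (fun=> 0) D g x) !patchE.
  by case: ifP => // _; rewrite oppr0.
suff -> : (fun j : {ffun 'I_d -> nat} =>
    ((\sum_(m < d) (j m)%:R `^ (2 * b)) * theta (fun x => - g x) j ^+ 2)%:E) =
    (fun j => ((\sum_(m < d) (j m)%:R `^ (2 * b)) * theta g j ^+ 2)%:E) by [].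
apply/funext => j; congr (_ * _)%:E.
have -> : theta (fun x => - g x) j = - theta g j.
  rewrite /theta -!/(ip _ _) -mulN1r -ipZl//; last exact: sqint_fourier.
  by congr ip; apply/funext => x; rewrite mulN1r.
by rewrite sqrrN.
Qed.

Lemma pairingE f1 f2 g : sqint f1 -> sqint f2 -> sqint g ->
  (\int[lebesgue_tuple d]_(x in D) ((f1 x - f2 x) * g x)%:E = (ip f1 g - ip f2 g)%:E)%E.
Proof.
move=> s1 s2 sg; rewrite -ipBl// /ip /Rintegral fineK//.
apply: (integrable_fin_num (@measurable_cube R d)); apply: sqintM => //.
exact: sqintB.
Qed.

Lemma loss_le f1 f2 (c : \bar R) : sqint f1 -> sqint f2 ->
  (forall g, W g -> ((ip f1 g - ip f2 g)%:E <= c)%E) -> (loss f1 f2 <= c)%E.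
Proof.
move=> s1 s2 h; apply: ge_ereal_sup => _ [g Wg <-].
by rewrite pairingE//; [exact: h|exact: sobolev_sqint Wg].
Qed.

Lemma loss_ge f1 f2 g : sqint f1 -> sqint f2 -> W g ->
  ((ip f1 g - ip f2 g)%:E <= loss f1 f2)%E.
Proof.
move=> s1 s2 Wg; apply: ereal_sup_ubound; exists g => //.
by rewrite pairingE//; exact: sobolev_sqint Wg.
Qed.

End adversarial.

Section oracle.
Context {R : realType} (d n : nat) (A alpha delta : R).
Local Notation W := (sobolev d delta 1).
Local Notation loss := (adversarial_loss W).
Local Notation models := (models n alpha).
Local Notation V J := (threshold d n A alpha delta J).
Variables (f : vec R d -> R) (Z : @views R d n) (ex b : nat -> R) (Jhat : nat).
Hypothesis sf : sqint f.
Hypothesis noise : forall J g, J \in models -> W g ->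
  `|\sum_(j : mindex d J) (theta_hat Z j - theta f (mval j)) * theta g (mval j)| <=
  V J + ex J.
Hypothesis bias : forall J g, J \in models -> W g -> `|residue J f g| <= b J.
Hypothesis b_ge0 : forall J, 0 <= b J.
Hypothesis b_mono : forall J J', (J <= J')%N -> b J' <= b J.
Hypothesis ex_ge0 : forall J, J \in models -> 0 <= ex J.
Hypothesis V_ge0 : forall J, 0 <= V J.
Hypothesis selected : is_selected A alpha delta Z Jhat.

Let E := \sum_(J <- models) ex J.

Let ex_le J : J \in models -> ex J <= E.
Proof.
move=> JM; rewrite /E (big_rem J)//= lerDl big_seq; apply: sumr_ge0 => J' J'M.
by apply: ex_ge0; exact: mem_rem J'M.
Qed.

Let E_ge0 : 0 <= E.
Proof. by rewrite /E big_seq; apply: sumr_ge0 => J; exact: ex_ge0. Qed.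

Let sqint_est J : sqint (estimator Z J).
Proof. by apply: sqint_sum => j; apply: sqintZ; exact: sqint_fourier. Qed.

Let est_ip J g : W g -> ip (estimator Z J) g =
  \sum_(j : mindex d J) theta_hat Z j * theta g (mval j).
Proof. by move=> /sobolev_sqint; exact: theta_span. Qed.

Let est_error J g : J \in models -> W g ->
  `|ip (estimator Z J) g - ip f g| <= V J + ex J + b J.
Proof.
move=> JM Wg; have h1 := noise JM Wg; have h2 := bias JM Wg.
apply: le_trans (lerD h1 h2); apply: le_trans (ler_normB _ _).
rewrite le_eqVlt; apply/orP; left; apply/eqP; congr `|_|.
rewrite est_ip// /residue.
under [in RHS]eq_bigr do rewrite mulrBl.
by rewrite sumrB; ring.
Qed.

Let pair_error J J' g : J \in models -> J' \in models -> (J <= J')%N -> W g ->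
  ip (estimator Z J') g - ip (estimator Z J) g <=
  V J' + ex J' + (V J + ex J) + 2 * b J.
Proof.
move=> JM JM' JJ Wg; have := est_error JM Wg; have := est_error JM' Wg.
by rewrite !ler_norml => /andP[_ h1] /andP[h2 _]; have := b_mono JJ; lra.
Qed.

Let A_hat_ge0 J : (0 <= A_hat A alpha delta Z J)%E.
Proof. exact: bigmax_ge_id. Qed.

(** Twice the threshold absorbs the noise of the finer estimator, so what remains
    in the bias proxy is the noise and the bias at level [J]. *)
Let A_hat_le J : J \in models ->
  (A_hat A alpha delta Z J <= (V J + 2 * E + 2 * b J)%:E)%E.
Proof.
move=> JM; have M0 : 0 <= V J + 2 * E + 2 * b J.
  by have := V_ge0 J; have := b_ge0 J; have := E_ge0; lra.
rewrite /A_hat big_seq; apply: bigmax_le => [|J' J'M]; first by rewrite lee_fin.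
rewrite ge_max; apply/andP; split; first by rewrite lee_fin.
rewrite leeBlDr// -EFinD; apply: loss_le => // g Wg.
rewrite lee_fin; have [JJ|JJ] := leqP J' J.
  rewrite subrr; have := V_ge0 J'; lra.
have := pair_error JM J'M (ltnW JJ) Wg.
have := ex_le JM; have := ex_le J'M; have := V_ge0 J'; lra.
Qed.

Let loss_le_A_hat J J' : J' \in models ->
  (loss (estimator Z J') (estimator Z (minn J' J)) <=
   A_hat A alpha delta Z J + (2 * V J')%:E)%E.
Proof.
move=> J'M; rewrite -leeBlDr//.
apply: (@le_trans _ _ (maxe 0 (loss (estimator Z J') (estimator Z (minn J' J)) -
    (2 * V J')%:E))%E); first by rewrite le_max lexx orbT.
rewrite /A_hat; elim: models J'M => [//|J1 s ih].
rewrite inE big_cons le_max => /orP[/eqP <-|/ih ->]; first by rewrite lexx.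
by rewrite orbT.
Qed.

(** The selected and the competing estimators are both compared with the one at
    the smaller of their levels; each comparison is controlled by the criterion of
    the other level, and the criterion of the selected level is the smaller
    one. *)
Lemma oracle_inequality J : J \in models ->
  (loss (estimator Z Jhat) f <= (7 * V J + 5 * E + 5 * b J)%:E)%E.
Proof.
move=> JM; have [HM crit] := selected; have {crit} := crit _ JM.
have := A_hat_le JM; have := loss_le_A_hat J HM; have := loss_le_A_hat Jhat JM.
rewrite /Crit; have := A_hat_ge0 J; have := A_hat_ge0 Jhat.
case: (A_hat _ _ _ Z Jhat) => [a'| |]//; case: (A_hat _ _ _ Z J) => [a| |]//.
rewrite -!EFinD !lee_fin => a'0 a0 l1 l2 aV cr.
apply: loss_le => // g Wg; rewrite lee_fin.
have h1 : ip (estimator Z Jhat) g - ip (estimator Z (minn Jhat J)) g <= a + 2 * V Jhat.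
  by rewrite -lee_fin; apply: le_trans l2; exact: loss_ge.
have h2 : ip (estimator Z (minn Jhat J)) g - ip (estimator Z J) g <= a' + 2 * V J.
  rewrite -lee_fin; apply: le_trans l1; rewrite minnC.
  have := loss_ge (sqint_est J) (sqint_est (minn J Jhat)) (sobolev_opp Wg).
  have opp h : sqint h -> ip h (fun x => - g x) = - ip h g.
    move=> sh; rewrite ipC -mulN1r (ipC h) -ipZl//; last exact: sobolev_sqint Wg.
    by congr ip; apply/funext => x; rewrite mulN1r.
  rewrite !opp// opprK addrC; exact.
have := est_error JM Wg; rewrite ler_norml => /andP[_ h3].
by have := ex_le JM; have := b_ge0 J; lra.
Qed.

End oracle.

(** * The risk bound *)

Section risk.
Context {R : realType} (d n : nat) (A alpha delta beta r : R).
Hypotheses (d_gt0 : (0 < d)%N) (n_gt0 : (0 < n)%N) (A_ge1 : 1 <= A)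
  (alpha_gt0 : 0 < alpha) (alpha_le : alpha <= A) (delta_gt0 : 0 < delta)
  (beta_gt0 : 0 < beta) (r_gt0 : 0 < r).
Local Notation N := (n%:R * alpha ^+ 2).
Hypothesis N_ge2 : 2 <= N.
Local Notation models := (models n alpha).

Definition depth : nat := Num.truncn (ln (1 + N) / ln 2).

Lemma modelsE J : J \in models <-> exists2 L, (L < depth)%N & J = (2 ^ L.+1 - 1)%N.
Proof.
split => [/mapP[L + ->]|[L Lm ->]]; first by rewrite mem_iota => Lm; exists L.
by apply/mapP; exists L; rewrite ?mem_iota.
Qed.

Let ln1N_ge0 : 0 <= ln (1 + N) / ln 2.
Proof. by rewrite divr_ge0 ?(ltW (ln2_gt0 _))// ln_ge0//; have := N_ge2; lra. Qed.

Let N1_gt0 : 0 < 1 + N. Proof. by have := N_ge2; lra. Qed.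

Lemma pow2_depth_le : (2 ^ depth)%N%:R <= 1 + N.
Proof.
rewrite natrX -ler_ln ?posrE ?exprn_gt0// lnXn// -[ln 2 *+ _]mulr_natl.
by rewrite -ler_pdivlMr ?ln2_gt0// truncn_le.
Qed.

Lemma pow2_depth_gt : 1 + N < (2 ^ depth.+1)%N%:R.
Proof.
rewrite natrX -ltr_ln ?posrE ?exprn_gt0// lnXn// -[ln 2 *+ _]mulr_natl.
by rewrite -ltr_pdivrMr ?ln2_gt0// truncnS_gt.
Qed.

Lemma depth_le : depth%:R <= N.
Proof.
have := pow2_depth_le; have := ltn_expl depth (isT : 1 < 2)%N.
rewrite -(ler_nat R) -[depth.+1%:R]natr1; move: (_ ^ _)%:R => x; lra.
Qed.

Lemma depth_gt0 : (0 < depth)%N.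
Proof.
rewrite lt0n; apply/negP => /eqP m0; have := pow2_depth_gt; rewrite m0 expn1.
by have := N_ge2; lra.
Qed.

Lemma models_le J : J \in models -> J%:R <= N.
Proof.
move=> /modelsE[L Lm ->]; have := pow2_depth_le.
have : (2 ^ L.+1)%N%:R <= (2 ^ depth)%N%:R :> R by rewrite ler_nat leq_exp2l.
rewrite natrB ?expn_gt0//; move: (_ ^ _)%:R (_ ^ _)%:R => x y; lra.
Qed.

Context disp (Omega : measurableType disp) (P : probability Omega R).
Variables (f : vec R d -> R) (X : 'I_n -> {mfun Omega >-> vec R d})
  (Z : forall J, 'I_n -> mindex d J -> {mfun Omega >-> R})
  (Jhat : {mfun Omega >-> nat}).
Hypotheses (sob : sobolev d beta r f) (dens : density d f).
Hypothesis law : privatized_sample alpha delta P f X Z.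
Hypothesis selected :
  forall w, is_selected A alpha delta (fun J i j => Z i j w : R) (Jhat w).
Local Notation V J := (threshold d n A alpha delta J).

Definition noise_constant : R := 2 / Num.sqrt 2 / Num.sqrt (ln 2).

(** The excesses of all the levels of the collection enter the oracle inequality.
    There are at most [N] levels, each contributing [1 / N^(3/2)]. *)
Lemma risk_bound J : J \in models ->
  (\int[P]_w adversarial_loss (sobolev d delta 1)
     (estimator (fun J i j => Z i j w) (Jhat w)) f <=
   (7 * V J + 5 * (noise_constant / Num.sqrt N) +
    5 * (r * J.+1%:R `^ (- (beta + delta))))%:E)%E.
Proof.
move=> JM; have sf : sqint f := sobolev_sqint sob; have [_ f0 f1] := dens.
have s0 : 0 <= beta + delta by rewrite addr_ge0// ltW.
pose b J := r * J.+1%:R `^ (- (beta + delta)).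
have b0 K : 0 <= b K by rewrite mulr_ge0 ?powR_ge0// ltW.
pose ex K w := if K \in models then excess A alpha delta f Z K w else 0.
have ex0 K w : 0 <= ex K w.
  by rewrite /ex; case: ifP => // KM; apply: excess_ge0.
pose U w := 7 * V J + 5 * (\sum_(K <- models) ex K w) + 5 * b J.
have V0 K : 0 <= V K by exact: threshold_ge0.
have E0 w : 0 <= \sum_(K <- models) ex K w.
  by apply: sumr_ge0 => K _; exact: ex0.
have c0 : 0 <= 7 * V J + 5 * b J by have := V0 J; have := b0 J; lra.
apply: (@le_trans _ _ (\int[P]_w (U w)%:E)%E).
  apply: integral_le_majorant => w.
    by rewrite lee_fin; have := E0 w; rewrite /U; lra.
  apply: (oracle_inequality (ex := fun K => ex K w) (b := b) sf) => //.
  - by move=> K g KM Wg; rewrite /ex KM; apply: noise_pointwise.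
  - by move=> K g KM Wg; apply: bias => //; exact: ltW.
  - move=> K K' KK; rewrite /b ler_pM2l// !powRN lef_pV2 ?posrE ?powR_gt0//.
    by rewrite ge0_ler_powR ?nnegrE// ler_nat.
have mex K : measurable_fun setT (ex K).
  by rewrite /ex; case: (K \in models) => //; exact: measurable_excess.
rewrite (_ : (fun w => (U w)%:E) = (fun w => (7 * V J + 5 * b J)%:E +
    5%:E * \sum_(K <- models) (ex K w)%:E)%E); last first.
  by apply/funext => w; rewrite sumEFin -EFinM -EFinD; congr EFin; rewrite /U; ring.
have mS : measurable_fun setT (fun w => \sum_(K <- models) (ex K w)%:E)%E.
  by apply: emeasurable_sum => K; apply/measurable_EFinP.
have S0 w : (0 <= \sum_(K <- models) (ex K w)%:E)%E by rewrite sumEFin lee_fin.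
rewrite ge0_integralD//; last 2 first.
- by move=> w _; rewrite mule_ge0// lee_fin.
- by apply: emeasurable_funM.
rewrite integral_cst//; have -> : forall c : \bar R, (c * P setT = c)%E.
  by move=> c; rewrite probability_setT mule1.
rewrite ge0_integralZl_EFin//.
rewrite -/(b J) addrAC.
rewrite [leRHS]EFinD leeD2l// [leRHS]EFinM lee_wpmul2l ?lee_fin//.
rewrite ge0_integral_sum//; last 2 first.
- by move=> K; apply/measurable_EFinP.
- by move=> K w _; rewrite lee_fin.
have N0 := N_gt0 N_ge2; have sN0 : 0 < Num.sqrt N by rewrite sqrtr_gt0.
apply: (@le_trans _ _ (\sum_(K <- models) (noise_constant / (N * Num.sqrt N))%:E)%E).
  rewrite big_seq [leRHS]big_seq; apply: lee_sum => K KM.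
  by rewrite /ex KM; apply: (integral_excess d_gt0 n_gt0 A_ge1 alpha_gt0 alpha_le delta_gt0 N_ge2 sf f0 f1 law).
rewrite sumEFin lee_fin big_const_seq iter_addr_0 count_predT size_map size_iota -/depth.
rewrite -[_ *+ depth]mulr_natl.
have c1 : 0 <= noise_constant / (N * Num.sqrt N).
  by rewrite /noise_constant !divr_ge0 ?sqrtr_ge0// mulr_ge0 ?ltW.
apply: (le_trans (ler_wpM2r c1 depth_le)).
rewrite le_eqVlt; apply/orP; left; apply/eqP.
move: (lt0r_neq0 N0) (lt0r_neq0 sN0); move: (Num.sqrt N) N => u v h1 h2; field.
by rewrite h1 h2.
Qed.

End risk.

(** * Choice of the resolution *)

Section tradeoff.
Context {R : realType}.
Variables (N : R) (m : nat).
Hypotheses (N_ge2 : 2 <= N) (m_gt0 : (0 < m)%N)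
  (m_le : (2 ^ m)%:R <= 1 + N) (m_gt : 1 + N < (2 ^ m.+1)%:R).

Let N0 : 0 < N. Proof. by move: N_ge2; lra. Qed.

Let l2 : 0 < ln 2 :> R := ln2_gt0.

Let lN : ln 2 <= ln N. Proof. by rewrite ler_ln// posrE. Qed.

Let lN0 : 0 < ln N. Proof. exact: lt_le_trans lN. Qed.

Lemma sqrt_ratio : Num.sqrt (ln N) / Num.sqrt N = (N / ln N) `^ (- (1 / 2)).
Proof.
rewrite powRN mul1r powR12_sqrt ?divr_ge0 ?ltW// sqrtrM ?(ltW N0)//.
by rewrite sqrtrV ?(ltW lN0)// invfM invrK mulrC.
Qed.

Lemma finest_level_ge : N / 2 <= (2 ^ m)%:R.
Proof. by move: m_gt; rewrite expnS natrM; move: (2 ^ m)%:R => x; lra. Qed.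

Lemma depth_le_ln : m%:R <= 2 / ln 2 * ln N.
Proof.
rewrite mulrAC ler_pdivlMr// mulr_natl -lnXn// -natrX.
have -> : 2 * ln N = ln (N ^+ 2) by rewrite lnXn// mulr_natl.
rewrite ler_ln ?posrE ?exprn_gt0// ?ltr0n ?expn_gt0//.
by apply: le_trans m_le _; move: N_ge2; nra.
Qed.

(** At the finest level, a total smoothness of at least 1/2 makes the bias
    parametric. *)
Lemma finest_bias s : 1 / 2 <= s ->
  (2 ^ m)%:R `^ (- s) <= Num.sqrt 2 / Num.sqrt N.
Proof.
move=> s2; apply: (@le_trans _ _ ((2 ^ m)%:R `^ (- (1 / 2)))).
  by rewrite ler_powR ?lerN2// ler1n expn_gt0.
rewrite powRN mul1r powR12_sqrt// -[leRHS]invf_div.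
rewrite lef_pV2 ?posrE ?divr_gt0 ?sqrtr_gt0// ?ltr0n ?expn_gt0//.
by rewrite -sqrtrV// -sqrtrM ?(ltW N0)// ler_wsqrtr// finest_level_ge.
Qed.

Lemma parametric_le S : 1 <= S ->
  1 / Num.sqrt N <= (Num.sqrt (ln 2))^-1 * (S * Num.sqrt (ln N) / Num.sqrt N).
Proof.
move=> S1; rewrite mulrA ler_wpM2r ?invr_ge0 ?sqrtr_ge0//.
rewrite ler_pdivlMl ?sqrtr_gt0// mulr1 -[leLHS]mul1r ler_pM ?sqrtr_ge0//.
exact: ler_wsqrtr.
Qed.

(** The ideal cutoff [x] is rounded down to a power of two. When it exceeds the
    finest available cutoff, the latter is of order [N] and hence not much smaller
    than [x]. *)
Lemma balanced_level x : 1 <= x -> x <= N / ln N ->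
  exists2 L, (L < m)%N &
    (2 ^ L.+1)%:R <= 2 * x /\ ln 2 / 2 * x <= (2 ^ L.+1)%:R.
Proof.
move=> x1 xN; have x0 : 0 <= x by lra.
have l21 : ln 2 <= 1 :> R by apply: (@le_ln1Dx R 1); lra.
have t0 : (0 < Num.truncn x)%N by rewrite truncn_gt0.
have xt : (Num.truncn x)%:R <= x by rewrite truncn_le.
have [tm|tm] := ltnP (trunc_log 2 (Num.truncn x)) m.
  exists (trunc_log 2 (Num.truncn x)) => //; split.
    rewrite expnS natrM ler_wpM2l//; apply: le_trans xt.
    by rewrite ler_nat trunc_logP.
  apply: (@le_trans _ _ x); first by nra.
  apply: (@le_trans _ _ (Num.truncn x).+1%:R); first by rewrite ltW// truncnS_gt.
  by rewrite ler_nat trunc_log_ltn.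
exists m.-1; rewrite prednK//; split.
  apply: (@le_trans _ _ x); last lra; apply: le_trans xt.
  rewrite ler_nat; apply: leq_trans (trunc_logP (isT : 1 < 2)%N t0).
  by rewrite leq_exp2l.
apply: le_trans finest_level_ge; rewrite mulrAC ler_wpM2r//.
have : x <= N / ln 2.
  by apply: le_trans xN _; rewrite ler_wpM2l ?(ltW N0)// lef_pV2 ?posrE.
by rewrite ler_pdivlMr// mulrC.
Qed.

End tradeoff.

Section regimes.
Context {R : realType} (d : nat) (delta beta : R).
Hypotheses (d_gt0 : (0 < d)%N) (delta_gt0 : 0 < delta) (beta_gt0 : 0 < beta).
Local Notation k := ((1 - delta / d%:R) / 2).
Local Notation variance N L :=
  (geo k L ^+ d ^+ 2 * Num.sqrt (ln N) / Num.sqrt N).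
Local Notation bias L := ((2 ^ L.+1)%:R `^ (- (beta + delta))).

Let d0 : 0 < d%:R :> R. Proof. by rewrite ltr0n. Qed.

(** The rate [rho] is achieved by the best available level, uniformly in the
    effective sample size [N] and its number [m] of levels. *)
Definition attained (rho : R -> R) := exists2 K : R, 0 <= K &
  forall N m, 2 <= N -> (0 < m)%N ->
    (2 ^ m)%:R <= 1 + N -> 1 + N < (2 ^ m.+1)%:R ->
    exists2 L, (L < m)%N & variance N L <= K * rho N /\ bias L <= K * rho N.

(** When the variance term does not grow polynomially with the resolution, the
    finest level is optimal, the bias being parametric there. *)
Lemma attained_finest rho G : 0 <= G -> 1 / 2 <= beta + delta ->
  (forall N m, 2 <= N -> (0 < m)%N -> (2 ^ m)%:R <= 1 + N ->
    variance N m.-1 <= G * rho N) -> attained rho.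
Proof.
move=> G0 s2 h; pose c : R := Num.sqrt 2 / Num.sqrt (ln 2).
have c0 : 0 <= c by rewrite divr_ge0 ?sqrtr_ge0.
exists (G * (1 + c)); first by rewrite mulr_ge0// addr_ge0.
move=> N m N2 m0 mle mgt; have hv := h N m N2 m0 mle.
have v0 : 0 <= variance N m.-1.
  apply: divr_ge0; last exact: sqrtr_ge0.
  by apply: mulr_ge0; [exact: sqr_ge0|exact: sqrtr_ge0].
have rho0 : 0 <= G * rho N by exact: le_trans hv.
exists m.-1; first by rewrite prednK.
have -> : G * (1 + c) * rho N = G * rho N + G * rho N * c by ring.
split.
  by apply: le_trans hv _; rewrite lerDl mulr_ge0.
rewrite prednK//; apply: le_trans (finest_bias N2 mgt s2) _.
apply: (@le_trans _ _ (c * variance N m.-1)).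
  rewrite /c -[leRHS]mulrA -[X in Num.sqrt 2 * X <= _]mul1r ler_wpM2l ?sqrtr_ge0//.
  by apply: parametric_le => //; rewrite !exprn_ege1// geo_ge1.
by apply: le_trans (ler_wpM2l c0 hv) _; rewrite mulrC lerDr.
Qed.

(** The weights of the blocks are summable. *)
Lemma attained_smooth : d%:R < delta ->
  attained (fun N => (N / ln N) `^ (- (1 / 2))).
Proof.
move=> dd; have k0 : k < 0.
  by rewrite pmulr_llt0// subr_lt0 ltr_pdivlMr// mul1r.
have d1 : 1 <= d%:R :> R by rewrite ler1n.
have q1 : 2 `^ k < 1 :> R.
  by rewrite -[k]opprK powRN invf_lt1 ?powR_gt0// powR2_gt1// oppr_gt0.
apply: (attained_finest (G := ((1 - 2 `^ k)^-1) ^+ d ^+ 2)).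
- by rewrite sqr_ge0.
- by move: beta_gt0; lra.
- move=> N m N2 m0 mle; rewrite -sqrt_ratio// mulrA.
  rewrite !ler_wpM2r ?invr_ge0 ?sqrtr_ge0//.
  have g0 : 0 <= geo k m.-1 by apply: le_trans (geo_ge1 _ _).
  rewrite !lerXn2r ?nnegrE ?exprn_ge0 ?geo_neg ?invr_ge0//; lra.
Qed.

(** All blocks have weight 1, so that the total weight counts them: it is the
    number of levels to the power [d]. *)
Lemma attained_critical : delta = d%:R ->
  attained (fun N => (N / ln N ^+ (4 * d + 1)) `^ (- (1 / 2))).
Proof.
move=> dd; have d1 : 1 <= d%:R :> R by rewrite ler1n.
have l2 : 0 < ln 2 :> R := ln2_gt0.
have k0 : k = 0 by rewrite dd divff ?subrr ?mul0r// gt_eqF.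
apply: (attained_finest (G := (2 / ln 2) ^+ d ^+ 2)).
- by rewrite sqr_ge0.
- by move: beta_gt0; lra.
- move=> N m N2 m0 mle; rewrite k0 geo_zero prednK//.
  have N0 : 0 < N by apply: lt_le_trans N2.
  have lN0 : 0 < ln N by apply: ln_gt0; move: N2; lra.
  have -> : (N / ln N ^+ (4 * d + 1)) `^ (- (1 / 2)) =
      ln N ^+ d ^+ 2 * (Num.sqrt (ln N) / Num.sqrt N).
    rewrite powRN mul1r powR12_sqrt ?divr_ge0 ?exprn_ge0 ?ltW//.
    rewrite sqrtrM ?(ltW N0)// sqrtrV ?exprn_ge0 ?(ltW lN0)// invfM invrK mulrC.
    rewrite mulrA; congr (_ / _); rewrite addn1 exprSr (_ : 4 * d = (d * 2) * 2)%N; last by lia.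
    rewrite sqrtrM ?exprn_ge0 ?(ltW lN0)// exprM sqrtr_sqr ger0_norm ?exprn_ge0 ?(ltW lN0)//.
    by rewrite exprM.
  rewrite [leRHS]mulrA -[leLHS]mulrA ler_wpM2r ?divr_ge0 ?sqrtr_ge0// -!exprMn.
  rewrite !lerXn2r ?nnegrE ?exprn_ge0 ?mulr_ge0 ?invr_ge0 ?(ltW l2) ?(ltW lN0)//.
  exact: depth_le_ln.
Qed.

(** The total weight is dominated by the finest blocks. The cutoff
    [x = (N / ln N)^(1 / (2 beta + 2 d))] makes the bias [x^(-(beta + delta))] equal
    to the variance term [x^(d - delta) / sqrt (N / ln N)]. *)
Lemma attained_rough : delta < d%:R ->
  attained (fun N => (N / ln N) `^ (- ((beta + delta) / (2 * beta + 2 * d%:R)))).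
Proof.
move=> dd; have d1 : 1 <= d%:R :> R by rewrite ler1n.
have l2 : 0 < ln 2 :> R := ln2_gt0; set e := 2 * beta + 2 * d%:R.
have e0 : 0 < e by rewrite /e; move: beta_gt0; lra.
have e1 : 1 <= e by rewrite /e; move: beta_gt0; lra.
have k0 : 0 < k by rewrite divr_gt0// subr_gt0 ltr_pdivrMr// mul1r.
have q0 : 0 < 2 `^ k - 1 by rewrite subr_gt0 powR2_gt1.
have s0 : 0 < beta + delta by rewrite addr_gt0.
pose G := ((2 `^ k - 1)^-1) ^+ d ^+ 2.
have G0 : 0 <= G by rewrite sqr_ge0.
pose K := G * 2 `^ (d%:R - delta) + (ln 2 / 2) `^ (- (beta + delta)).
exists K; first by apply: addr_ge0; [apply: mulr_ge0 => //|]; exact: powR_ge0.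
move=> N m N2 m0 mle mgt; have N0 : 0 < N by apply: lt_le_trans N2.
have lN0 : 0 < ln N by apply: ln_gt0; move: N2; lra.
set M := N / ln N; have M1 : 1 <= M.
  rewrite ler_pdivlMr// mul1r; apply: ltW; exact: ln_sublinear.
have M0 : 0 < M by lra.
pose x := M `^ e^-1.
have x1 : 1 <= x by rewrite -(powRr0 M) ler_powR// invr_ge0 ltW.
have x0 : 0 < x by lra.
have xM : x <= M by rewrite -[leRHS]powRr1 ?(ltW M0)// ler_powR// invf_le1.
have [L Lm [Lx xL]] := balanced_level N2 m0 mgt x1 xM.
have p0 : 0 < (2 ^ L.+1)%:R :> R by rewrite ltr0n expn_gt0.
set rho := M `^ _; have rho0 : 0 <= rho by exact: powR_ge0.
exists L => //; rewrite [K * rho]mulrDl; split.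
  apply: (@le_trans _ _ (G * 2 `^ (d%:R - delta) * rho)); last first.
    by rewrite lerDl; apply: mulr_ge0 => //; exact: powR_ge0.
  rewrite -[leLHS]mulrA sqrt_ratio// -/M.
  have -> : rho = x `^ (d%:R - delta) * M `^ (- (1 / 2)).
    rewrite /rho /x -powRrM -powRD; last by rewrite (gt_eqF M0) implybT.
    by congr powR; rewrite /e; field; rewrite -/e gt_eqF.
  rewrite mulrA ler_wpM2r ?powR_ge0// -mulrA -powRM ?(ltW x0)//.
  have h : geo k L ^+ d ^+ 2 <= (((2 `^ k) ^+ L.+1) / (2 `^ k - 1)) ^+ d ^+ 2.
    have g0 : 0 <= geo k L by apply: le_trans (geo_ge1 _ _).
    by rewrite !lerXn2r ?nnegrE ?exprn_ge0 ?geo_pos ?divr_ge0 ?exprn_ge0 ?powR_ge0 ?(ltW q0).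
  apply: (le_trans h); rewrite !exprMn mulrC ler_wpM2l//.
  have -> : (2 `^ k) ^+ L.+1 ^+ d ^+ 2 = (2 ^ L.+1)%:R `^ (d%:R - delta).
    have e3 (y : R) : y ^+ L.+1 ^+ d ^+ 2 = y ^+ (L.+1 * d * 2) by rewrite !exprM.
    rewrite e3.
    rewrite natrX.
    rewrite -[LHS]powR_mulrn; last exact: powR_ge0.
    rewrite -[2 ^+ _]powR_mulrn; last exact: ler0n.
    rewrite -[LHS]powRrM.
    rewrite -[RHS]powRrM.
    congr powR.
    by rewrite !natrM; field; rewrite gt_eqF.
  by rewrite ge0_ler_powR ?nnegrE ?mulr_ge0 ?(ltW p0) ?(ltW x0)// subr_ge0 ltW.
apply: (@le_trans _ _ ((ln 2 / 2) `^ (- (beta + delta)) * rho)); last first.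
  by rewrite lerDr; do 2 apply: mulr_ge0 => //; exact: powR_ge0.
have -> : rho = x `^ (- (beta + delta)).
  by rewrite /rho /x -powRrM; congr powR; field; rewrite gt_eqF.
have c0 : 0 < ln 2 / 2 :> R by lra.
rewrite -powRM ?(ltW x0) ?(ltW c0)// !powRN lef_pV2 ?posrE ?powR_gt0 ?mulr_gt0//.
by rewrite ge0_ler_powR ?nnegrE ?(ltW s0) ?(ltW p0)// mulr_ge0 ?ltW.
Qed.

End regimes.

(** * Rates *)

Section threshold_bound.
Context {R : realType} (d n : nat) (A alpha delta : R).
Hypotheses (d_gt0 : (0 < d)%N) (n_gt0 : (0 < n)%N) (A_ge1 : 1 <= A)
  (alpha_gt0 : 0 < alpha) (delta_gt0 : 0 < delta).
Local Notation N := (n%:R * alpha ^+ 2).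
Hypothesis N_ge2 : 2 <= N.

Definition threshold_constant : R :=
  Num.sqrt 2 * tau d A * Num.sqrt (3 * d%:R + 3 / 2 + tau d A / ln 2).

Lemma threshold_constant_ge0 : 0 <= threshold_constant.
Proof.
apply: mulr_ge0; last exact: sqrtr_ge0.
apply: mulr_ge0; first exact: sqrtr_ge0.
by apply: le_trans (tau_ge2 d_gt0 A_ge1).
Qed.

(** Over the model collection, the logarithms of [J], of the total weight and of
    the noise level are at most of the order of [ln N]. *)
Lemma threshold_le L J : J = (2 ^ L.+1 - 1)%N -> J%:R <= N ->
  threshold d n A alpha delta J <= threshold_constant *
    (geo ((1 - delta / d%:R) / 2) L ^+ d ^+ 2 * Num.sqrt (ln N) / Num.sqrt N).
Proof.
move=> JE JN; have t2 := tau_ge2 d_gt0 A_ge1; have lN := lnN_ge N_ge2.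
have N0 := N_gt0 N_ge2; have l2 : 0 < ln 2 :> R := ln2_gt0.
have J0 : 0 < J%:R :> R by rewrite ltr0n JE subn_gt0 (ltn_exp2l 0).
set k := (1 - delta / d%:R) / 2; set S := geo k L ^+ d.
have Sig : Sigma_ d n alpha delta J = S ^+ 2 / Num.sqrt N.
  by rewrite Sigma_eq// (total_weightE _ _ JE).
have S1 : 1 <= S by rewrite exprn_ege1// geo_ge1.
have S0 : 0 < S by apply: lt_le_trans S1.
have lnJ : ln J%:R <= ln N by rewrite ler_ln.
have lnS : ln S <= d%:R * ln N.
  rewrite mulr_natl -lnXn// ler_ln; [|exact: S0|by rewrite posrE exprn_gt0].
  have g0 : 0 <= geo k L by apply: le_trans (geo_ge1 _ _).
  rewrite lerXn2r ?nnegrE ?(ltW N0)//; apply: le_trans JN; rewrite JE; apply: geo_le.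
  rewrite ler_pdivrMr// lerBlDr (_ : 1 * 2 = 1 + 1); last by rewrite mul1r.
  by rewrite -addrA lerDl addr_ge0// divr_ge0 ?ltW// ltr0n.
have t0 : 0 < tau d A by apply: lt_le_trans t2.
have sN0 : 0 < Num.sqrt N by rewrite sqrtr_gt0.
have lntau : ln (tau d A) <= tau d A / ln 2 * ln N.
  apply: (@le_trans _ _ (tau d A)); first by apply: ltW; exact: ln_sublinear.
  by rewrite mulrAC ler_pdivlMr// ler_wpM2l// ltW.
have lnTS : ln (tau d A * Sigma_ d n alpha delta J) =
    ln (tau d A) + 2 * ln S - ln N / 2.
  have S2 : 0 < S ^+ 2 by exact: exprn_gt0.
  rewrite Sig lnM ?posrE ?divr_gt0// ln_div ?posrE//.
  by rewrite lnXn// ln_sqrtN// -[ln S *+ 2]mulr_natl addrA.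
have ex : exponent d n A alpha delta J <=
    (3 * d%:R + 3 / 2 + tau d A / ln 2) * ln N.
  rewrite /exponent lnTS.
  have h : d%:R * ln J%:R <= d%:R * ln N by rewrite ler_wpM2l.
  have lN0 : 0 < ln N by apply: lt_le_trans lN.
  move: h lnS lntau lN0; move: (tau d A / ln 2) (ln N) (ln J%:R) (ln S) (ln (tau d A)).
  by move=> q a b c e; rewrite !mulrDl; lra.
rewrite /threshold -/(exponent d n A alpha delta J) Sig /threshold_constant.
set c := 3 * _ + _ + _ in ex *.
have c0 : 0 <= c.
  rewrite /c; apply: addr_ge0; last by rewrite divr_ge0 ?ltW.
  by rewrite addr_ge0// mulr_ge0.
rewrite [leRHS](_ : _ = Num.sqrt 2 * tau d A * (S ^+ 2 / Num.sqrt N) *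
    (Num.sqrt c * Num.sqrt (ln N))); last by ring.
rewrite ler_wpM2l//; last by rewrite -sqrtrM// ler_wsqrtr.
apply: mulr_ge0; first by apply: mulr_ge0; [exact: sqrtr_ge0|exact: ltW].
by apply: divr_ge0; [exact: sqr_ge0|exact: sqrtr_ge0].
Qed.

End threshold_bound.

Theorem corollary2p1 (R : realType) (d : nat) (A delta beta r : R)
    (hd : (1 <= d)%N) (hA : 1 <= A) (hdelta : 0 < delta) (hbeta : 0 < beta)
    (hr : 0 < r) (hrd : d%:R <= r ^+ 2) :
  exists C : R,
    forall (n : nat) (alpha : R),
      (1 <= n)%N -> 0 < alpha -> alpha <= A -> 2 <= n%:R * alpha ^+ 2 ->
    forall (disp : measure_display) (Omega : measurableType disp)
      (P : (vec R d -> R) -> probability Omega R)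
      (X : 'I_n -> {mfun Omega >-> vec R d})
      (Z : forall J, 'I_n -> mindex d J -> {mfun Omega >-> R})
      (Jhat : {mfun Omega >-> nat}),
      (forall f, sobolev d beta r f -> density d f ->
         privatized_sample alpha delta (P f) f X Z) ->
      (forall w, is_selected A alpha delta (fun J i j => Z J i j w) (Jhat w)) ->
      (ereal_sup
         [set \int[P f]_w adversarial_loss (sobolev d delta 1)
                (estimator (fun J i j => Z J i j w) (Jhat w)) f
         | f in sobolev d beta r `&` density d]
       <= (C * rate d n alpha delta beta)%:E)%E.
Proof.
have [K K0 hK] : attained d delta beta (fun N =>
    if delta < d%:R then (N / ln N) `^ (- ((beta + delta) / (2 * beta + 2 * d%:R)))
    else if delta == d%:R then (N / ln N ^+ (4 * d + 1)) `^ (- (1 / 2))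
    else (N / ln N) `^ (- (1 / 2))).
  case: (ltrgtP delta d%:R) => [dd|dd|dd]; [exact: attained_rough| |].
    exact: attained_smooth.
  exact: attained_critical.
pose c := threshold_constant d A.
pose c' : R := 5 * noise_constant / Num.sqrt (ln 2).
exists ((7 * c + c' + 5 * r) * K) => n alpha n0 a0 aA N2 disp Omega P X Z Jhat law sel.
have [L Lm [hv hb]] := hK _ _ N2 (depth_gt0 N2) (pow2_depth_le N2) (pow2_depth_gt N2).
rewrite -/(rate d n alpha delta beta) in hv hb.
set rho := rate _ _ _ _ _ in hv hb *.
pose J := (2 ^ L.+1 - 1)%N; have JM : J \in models n alpha by apply/modelsE; exists L.
have J1 : J.+1 = (2 ^ L.+1)%N by rewrite /J subn1 prednK// expn_gt0.
have JN := models_le N2 JM.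
apply: ge_ereal_sup => _ [f [sob dens] <-].
apply: le_trans (risk_bound hd n0 hA a0 aA hdelta hbeta hr N2 sob dens (law _ sob dens) sel JM) _.
rewrite lee_fin J1.
have hV := threshold_le hd n0 hA a0 hdelta N2 (erefl J) JN.
have c0 : 0 <= c := threshold_constant_ge0 hd hA.
have hp : 1 / Num.sqrt (n%:R * alpha ^+ 2) <= (Num.sqrt (ln 2))^-1 * (K * rho).
  apply: le_trans (parametric_le N2 _) (ler_wpM2l _ hv).
    by rewrite !exprn_ege1// geo_ge1.
  by rewrite invr_ge0 sqrtr_ge0.
have n1 : 0 <= noise_constant :> R by rewrite /noise_constant !divr_ge0 ?sqrtr_ge0.
have h1 := le_trans hV (ler_wpM2l c0 hv).
have h2 := ler_wpM2l n1 hp.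
have h3 := ler_wpM2l (ltW hr) hb.
rewrite [leRHS](_ : _ = 7 * (c * (K * rho)) +
   5 * (noise_constant * ((Num.sqrt (ln 2))^-1 * (K * rho))) + 5 * (r * (K * rho))); last first.
  by rewrite /c'; ring.
rewrite mul1r in h2.
by rewrite !lerD// ler_wpM2l.
Qed.
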